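(* There exist a parameter $\beta>0$ and, for each $Q\in\mathbb{S}^+_{r_1}$, constants $\alpha_1(Q),\alpha_2(Q)$ whose values only depend on $Q$, such that for any $x\in\mathbb{R}^{r_1}$, any $Q\in\mathbb{S}^+_{r_1}$, any $\delta\geq0$, any $s\ge0$ and any $t\in[s,\infty[$, the conditional probability, given the state variable $X_s$, of the event $$\left\Vert\psi_{s,t}(x,Q)-\varphi_{s,t}(X_s)\right\Vert_2\leq\alpha_1(Q)\,e^{-\beta(t-s)}\,\Vert x-X_s\Vert_2+\alpha_2(Q)\left[1+\delta+\sqrt{\delta}\right]$$ is greater than $1-e^{-\delta}$.
   Context: Let $r_1,r_2\ge 1$. $\mathbb{S}^+_{r}$ is the set of real symmetric positive definite $(r\times r)$-matrices, $'$ denotes transpose, and $\Vert\cdot\Vert_2$ is the Euclidean norm on vectors. Model (time-invariant, fixed throughout): $A\in\mathbb{R}^{r_1\times r_1}$, $C\in\mathbb{R}^{r_2\times r_1}$, $R_1\in\mathbb{S}^+_{r_1}$, $R_2\in\mathbb{S}^+_{r_2}$ are constant, with symmetric square roots $R_1^{1/2},R_2^{1/2}$, and $S:=C'R_2^{-1}C$. The signal $X$ and observation $Y$ satisfy $$dX_t=AX_t\,dt+R_1^{1/2}dW_t,\qquad dY_t=CX_t\,dt+R_2^{1/2}dV_t,\qquad Y_0=0,$$ where $(W,V)$ is an $(r_1+r_2)$-dimensional standard Brownian motion and $X_0$ is an independent $\mathbb{R}^{r_1}$-valued random vector (not necessarily Gaussian) with finite mean and covariance. Observability/controllability (standing assumption):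 the matrices $[R_1^{1/2},AR_1^{1/2},\ldots,A^{r_1-1}R_1^{1/2}]$ and $[C',(CA)',\ldots,(CA^{r_1-1})']'$ both have rank $r_1$. Flows, for $0\le s\le t$, $x\in\mathbb{R}^{r_1}$, $Q\in\mathbb{S}^+_{r_1}$: - Riccati flow: $\partial_t\phi_{s,t}(Q)=A\phi_{s,t}(Q)+\phi_{s,t}(Q)A'-\phi_{s,t}(Q)S\phi_{s,t}(Q)+R_1$, $\phi_{s,s}(Q)=Q$. - Signal flow: $d\varphi_{s,t}(x)=A\varphi_{s,t}(x)\,dt+R_1^{1/2}dW_t$, $\varphi_{s,s}(x)=x$ (so $X_t=\varphi_{s,t}(X_s)$). - Kalman-Bucy filter flow: $d\psi_{s,t}(x,Q)=[A-\phi_{s,t}(Q)S]\psi_{s,t}(x,Q)\,dt+\phi_{s,t}(Q)C'R_2^{-1}dY_t$, $\psi_{s,s}(x,Q)=x$. *)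

(* Defs.v *)
From HB Require Import structures.
From mathcomp Require Import all_boot all_order all_algebra.
From mathcomp Require Import all_classical all_reals all_analysis.

Set Implicit Arguments.
Unset Strict Implicit.
Unset Printing Implicit Defensive.

Import Order.TTheory GRing.Theory Num.Theory.
Import numFieldNormedType.Exports.

Local Open Scope classical_set_scope.
Local Open Scope ring_scope.

(* The library's norm on matrices is the sup norm. *)
Definition norm2 {R : realType} {n : nat} (v : 'cV[R]_n) : R :=
  Num.sqrt (\sum_(i < n) v i 0 ^+ 2).

Definition spdmx {R : realType} {n : nat} (Q : 'M[R]_n) : Prop :=
  Q^T = Q /\ forall v : 'cV[R]_n, v != 0 -> 0 < (v^T *m Q *m v) 0 0.

Definition is_sym_sqrtmx {R : realType} {n : nat} (Q Qh : 'M[R]_n) : Prop :=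
  Qh^T = Qh /\ Qh *m Qh = Q.

Definition controllable {R : realType} {r : nat} (A B : 'M[R]_r) : Prop :=
  \rank (\mxrow_(j < r) (A ^+ j *m B)) = r.

Definition observable {R : realType} {r1 r2 : nat}
    (A : 'M[R]_r1) (C : 'M[R]_(r2, r1)) : Prop :=
  \rank (\mxcol_(i < r1) (C *m A ^+ i)) = r1.

(* The derivative at [t = s] is not required separately: by continuity of the
   right-hand side it exists as a one-sided derivative with the right value. *)
Definition is_riccati_flow {R : realType} {r : nat} (A S R1 : 'M[R]_r)
    (phi : R -> R -> 'M[R]_r -> 'M[R]_r) : Prop :=
  forall (s : R) (Q : 'M[R]_r), 0 <= s -> spdmx Q ->
    [/\ phi s s Q = Q,
        {within `[s, +oo[, continuous (fun t => phi s t Q)} &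
        forall t, s < t ->
          is_derive t (1 : R) (fun u => phi s u Q)
            (A *m phi s t Q + phi s t Q *m A^T
             - phi s t Q *m S *m phi s t Q + R1)].

Definition mxcoord {R : realType} {T : Type} {n : nat} (Z : T -> 'cV[R]_n)
  (i : 'I_n) (w : T) : R := Z w i 0.

Definition random_vector {R : realType} {d : measure_display}
    {T : measurableType d} {n : nat} (Z : T -> 'cV[R]_n) : Prop :=
  forall i, measurable_fun [set: T] (mxcoord Z i).

Definition sigma_rv {R : realType} {T : Type} {n : nat} (Z : T -> 'cV[R]_n) :
    set (set T) :=
  g_sigma_preimage (mxcoord Z).

Definition sigma_process {R : realType} {T : Type} {n : nat} (D : set R)
    (Z : R -> T -> 'cV[R]_n) : set (set T) :=
  <<s \bigcup_(t in D) sigma_rv (Z t) >>.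

Definition indep_sigma {R : realType} {d : measure_display}
    {T : measurableType d} (P : probability T R) (F G : set (set T)) : Prop :=
  forall A B : set T, F A -> G B -> P (A `&` B) = (P A * P B)%E.

(* The last clause says that [B t - B s] has law N(0, (t - s) I): by the
   pi-lambda theorem it is enough to give its values on boxes. The second
   argument of [normal_prob] is the standard deviation. *)
Definition is_brownian {R : realType} {d : measure_display}
    {T : measurableType d} (P : probability T R) {n : nat}
    (B : R -> T -> 'cV[R]_n) : Prop :=
  [/\ forall t, 0 <= t -> random_vector (B t),
      \forall w \ae P, B 0 w = 0,
      \forall w \ae P, {within `[0, +oo[, continuous (fun t => B t w)},
      forall s t, 0 <= s -> s < t ->
        indep_sigma P (sigma_rv (fun w => B t w - B s w))
          (sigma_process `[0, s] B) &
      forall (s t : R) (D : 'I_n -> set R), 0 <= s -> s < t ->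
        (forall i, measurable (D i)) ->
        P [set w | forall i, D i ((B t w - B s w) i 0)]
        = (\prod_(i < n) normal_prob 0 (Num.sqrt (t - s)) (D i))%E].

Definition mxintegral {R : realType} {n : nat} (s t : R) (f : R -> 'cV[R]_n) :
    'cV[R]_n :=
  \col_i \int[lebesgue_measure]_(u in `[s, t]) f u i 0.

(* Integral form of [dZ_t = F_t Z_t dt + dN_t], [Z_s = z], for one realization,
   where [N t] is the driving term accumulated over [s, t]. *)
Definition solves_linear_sde {R : realType} {r : nat} (F : R -> 'M[R]_r)
    (N : R -> 'cV[R]_r) (s : R) (z : 'cV[R]_r) (Z : R -> 'cV[R]_r) : Prop :=
  {within `[s, +oo[, continuous Z} /\
  forall t, s <= t -> Z t = z + mxintegral s t (fun u => F u *m Z u) + N t.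

Definition riemann_sum {R : realType} {m n : nat} (G : R -> 'M[R]_(m, n))
    (Y : R -> 'cV[R]_n) (s t : R) (k : nat) : 'cV[R]_m :=
  let u (j : nat) := s + (t - s) * j%:R / k%:R in
  \sum_(j < k) G (u j) *m (Y (u j.+1) - Y (u j)).

(* [J] is the Ito integral of the deterministic function [G] against the process
   [Y] over [s, t]. For a continuous [G] and a continuous semimartingale [Y] the
   limit in probability of the left-point sums exists and is the Ito integral. *)
Definition is_stoch_integral {R : realType} {d : measure_display}
    {T : measurableType d} (P : probability T R) {m n : nat}
    (G : R -> 'M[R]_(m, n)) (Y : R -> T -> 'cV[R]_n) (s t : R)
    (J : T -> 'cV[R]_m) : Prop :=
  random_vector J /\
  forall e : R, 0 < e ->
    (fun k : nat =>
       P [set w | e <= norm2 (riemann_sum G (fun u => Y u w) s t k - J w)])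
      @ \oo --> 0%E.

Definition is_signal {R : realType} {d : measure_display}
    {T : measurableType d} (P : probability T R) {r1 : nat} (A R1h : 'M[R]_r1)
    (W X : R -> T -> 'cV[R]_r1) : Prop :=
  (forall t, 0 <= t -> random_vector (X t)) /\
  \forall w \ae P, solves_linear_sde (fun=> A) (fun t => R1h *m W t w) 0 (X 0 w)
                     (fun t => X t w).

Definition is_observation {R : realType} {d : measure_display}
    {T : measurableType d} (P : probability T R) {r1 r2 : nat}
    (C : 'M[R]_(r2, r1)) (R2h : 'M[R]_r2) (V : R -> T -> 'cV[R]_r2)
    (X : R -> T -> 'cV[R]_r1) (Y : R -> T -> 'cV[R]_r2) : Prop :=
  (forall t, 0 <= t -> random_vector (Y t)) /\
  \forall w \ae P, forall t, 0 <= t ->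
    Y t w = mxintegral 0 t (fun u => C *m X u w) + R2h *m V t w.

(* The flow is evaluated at random points: it is a jointly measurable random
   field (the Borel sigma-algebra of the state space being that of [r1.-tuple R])
   and the exceptional null set does not depend on the starting point. *)
Definition is_signal_flow {R : realType} {d : measure_display}
    {T : measurableType d} (P : probability T R) {r1 : nat} (A R1h : 'M[R]_r1)
    (W : R -> T -> 'cV[R]_r1)
    (varphi : R -> R -> 'cV[R]_r1 -> T -> 'cV[R]_r1) : Prop :=
  forall s, 0 <= s ->
    (forall t (i : 'I_r1), s <= t ->
       measurable_fun [set: (r1.-tuple R * T)%type]
         (fun p : r1.-tuple R * T =>
            varphi s t (\col_j tnth p.1 j) p.2 i 0)) /\
    \forall w \ae P, forall x : 'cV[R]_r1,
      solves_linear_sde (fun=> A) (fun t => R1h *m (W t w - W s w)) s x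
        (fun t => varphi s t x w).

Definition is_filter_flow {R : realType} {d : measure_display}
    {T : measurableType d} (P : probability T R) {r1 r2 : nat}
    (A S : 'M[R]_r1) (C : 'M[R]_(r2, r1)) (R2 : 'M[R]_r2)
    (phi : R -> R -> 'M[R]_r1 -> 'M[R]_r1) (Y : R -> T -> 'cV[R]_r2)
    (psi : R -> R -> 'cV[R]_r1 -> 'M[R]_r1 -> T -> 'cV[R]_r1) : Prop :=
  forall (s : R) (x : 'cV[R]_r1) (Q : 'M[R]_r1), 0 <= s -> spdmx Q ->
    (forall t, s <= t -> random_vector (psi s t x Q)) /\
    exists J : R -> T -> 'cV[R]_r1,
      (forall t, s <= t ->
         is_stoch_integral P (fun u => phi s u Q *m C^T *m invmx R2) Y s t (J t))
      /\ \forall w \ae P,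
           solves_linear_sde (fun u => A - phi s u Q *m S) (fun t => J t w) s x
             (fun t => psi s t x Q w).

Definition is_cond_prob {R : realType} {d : measure_display}
    {T : measurableType d} (P : probability T R) (G : set (set T)) (E : set T)
    (p : T -> R) : Prop :=
  [/\ forall B : set R, measurable B -> G (p @^-1` B),
      P.-integrable [set: T] (EFin \o p) &
      forall A : set T, G A ->
        (\int[P]_(w in A) (p w)%:E = P (E `&` A))%E].

(* A version of the conditional probability of [E] given the sub-sigma-algebra
   [G]; two versions agree almost surely. The default value is only used when no
   version exists (e.g. because [E] is not measurable). *)
Definition cond_prob {R : realType} {d : measure_display}
    {T : measurableType d} (P : probability T R) (G : set (set T)) (E : set T) :
    T -> R :=
  xget (fun=> 0) [set p | is_cond_prob P G E p].

(* Main.v *)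
Require Import Defs.
From HB Require Import structures.
From mathcomp Require Import all_boot all_order all_algebra.
From mathcomp Require Import all_classical all_reals all_analysis.
From mathcomp Require Import measurable_realfun ring lra.

(** The filter error [e = psi - X] solves a linear equation on [[s, t]]: with
[P u = phi s u Q] and [S = C' R2^-1 C], its drift is [(A - P S) e] and it is
driven by [- R1^{1/2} dW + P C' R2^{-1/2} dV]. Let [L] be the backward
transition matrix of that drift, [L t = 1] and [L' = - L (A - P S)]. Variation of
constants gives [e t = L s (x - X s) + Z], where [Z] is the Wiener integral of
the noise coefficients multiplied by [L], independent of the past of [s].

Both terms are controlled by one identity ([transported_cov]):
[(L P L^T)' = L (R1 + P S P) L^T]. The right-hand side is the covariance of the
noise that drives [L e]. Observability gives a Lyapunov matrix
([observable_lyapunov]) and hence a bound on [P t] that forgets the size of [Q]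
exponentially fast ([riccati_upper]). As [R1] is positive definite, it dominates
[P], so that [L P L^T] grows at an exponential rate that does not depend on [Q];
read backwards from [L t = 1] this bounds [norm2 (L s v)] by
[alpha1 Q * exp (- beta (t - s)) * norm2 v] ([transition_decay],
[riccati_estimates]). For the random term, the same identity shows that the i-th
coordinate of [Z] has variance [(P t - L s P s (L s)^T) i i], which is bounded in
terms of [Q] alone ([quadratic_variation]).

The exponential moments of [Z] are estimated on Riemann sums. Given the past of
[s], one increment of the Brownian motion after the other is integrated out with
the Gaussian moment generating function; Jensen's inequality separates the
[r1 + r2] coordinates of an increment at the price of a factor in the exponent
([increment_mgf], [gaussian_sum_mgf]), and Fatou's lemma passes to the limit
([riemann_limit_mgf]). Chernoff's bound and a union over the coordinates show, for
every event [F] of the past of [s], that some coordinate of [Z] exceeds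
[delta + b Q] on a part of [F] of probability at most [exp (- 1 - delta) * P F]
([riemann_limit_vector_tail], [filter_deviation]). Since [X s] is measurable with
respect to that past ([sigma_signal_past]), [F] may range over the
sigma-algebra of [X s], which is the claim about the conditional probability
([cond_prob_ge]).

All stochastic integrals have integrands that are differentiable in time, so that
summation by parts makes their Riemann sums converge along each path
([riemann_sum_parts]). The equations of the signal, of the observation and of the
filter therefore become linear equations driven by continuous paths, one
realization at a time ([voc_riemann], [filter_error_riemann]); the limit in
probability that defines an Ito integral agrees almost surely with the pathwise
limit ([cvg_in_prob_unique]). *)

Set Implicit Arguments.
Unset Strict Implicit.
Unset Printing Implicit Defensive.

Import Order.TTheory GRing.Theory Num.Theory.
Import numFieldNormedType.Exports.

Local Open Scope classical_set_scope.
Local Open Scope ring_scope.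

(** * Continuity and primitives on a segment *)

Definition cts {R : realType} (a b : R) (f : R -> R) : Prop :=
  {within `[a, b], continuous f}.

(** Continuity on the closed segment and a derivative inside it: this is what
    the mean value theorem uses, and what a flow started at [a] provides, its
    derivative at [a] being one-sided. *)
Definition prim {R : realType} (a b : R) (F f : R -> R) : Prop :=
  cts a b F /\ forall u, a < u < b -> is_derive u (1 : R) F (f u).

Lemma ctsP (R : realType) (a b : R) (f : R -> R) :
  cts a b f <-> forall x, a <= x <= b -> f @ within `[a, b] (nbhs x) --> f x.
Proof.
by rewrite /cts subspace_continuousP; split => h x hx; apply: h; move: hx;
  rewrite /= in_itv.
Qed.

Lemma cts_eq (R : realType) (a b : R) (f g : R -> R) :
  (forall x, a <= x <= b -> f x = g x) -> cts a b f -> cts a b g.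
Proof.
move=> fg; apply: subspace_eq_continuous => x; rewrite inE/= in_itv/=.
exact: fg.
Qed.

Lemma cts_cst (R : realType) (a b c : R) : cts a b (fun=> c).
Proof. by apply/ctsP => x _; exact: cvg_cst. Qed.

Lemma cts_id (R : realType) (a b : R) : cts a b id.
Proof. by apply/ctsP => x _; exact: cvg_within. Qed.

Lemma ctsD (R : realType) (a b : R) (f g : R -> R) :
  cts a b f -> cts a b g -> cts a b (fun u => f u + g u).
Proof. by move=> /ctsP hf /ctsP hg; apply/ctsP => x hx; apply: cvgD; [exact: hf|exact: hg]. Qed.

Lemma ctsM (R : realType) (a b : R) (f g : R -> R) :
  cts a b f -> cts a b g -> cts a b (fun u => f u * g u).
Proof. by move=> /ctsP hf /ctsP hg; apply/ctsP => x hx; apply: cvgM; [exact: hf|exact: hg]. Qed.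

Lemma ctsN (R : realType) (a b : R) (f : R -> R) :
  cts a b f -> cts a b (fun u => - f u).
Proof. by move=> /ctsP hf; apply/ctsP => x hx; apply: (@cvgN _ R^o); exact: hf. Qed.

Lemma cts_comp (R : realType) (a b : R) (f g : R -> R) :
  continuous g -> cts a b f -> cts a b (fun u => g (f u)).
Proof.
move=> hg /ctsP hf; apply/ctsP => x hx.
by apply: (cvg_comp _ _ (hf x hx)); exact: hg.
Qed.

Lemma cts_sum (R : realType) (a b : R) (I : Type) (r : seq I) (f : I -> R -> R) :
  (forall i, cts a b (f i)) -> cts a b (fun u => \sum_(i <- r) f i u).
Proof.
move=> hf; elim: r => [|i r IH].
  by apply: (@cts_eq _ _ _ (fun=> 0)); [move=> x _; rewrite big_nil|exact: cts_cst].
by apply: cts_eq (ctsD (hf i) IH) => x _; rewrite big_cons.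
Qed.

Lemma cts_sub (R : realType) (a b c d : R) (f : R -> R) :
  a <= c -> d <= b -> cts a b f -> cts c d f.
Proof.
move=> ac db; apply: continuous_subspaceW => x /=; rewrite !in_itv/= => /andP[cx xd].
by rewrite (le_trans ac)//= (le_trans xd).
Qed.

Lemma cts_bounded (R : realType) (a b : R) (f : R -> R) : cts a b f ->
  exists2 K : R, 0 < K & forall x, a <= x <= b -> `|f x| <= K.
Proof.
move=> cf.
have /compact_bounded[M [_ hM]] := continuous_compact cf (@segment_compact R a b).
exists (`|M| + 1); first by rewrite ltr_wpDl.
move=> x hx; apply: hM; first by rewrite (le_lt_trans (ler_norm _))// ltrDl.
by exists x => //=; rewrite in_itv.
Qed.

(** Heine's theorem, from the near-covering property of the segment. *)
Lemma cts_uniform (R : realType) (a b : R) (f : R -> R) : cts a b f ->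
  forall e : R, 0 < e -> exists2 d : R, 0 < d &
    forall x y, a <= x <= b -> a <= y <= b -> `|x - y| < d -> `|f x - f y| < e.
Proof.
move=> /ctsP cf e e0.
have : \forall d \near (0:R)^'+, `[a, b] `<=`
    (fun x => forall y, a <= y <= b -> `|x - y| < d -> `|f x - f y| < e).
  have /compact_near_coveringP/near_covering_withinP := @segment_compact R a b.
  apply => x /=; rewrite in_itv/= => hx.
  have := cf x hx => /cvgrPdist_lt/(_ (e / 2)); rewrite divr_gt0// => /(_ isT).
  rewrite /within/= => /nbhs_ballP[r /= r0 hr].
  have r20 : 0 < r / 2 by rewrite divr_gt0.
  exists (ball x (r / 2), [set d | d < r / 2]) => /=.
    split; first exact: nbhsx_ballx.
    by apply: nbhs_right_lt.
  move=> [x' d] [/= xx' dr]; rewrite in_itv/= => hx' y hy x'y.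
  have h1 : `|f x - f x'| < e / 2.
    apply: hr; last by rewrite in_itv.
    by apply: le_ball xx'; rewrite ler_pdivrMr// ler_peMr ?ler1n// ltW.
  have h2 : `|f x - f y| < e / 2.
    apply: hr; last by rewrite in_itv.
    rewrite /ball/= (splitr r) -(subrKA x').
    apply: le_lt_trans (ler_normD _ _) _; apply: ltrD => //.
    exact: lt_trans dr.
  rewrite -(subrKA (f x)) (splitr e).
  apply: le_lt_trans (ler_normD _ _) _; apply: ltrD => //.
  by rewrite distrC.
move=> H.
have [d [d0 hd]] := filter_ex (filterI (nbhs_right_gt (0:R)) H).
by exists d => // x y hx; apply: hd; rewrite /= in_itv.
Qed.

Lemma prim_cts (R : realType) (a b : R) (F f : R -> R) : prim a b F f -> cts a b F.
Proof. by case. Qed.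

Lemma prim_sub (R : realType) (a b c d : R) (F f : R -> R) :
  a <= c -> d <= b -> prim a b F f -> prim c d F f.
Proof.
move=> ac db [cF dF]; split; first exact: cts_sub cF.
move=> u /andP[cu ud]; apply: dF.
by rewrite (le_lt_trans ac cu) (lt_le_trans ud db).
Qed.

Lemma prim_eq (R : realType) (a b : R) (F f g : R -> R) :
  (forall u, a < u < b -> f u = g u) -> prim a b F f -> prim a b F g.
Proof. by move=> fg [cF dF]; split=> // u hu; rewrite -fg//; exact: dF. Qed.

Lemma prim_cst (R : realType) (a b c : R) : prim a b (fun=> c) (fun=> 0).
Proof. by split; [exact: cts_cst|move=> u _; exact: is_derive_cst]. Qed.

Lemma prim_id (R : realType) (a b : R) : prim a b id (fun=> 1).
Proof. by split; [exact: cts_id|move=> u _; exact: is_derive_id]. Qed.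

Lemma primD (R : realType) (a b : R) (F f G g : R -> R) :
  prim a b F f -> prim a b G g -> prim a b (fun u => F u + G u) (fun u => f u + g u).
Proof.
move=> [cF dF] [cG dG]; split; first exact: ctsD.
by move=> u hu; have ? := dF u hu; have ? := dG u hu; exact: is_deriveD.
Qed.

Lemma primN (R : realType) (a b : R) (F f : R -> R) :
  prim a b F f -> prim a b (fun u => - F u) (fun u => - f u).
Proof.
move=> [cF dF]; split; first exact: ctsN.
by move=> u hu; have ? := dF u hu; exact: is_deriveN.
Qed.

Lemma primB (R : realType) (a b : R) (F f G g : R -> R) :
  prim a b F f -> prim a b G g -> prim a b (fun u => F u - G u) (fun u => f u - g u).
Proof. by move=> hF hG; apply: primD => //; exact: primN. Qed.

Lemma primM (R : realType) (a b : R) (F f G g : R -> R) :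
  prim a b F f -> prim a b G g ->
  prim a b (fun u => F u * G u) (fun u => f u * G u + F u * g u).
Proof.
move=> [cF dF] [cG dG]; split; first exact: ctsM.
move=> u hu; have ? := dF u hu; have ? := dG u hu.
have := @is_deriveM R _ F G u 1 (f u) (g u) (dF u hu) (dG u hu).
by move/is_derive_eq; apply; rewrite /GRing.scale/= addrC mulrC.
Qed.

Lemma primZ (R : realType) (a b c : R) (F f : R -> R) :
  prim a b F f -> prim a b (fun u => c * F u) (fun u => c * f u).
Proof.
move=> hF; apply: prim_eq (primM (prim_cst a b c) hF) => u _.
by rewrite mul0r add0r.
Qed.

Lemma prim_sum (R : realType) (a b : R) (I : Type) (r : seq I) (F f : I -> R -> R) :
  (forall i, prim a b (F i) (f i)) ->
  prim a b (fun u => \sum_(i <- r) F i u) (fun u => \sum_(i <- r) f i u).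
Proof.
move=> hf; elim: r => [|i r IH].
  have -> : (fun u => \sum_(i <- [::]) F i u) = (fun=> 0) by apply/funext => u; rewrite big_nil.
  by apply: prim_eq (prim_cst a b 0) => u _; rewrite big_nil.
have -> : (fun u => \sum_(j <- i :: r) F j u) = (fun u => F i u + \sum_(j <- r) F j u).
  by apply/funext => u; rewrite big_cons.
by apply: prim_eq (primD (hf i) IH) => u _; rewrite big_cons.
Qed.

Lemma prim_expR (R : realType) (a b k : R) :
  prim a b (fun u => expR (k * u)) (fun u => k * expR (k * u)).
Proof.
split.
  apply: cts_comp; first exact: continuous_expR.
  by apply: ctsM; [exact: cts_cst|exact: cts_id].
move=> u _.
have h : is_derive u (1:R) ( *%R k) k.
  have := @is_deriveZ R R R id k u 1 1 (is_derive_id _ _).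
  by move/is_derive_eq; apply; rewrite /GRing.scale/= mulr1.
have := @is_derive1_comp R expR ( *%R k) u (expR (k * u)) k.
move=> /(_ (is_derive_expR _) h).
by rewrite mulrC.
Qed.

(** The degenerate segment [a = b] is included, which is why the strict
    location of [c] is conditional. *)
Lemma prim_mvt (R : realType) (a b : R) (F f : R -> R) : a <= b -> prim a b F f ->
  exists2 c, a <= c <= b & (a < b -> a < c < b) /\ F b - F a = f c * (b - a).
Proof.
move=> ab [cF dF]; move: ab; rewrite le_eqVlt => /predU1P[<-|ab].
  by exists a; rewrite ?lexx ?ltxx// !subrr mulr0.
have dF' x : x \in `]a, b[ -> is_derive x 1 F (f x) by rewrite in_itv; exact: dF.
have [c + ->] := MVT ab dF' cF; rewrite in_itv/= => cab.
by exists c => //; case/andP: cab => /ltW-> /ltW->.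
Qed.

Lemma prim_le (R : realType) (a b K : R) (F f : R -> R) : a <= b -> prim a b F f ->
  (forall u, a < u < b -> f u <= K) -> F b - F a <= K * (b - a).
Proof.
move=> ab hF hf; have [c _ [hc ->]] := prim_mvt ab hF.
move: ab; rewrite le_eqVlt => /predU1P[->|ab]; first by rewrite subrr !mulr0.
by rewrite ler_wpM2r ?subr_ge0 ?(ltW ab)// hf// hc.
Qed.

Lemma prim_norm_le (R : realType) (a b K : R) (F f : R -> R) : a <= b -> prim a b F f ->
  (forall u, a < u < b -> `|f u| <= K) -> `|F b - F a| <= K * (b - a).
Proof.
move=> ab hF hf; rewrite ler_norml; apply/andP; split.
  rewrite lerNl.
  have := @prim_le _ _ _ K _ _ ab (primN hF).
  rewrite opprK addrC -opprB; apply => u hu.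
  by rewrite (le_trans (ler_norm _))// normrN hf.
by apply: prim_le ab hF _ => u hu; rewrite (le_trans (ler_norm _))// hf.
Qed.

Lemma prim_homo (R : realType) (a b : R) (F f : R -> R) : prim a b F f ->
  (forall u, a < u < b -> 0 <= f u) ->
  forall x y, a <= x -> x <= y -> y <= b -> F x <= F y.
Proof.
move=> hF hf x y ax xy yb.
have := @prim_le _ _ _ 0 _ _ xy (primN (prim_sub ax yb hF)).
rewrite mul0r opprK addrC subr_le0; apply => u /andP[xu uy].
by rewrite oppr_le0 hf// (le_lt_trans ax)//= (lt_le_trans uy).
Qed.

Lemma prim_integral (R : realType) (a b : R) (f : R -> R) : cts a b f ->
  prim a b (fun x => \int[lebesgue_measure]_(u in `[a, x]) f u) f.
Proof.
move=> cf.
have intf : lebesgue_measure.-integrable `[a, b] (EFin \o f).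
  by apply: continuous_compact_integrable => //; exact: segment_compact.
split.
  have [ab|ba] := leP a b; first exact: parameterized_integral_continuous.
  apply/ctsP => x /andP[ax xb]; exfalso.
  by move: (le_lt_trans (le_trans ax xb) ba); rewrite ltxx.
move=> u /andP[au ub].
have cu : {for u, continuous f}.
  have : {within `]a, b[, continuous f}.
    by apply: continuous_subspaceW cf; exact: subset_itv_oo_cc.
  rewrite continuous_open_subspace; last exact: interval_open.
  by apply; rewrite inE/= in_itv/= au ub.
have [d1 d2] := continuous_FTC1_closed ub intf au cu.
by have := derivableP d1; rewrite -derive1E d2.
Qed.

Lemma prim_exists (R : realType) (a b : R) (f : R -> R) : cts a b f ->
  exists2 F, prim a b F f & F a = 0.
Proof.
move=> /prim_integral h; eexists; first exact: h.
by rewrite /= set_itv1 Rintegral_set1.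
Qed.

(** * Matrix-valued functions *)

(** Entrywise, so that the calculus of scalar functions applies directly. *)
Definition mxcts {R : realType} {m n : nat} (a b : R) (F : R -> 'M[R]_(m, n)) : Prop :=
  forall i j, cts a b (fun u => F u i j).

Definition mxprim {R : realType} {m n : nat} (a b : R) (F f : R -> 'M[R]_(m, n)) : Prop :=
  forall i j, prim a b (fun u => F u i j) (fun u => f u i j).

Lemma mxprim_eq (R : realType) (m n : nat) (a b : R) (F f g : R -> 'M[R]_(m, n)) :
  (forall u, a < u < b -> f u = g u) -> mxprim a b F f -> mxprim a b F g.
Proof. by move=> fg hF i j; apply: prim_eq (hF i j) => u hu; rewrite fg. Qed.

Lemma mxprim_cts (R : realType) (m n : nat) (a b : R) (F f : R -> 'M[R]_(m, n)) :
  mxprim a b F f -> mxcts a b F.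
Proof. by move=> hF i j; exact: prim_cts (hF i j). Qed.

Lemma mxcts_cst (R : realType) (m n : nat) (a b : R) (M : 'M[R]_(m, n)) :
  mxcts a b (fun=> M).
Proof. by move=> i j; exact: cts_cst. Qed.

Lemma mxprim_cst (R : realType) (m n : nat) (a b : R) (M : 'M[R]_(m, n)) :
  mxprim a b (fun=> M) (fun=> 0).
Proof. by move=> i j; apply: prim_eq (prim_cst a b _) => u _; rewrite mxE. Qed.

Lemma mxctsD (R : realType) (m n : nat) (a b : R) (F G : R -> 'M[R]_(m, n)) :
  mxcts a b F -> mxcts a b G -> mxcts a b (fun u => F u + G u).
Proof. by move=> hF hG i j; apply: cts_eq (ctsD (hF i j) (hG i j)) => u _; rewrite mxE. Qed.

Lemma mxctsN (R : realType) (m n : nat) (a b : R) (F : R -> 'M[R]_(m, n)) :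
  mxcts a b F -> mxcts a b (fun u => - F u).
Proof. by move=> hF i j; apply: cts_eq (ctsN (hF i j)) => u _; rewrite mxE. Qed.

Lemma mxctsM (R : realType) (m n p : nat) (a b : R) (F : R -> 'M[R]_(m, n))
  (G : R -> 'M[R]_(n, p)) :
  mxcts a b F -> mxcts a b G -> mxcts a b (fun u => F u *m G u).
Proof.
move=> hF hG i j.
have := @cts_sum _ a b _ (index_enum 'I_n) _ (fun k => ctsM (hF i k) (hG k j)).
by apply: cts_eq => u _; rewrite mxE.
Qed.

Lemma mxctsT (R : realType) (m n : nat) (a b : R) (F : R -> 'M[R]_(m, n)) :
  mxcts a b F -> mxcts a b (fun u => (F u)^T).
Proof. by move=> hF i j; apply: cts_eq (hF j i) => u _; rewrite mxE. Qed.

Lemma prim_ext (R : realType) (a b : R) (F f G g : R -> R) :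
  F =1 G -> f =1 g -> prim a b F f -> prim a b G g.
Proof. by move=> /funext -> /funext ->. Qed.

Lemma mxprimD (R : realType) (m n : nat) (a b : R) (F f G g : R -> 'M[R]_(m, n)) :
  mxprim a b F f -> mxprim a b G g ->
  mxprim a b (fun u => F u + G u) (fun u => f u + g u).
Proof.
by move=> hF hG i j; apply: prim_ext (primD (hF i j) (hG i j)) => u; rewrite mxE.
Qed.

Lemma mxprimN (R : realType) (m n : nat) (a b : R) (F f : R -> 'M[R]_(m, n)) :
  mxprim a b F f -> mxprim a b (fun u => - F u) (fun u => - f u).
Proof.
by move=> hF i j; apply: prim_ext (primN (hF i j)) => u; rewrite mxE.
Qed.

Lemma mxprimB (R : realType) (m n : nat) (a b : R) (F f G g : R -> 'M[R]_(m, n)) :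
  mxprim a b F f -> mxprim a b G g ->
  mxprim a b (fun u => F u - G u) (fun u => f u - g u).
Proof. by move=> hF hG; apply: mxprimD => //; exact: mxprimN. Qed.

Lemma mxprimM (R : realType) (m n p : nat) (a b : R) (F f : R -> 'M[R]_(m, n))
  (G g : R -> 'M[R]_(n, p)) :
  mxprim a b F f -> mxprim a b G g ->
  mxprim a b (fun u => F u *m G u) (fun u => f u *m G u + F u *m g u).
Proof.
move=> hF hG i j.
apply: prim_ext (prim_sum (index_enum _) (fun k => primM (hF i k) (hG k j))) => u.
  by rewrite mxE.
by rewrite !mxE -big_split.
Qed.

Lemma mxprimT (R : realType) (m n : nat) (a b : R) (F f : R -> 'M[R]_(m, n)) :
  mxprim a b F f -> mxprim a b (fun u => (F u)^T) (fun u => (f u)^T).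
Proof. by move=> hF i j; apply: prim_ext (hF j i) => u; rewrite mxE. Qed.

Lemma mxprimMl (R : realType) (m n p : nat) (a b : R) (M : 'M[R]_(m, n))
  (G g : R -> 'M[R]_(n, p)) :
  mxprim a b G g -> mxprim a b (fun u => M *m G u) (fun u => M *m g u).
Proof.
move=> hG; apply: mxprim_eq (mxprimM (mxprim_cst a b M) hG) => u _.
by rewrite mul0mx add0r.
Qed.

Lemma mxprimMr (R : realType) (m n p : nat) (a b : R) (M : 'M[R]_(n, p))
  (G g : R -> 'M[R]_(m, n)) :
  mxprim a b G g -> mxprim a b (fun u => G u *m M) (fun u => g u *m M).
Proof.
move=> hG; apply: mxprim_eq (mxprimM hG (mxprim_cst a b M)) => u _.
by rewrite mulmx0 addr0.
Qed.

Lemma mxprim_sub (R : realType) (m n : nat) (a b c d : R) (F f : R -> 'M[R]_(m, n)) :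
  a <= c -> d <= b -> mxprim a b F f -> mxprim c d F f.
Proof. by move=> ac db hF i j; exact: prim_sub (hF i j). Qed.

Lemma mxcts_sub (R : realType) (m n : nat) (a b c d : R) (F : R -> 'M[R]_(m, n)) :
  a <= c -> d <= b -> mxcts a b F -> mxcts c d F.
Proof. by move=> ac db hF i j; exact: cts_sub (hF i j). Qed.

(** * Linear differential equations *)

(** Multiplication by [expR (- K * u)], or by [expR (K * u)], makes [F]
    monotone. Either end may carry the zero: symmetry of the Riccati flow is
    propagated from its initial time, transition matrices from their final time. *)
Lemma gronwall_zero (R : realType) (a b K c : R) (F f : R -> R) :
  prim a b F f -> (forall u, a <= u <= b -> 0 <= F u) ->
  (forall u, a < u < b -> `|f u| <= K * F u) ->
  (c = a \/ c = b) -> F c = 0 -> forall u, a <= u <= b -> F u = 0.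
Proof.
move=> hF F0 hf hc Fc u /andP[au ub]; apply/eqP; rewrite eq_le F0 ?au// andbT.
have aux k : prim a b (fun v => F v * expR (k * v))
    (fun v => (f v + k * F v) * expR (k * v)).
  by apply: prim_ext (primM hF (prim_expR a b k)) => v //; ring.
case: hc => ?; subst c.
- suff : F u * expR (- K * u) <= 0 by rewrite pmulr_lle0 ?expR_gt0.
  have := @prim_homo _ a b _ _ (primN (aux (- K))) _ a u (lexx a) au ub.
  rewrite Fc mul0r oppr0 oppr_ge0; apply => v hv.
  rewrite oppr_ge0 pmulr_lle0 ?expR_gt0// mulNr subr_le0.
  by rewrite (le_trans (ler_norm _))// hf.
- suff : F u * expR (K * u) <= 0 by rewrite pmulr_lle0 ?expR_gt0.
  have := @prim_homo _ a b _ _ (aux K) _ u b au ub (lexx b).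
  rewrite Fc mul0r; apply => v hv.
  rewrite pmulr_lge0 ?expR_gt0// -lerBlDr sub0r.
  by have := hf _ hv; rewrite ler_norml => /andP[].
Qed.

Lemma mxcts_bounded (R : realType) (m n : nat) (a b : R) (F : R -> 'M[R]_(m, n)) :
  mxcts a b F -> exists2 K : R, 0 < K & forall u, a <= u <= b -> forall i j, `|F u i j| <= K.
Proof.
move=> hF.
have h (p : 'I_m * 'I_n) : exists K, 0 < K /\ forall u, a <= u <= b -> `|F u p.1 p.2| <= K.
  by have [K K0 hK] := cts_bounded (hF p.1 p.2); exists K.
have [K hK] := choice h.
exists (1 + \sum_p K p).
  by rewrite ltr_wpDr// sumr_ge0// => p _; exact: ltW (hK p).1.
move=> u hu i j; apply: le_trans ((hK (i, j)).2 _ hu) _.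
rewrite (bigD1 (i, j))//= [leRHS]addrCA lerDl addr_ge0// sumr_ge0// => p _.
exact: ltW (hK p).1.
Qed.

(** Uniqueness for a homogeneous linear equation: Gronwall's argument for
    the sum of the squares of the entries of [D]. *)
Lemma lin_ode_zero (R : realType) (m n : nat) (a b c : R)
    (P : R -> 'M[R]_m) (Q : R -> 'M[R]_n) (D : R -> 'M[R]_(m, n)) :
  mxcts a b P -> mxcts a b Q ->
  mxprim a b D (fun u => P u *m D u + D u *m Q u) ->
  (c = a \/ c = b) -> D c = 0 -> forall u, a <= u <= b -> D u = 0.
Proof.
move=> /mxcts_bounded[KP KP0 hP] /mxcts_bounded[KQ KQ0 hQ] hD hc Dc.
pose N u := \sum_i \sum_j D u i j * D u i j.
have Nge u : 0 <= N u by apply: sumr_ge0 => i _; apply: sumr_ge0 => j _; exact: sqr_ge0.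
have Dle u i j : D u i j ^+ 2 <= N u.
  rewrite /N (bigD1 i)//= (bigD1 j)//= -expr2 -addrA lerDl addr_ge0//.
    by apply: sumr_ge0 => k _; exact: sqr_ge0.
  by apply: sumr_ge0 => i' _; apply: sumr_ge0 => k _; exact: sqr_ge0.
have DDle u i j k l : `|D u i j * D u k l| <= N u.
  have h1 := Dle u i j; have h2 := Dle u k l.
  rewrite ler_norml; apply/andP; split.
    by have := sqr_ge0 (D u i j + D u k l); nra.
  by have := sqr_ge0 (D u i j - D u k l); nra.
pose n' u := \sum_i \sum_j
  ((P u *m D u + D u *m Q u) i j * D u i j + D u i j * (P u *m D u + D u *m Q u) i j).
have hN : prim a b N n'.
  by apply: prim_sum => i; apply: prim_sum => j; apply: primM; exact: hD.
pose C : R := KP *+ m + KQ *+ n.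
have hb u i j : a <= u <= b -> `|D u i j * (P u *m D u + D u *m Q u) i j| <= C * N u.
  move=> hu; rewrite !mxE mulrDr (le_trans (ler_normD _ _))// /C mulrDl.
  apply: lerD; rewrite mulr_sumr (le_trans (ler_norm_sum _ _ _))//.
    apply: (@le_trans _ _ (\sum_(k < m) KP * N u)); last first.
      by rewrite sumr_const card_ord -mulrnAl.
    apply: ler_sum => k _; rewrite mulrCA normrM; apply: ler_pM => //; exact: hP.
  apply: (@le_trans _ _ (\sum_(k < n) KQ * N u)); last first.
    by rewrite sumr_const card_ord -mulrnAl.
  apply: ler_sum => k _; rewrite mulrA mulrC normrM; apply: ler_pM => //; exact: hQ.
have hn u : a < u < b -> `|n' u| <= (((C + C) *+ n) *+ m) * N u.
  move=> /andP[au ub]; have hu : a <= u <= b by rewrite !ltW.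
  rewrite /n' (le_trans (ler_norm_sum _ _ _))//.
  apply: (@le_trans _ _ (\sum_(i < m) \sum_(j < n) (C + C) * N u)); last first.
    by rewrite !sumr_const !card_ord -!mulrnAl.
  apply: ler_sum => i _; rewrite (le_trans (ler_norm_sum _ _ _))//.
  apply: ler_sum => j _; rewrite (le_trans (ler_normD _ _))// mulrDl.
  by rewrite [X in `|X| + _]mulrC lerD ?hb.
have Nc : N c = 0 by apply: big1 => i _; apply: big1 => j _; rewrite Dc mxE mul0r.
move=> u hu; apply/matrixP => i j; rewrite mxE.
have Nu : N u = 0 by apply: (gronwall_zero hN _ hn hc Nc hu) => v _; exact: Nge.
by have := Dle u i j; rewrite Nu => h; apply/eqP; rewrite -sqrf_eq0 eq_le h sqr_ge0.
Qed.

Lemma cvg_sumR (R : realType) (I T : Type) (F : set_system T) (r : seq I)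
    (f : I -> T -> R) (l : I -> R) : Filter F ->
  (forall i, f i x @[x --> F] --> l i) ->
  \sum_(i <- r) f i x @[x --> F] --> \sum_(i <- r) l i.
Proof.
move=> FF h; elim: r => [|i r IH].
  rewrite big_nil (_ : (fun _ => _) = fun=> 0); first exact: cvg_cst.
  by apply/funext => x; rewrite big_nil.
rewrite big_cons (_ : (fun _ => _) = fun x => f i x + \sum_(j <- r) f j x).
  by apply: cvgD => //; exact: h.
by apply/funext => x; rewrite big_cons.
Qed.

(** The exponential series with the powers of [M] shifted by [q]: a
    derivative in time raises [q] by one, in the format that termwise
    differentiation of power series expects. *)
Definition mexp_coeff {R : realType} {n : nat} (M : 'M[R]_n) (q : nat) i j : R^nat :=
  fun k => (M ^+ (k + q)%N) i j / k`!%:R.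

(** Geometric growth of the entries makes the exponential series converge
    everywhere, by comparison with that of the scalar exponential. *)
Lemma mxpow_entry_le (R : realType) (n : nat) (M : 'M[R]_n) :
  exists2 c : R, 0 <= c & forall k i j, `|(M ^+ k) i j| <= c ^+ k.
Proof.
have [c0 h0 h] := mxcts_bounded (@mxcts_cst R n n 0 0 M).
exists (c0 *+ n); first by rewrite mulrn_wge0// ltW.
elim=> [|k IH] i j; first by rewrite !expr0 mxE; case: (i == j); rewrite ?normr1 ?normr0.
rewrite exprS mxE (le_trans (ler_norm_sum _ _ _))//.
apply: (@le_trans _ _ (\sum_(l < n) c0 * (c0 *+ n) ^+ k)).
  by apply: ler_sum => l _; rewrite normrM ler_pM// (h 0)// lexx.
by rewrite sumr_const card_ord -mulrnAl exprS.
Qed.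

Lemma is_cvg_mexp (R : realType) (n : nat) (M : 'M[R]_n) q i j (x : R) :
  cvgn (pseries (mexp_coeff M q i j) x).
Proof.
have [c c0 hc] := mxpow_entry_le M.
apply: normed_cvg.
have h : cvgn (series (c ^+ q *: exp_coeff (c * `|x|))).
  by apply: is_cvg_seriesZ; exact: is_cvg_series_exp_coeff.
apply: series_le_cvg h => k //.
  exact: normr_ge0.
  by apply: mulr_ge0; rewrite ?exprn_ge0// exp_coeff_ge0// mulr_ge0.
change (`|mexp_coeff M q i j k * x ^+ k| <= c ^+ q * exp_coeff (c * `|x|) k).
rewrite /mexp_coeff /exp_coeff/= exprMn !normrM normrX normfV.
rewrite [`|_`!%:R|]ger0_norm// mulrAC.
rewrite [leRHS]mulrA ler_wpM2r ?invr_ge0// [leRHS]mulrA ler_wpM2r ?exprn_ge0//.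
by rewrite -exprD addnC hc.
Qed.

Lemma mexp_diffs (R : realType) (n : nat) (M : 'M[R]_n) q i j :
  pseries_diffs (mexp_coeff M q i j) = mexp_coeff M q.+1 i j.
Proof.
apply/funext => k; rewrite /pseries_diffs /mexp_coeff addSnnS factS natrM invfM.
by rewrite mulrCA; congr (_ * _); rewrite mulVKf ?pnatr_eq0.
Qed.

Definition mexp {R : realType} {n : nat} (M : 'M[R]_n) (q : nat) (t : R) : 'M[R]_n :=
  \matrix_(i, j) limn (pseries (mexp_coeff M q i j) t).

Lemma mexp1 (R : realType) (n : nat) (M : 'M[R]_n) t : mexp M 1 t = M *m mexp M 0 t.
Proof.
apply/matrixP => i j; rewrite !mxE; apply/cvg_lim => //.
have -> : pseries (mexp_coeff M 1 i j) t =
    fun N => \sum_k M i k * pseries (mexp_coeff M 0 k j) t N.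
  apply/funext => N; rewrite /pseries /series/=.
  under [RHS]eq_bigr do rewrite mulr_sumr.
  rewrite exchange_big/=; apply: eq_bigr => l _.
  rewrite /mexp_coeff addn1 addn0 exprS mxE !mulr_suml.
  by apply: eq_bigr => k _; rewrite !mulrA.
under eq_bigr do rewrite mxE.
apply: cvg_sumR => k; apply: cvgM; first exact: cvg_cst.
exact: is_cvg_mexp.
Qed.

Lemma mexp0 (R : realType) (n : nat) (M : 'M[R]_n) : mexp M 0 0 = 1%:M.
Proof.
apply/matrixP => i j; rewrite !mxE; apply/cvg_lim => //.
rewrite -(cvg_shiftS _)/=.
rewrite [X in X @ _ --> _](_ : _ = fun=> (i == j)%:R); first exact: cvg_cst.
apply/funext => N; rewrite /pseries /series/= big_nat_recl//= big1.
  by rewrite /mexp_coeff addn0 !expr0 mulr1 mxE fact0 divr1 addr0.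
by move=> k _; rewrite expr0n mulr0.
Qed.

Lemma mexp_derive (R : realType) (n : nat) (M : 'M[R]_n) (t : R) i j :
  is_derive t (1 : R) (fun u => mexp M 0 u i j) ((M *m mexp M 0 t) i j).
Proof.
rewrite -mexp1.
have -> : (fun u => mexp M 0 u i j) = (fun u => limn (pseries (mexp_coeff M 0 i j) u)).
  by apply/funext => u; rewrite mxE.
rewrite mxE -mexp_diffs; apply: (@pseries_snd_diffs _ _ (`|t| + 1)).
- exact: is_cvg_mexp.
- rewrite mexp_diffs; exact: is_cvg_mexp.
- rewrite !mexp_diffs; exact: is_cvg_mexp.
by rewrite [ltRHS]ger0_norm ?ltrDl// addr_ge0.
Qed.

Lemma lin_ode_exists (R : realType) (n m : nat) (M : 'M[R]_n) (t0 : R) (X0 : 'M[R]_(n, m)) :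
  exists2 X : R -> 'M[R]_(n, m), X t0 = X0 & forall a b, mxprim a b X (fun u => M *m X u).
Proof.
exists (fun u => mexp M 0 (u - t0) *m X0); first by rewrite subrr mexp0 mul1mx.
move=> a b.
have h : mxprim a b (fun u => mexp M 0 (u - t0)) (fun u => M *m mexp M 0 (u - t0)).
  move=> i j.
  have d u : is_derive u (1 : R) (fun u => mexp M 0 (u - t0) i j) ((M *m mexp M 0 (u - t0)) i j).
    have h := mexp_derive M (u - t0) i j.
    have h2 : is_derive u (1:R) (fun u : R => u - t0) 1 by exact: is_derive_shift.
    have := @is_derive1_comp R (fun u => mexp M 0 u i j) (fun u => u - t0) u _ _ h h2.
    by rewrite mulr1.
  split=> // ; apply: continuous_subspaceT => u.
  by apply: differentiable_continuous; apply/derivable1_diffP; have [] := d u.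
apply: mxprim_eq (mxprimMr X0 h) => u _; by rewrite mulmxA.
Qed.

(** The transpose of a transition matrix solves a linear equation with the
    coefficient on the left. *)
Lemma transition_exists (R : realType) (n : nat) (A : 'M[R]_n) (t : R) :
  exists2 L : R -> 'M[R]_n, L t = 1%:M & forall a b, mxprim a b L (fun u => - (L u *m A)).
Proof.
have [Y Yt hY] := lin_ode_exists (- A^T) t (1%:M : 'M[R]_n).
exists (fun u => (Y u)^T) => [|a b]; first by rewrite Yt trmx1.
apply: mxprim_eq (mxprimT (hY a b)) => u _.
by rewrite mulNmx linearN/= trmx_mul trmxK.
Qed.

(** * Riemann-Stieltjes sums *)

(** The points at which [riemann_sum] evaluates its integrand; [k] may be
    zero, in which case they all equal [a]. *)
Definition grid {R : realType} (a b : R) (k j : nat) : R := a + (b - a) * j%:R / k%:R.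

Lemma grid0 (R : realType) (a b : R) k : grid a b k 0 = a.
Proof. by rewrite /grid mulr0 mul0r addr0. Qed.

Lemma gridE (R : realType) (a b : R) k : (0 < k)%N -> grid a b k k = b.
Proof. by move=> k0; rewrite /grid mulfK ?pnatr_eq0 ?gt_eqF// addrC subrK. Qed.

Lemma grid_step (R : realType) (a b : R) k j : grid a b k j.+1 - grid a b k j = (b - a) / k%:R.
Proof. by rewrite /grid -natr1; ring. Qed.

Lemma grid_le (R : realType) (a b : R) k i j : a <= b -> (i <= j)%N -> grid a b k i <= grid a b k j.
Proof.
move=> ab ij; rewrite /grid lerD2l ler_wpM2r ?invr_ge0// ler_wpM2l ?subr_ge0//.
by rewrite ler_nat.
Qed.

Lemma grid_itv (R : realType) (a b : R) k j : a <= b -> (j <= k)%N ->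
  a <= grid a b k j <= b.
Proof.
move=> ab jk; rewrite -{1}(grid0 a b k) grid_le//=.
case: k jk => [|k] jk; last by rewrite -{2}(@gridE _ a b k.+1)// grid_le.
by move: jk; rewrite leqn0 => /eqP ->; rewrite grid0.
Qed.

(** On each cell the function [Psi - m (xi k j) g] has derivative
    [g' (m - m (xi k j))], which is small by uniform continuity of [m]. The tags
    are free because left endpoints occur for the drift and the variance, right
    endpoints after a summation by parts. *)
Lemma riemann_stieltjes_cvg (R : realType) (a b : R) (m g g' Psi : R -> R)
    (xi : nat -> nat -> R) : a <= b ->
  cts a b m -> prim a b g g' -> cts a b g' -> prim a b Psi (fun u => g' u * m u) ->
  (forall k j, (j < k)%N -> grid a b k j <= xi k j <= grid a b k j.+1) ->
  (fun k => \sum_(j < k) m (xi k j) * (g (grid a b k j.+1) - g (grid a b k j)))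
    @ \oo --> Psi b - Psi a.
Proof.
move=> ab cm hg /cts_bounded[K K0 hK] hPsi hxi.
apply/cvgrPdist_le => e e0.
have B0 : 0 < K * (b - a + 1) by rewrite mulr_gt0// ltr_wpDl// subr_ge0.
have [d d0 hd] := cts_uniform cm (divr_gt0 e0 B0).
have hk : \forall k \near \oo, (b - a) / k%:R < d.
  have /cvgrPdist_lt/(_ _ d0) : (fun k : nat => (b - a) / k%:R) @ \oo --> (0 : R).
    rewrite -[X in _ --> X](mulr0 (b - a)); apply: cvgM; first exact: cvg_cst.
    rewrite -cvg_shiftS; exact: cvg_harmonic.
  apply: filterS => k; rewrite sub0r normrN.
  exact: le_lt_trans (ler_norm _).
near=> k.
have k0 : (0 < k)%N by near: k; exact: nbhs_infty_gt.
rewrite -{1}(gridE a b k0) -{2}(grid0 a b k).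
have -> : Psi (grid a b k k) - Psi (grid a b k 0) =
    \sum_(j < k) (Psi (grid a b k j.+1) - Psi (grid a b k j)).
  by rewrite -(@telescope_sumr _ 0 k (fun j => Psi (grid a b k j)))// big_mkord.
rewrite -sumrB (le_trans (ler_norm_sum _ _ _))//.
apply: (@le_trans _ _ (\sum_(j < k) (e / (K * (b - a + 1)) * K) * ((b - a) / k%:R))).
  apply: ler_sum => j _.
  have ajk : a <= grid a b k j by have /andP[] := grid_itv ab (ltnW (ltn_ord j)).
  have jkb : grid a b k j.+1 <= b by have /andP[] := grid_itv ab (ltn_ord j).
  have jj : grid a b k j <= grid a b k j.+1 by rewrite grid_le.
  have /andP[x1 x2] := hxi k j (ltn_ord j).
  have hth := primB (prim_sub ajk jkb hPsi) (primZ (m (xi k j)) (prim_sub ajk jkb hg)).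
  have := prim_norm_le jj hth (K := e / (K * (b - a + 1)) * K).
  rewrite grid_step.
  rewrite (_ : _ - _ - _ = Psi (grid a b k j.+1) - Psi (grid a b k j) -
    m (xi k j) * (g (grid a b k j.+1) - g (grid a b k j))); last by ring.
  apply => u /andP[u1 u2].
  rewrite [X in X - _]mulrC -mulrBl normrM ler_pM//; last first.
    by rewrite hK// (le_trans ajk (ltW u1)) (le_trans (ltW u2) jkb).
  apply: ltW; apply: hd.
  - by rewrite (le_trans ajk (ltW u1)) (le_trans (ltW u2) jkb).
  - by rewrite (le_trans ajk x1) (le_trans x2 jkb).
  - have : `|u - xi k j| <= (b - a) / k%:R.
      by rewrite -(grid_step a b k j) ler_norml; apply/andP; split; lra.
    by move/le_lt_trans; apply; near: k.
rewrite sumr_const card_ord -mulrnAr -[_ / _ *+ k]mulr_natr divfK ?pnatr_eq0 ?gt_eqF//.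
have : 0 <= b - a by rewrite subr_ge0.
move: B0; set w := b - a => B0 w0.
have K1 : K != 0 by rewrite gt_eqF.
have w1 : w + 1 != 0 by rewrite gt_eqF// ltr_wpDl.
rewrite (_ : _ * _ = e * (w / (w + 1))); last by field; rewrite w1 K1.
by rewrite ler_piMr ?(ltW e0)// ler_pdivrMr ?mul1r ?lerDl// ltr_wpDl.
Unshelve. all: by end_near. Qed.

(** * Quadratic forms *)

(** Noncommutative matrix identities: after expansion each product is an
    atom, and the remaining additive identity is checked entrywise. *)
Ltac mx_abel :=
  rewrite ?(mulmxDl, mulmxDr, mulNmx, mulmxN, mulmxA, opprK, mul0mx, mulmx0);
  repeat match goal with |- context [ @mulmx ?R ?m ?n ?p ?X ?Y ] =>
    let z := fresh "z" in set z := (@mulmx R m n p X Y); clearbody z end;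
  apply/matrixP => ? ?; rewrite !mxE; ring.

(** Special cases of linearity, in a form that rewriting can use without
    inferring the linear map. *)
Lemma trmx_add (R : realType) (m n : nat) (M N : 'M[R]_(m, n)) : (M + N)^T = M^T + N^T.
Proof. by apply/matrixP => i j; rewrite !mxE. Qed.
Lemma trmx_opp (R : realType) (m n : nat) (M : 'M[R]_(m, n)) : (- M)^T = - M^T.
Proof. by apply/matrixP => i j; rewrite !mxE. Qed.

Definition bf {R : realType} {m n : nat} (M : 'M[R]_(m, n)) (u : 'cV[R]_m) (v : 'cV[R]_n) : R :=
  (u^T *m M *m v) 0 0.

Notation qf M v := (bf M v v).

Lemma bf_sym (R : realType) (n : nat) (M : 'M[R]_n) u v : M^T = M -> bf M u v = bf M v u.
Proof.
move=> hM; rewrite /bf -[LHS](mxE trmx_key (fun i j => _ j i)) -/(trmx _).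
by rewrite !trmx_mul trmxK hM mulmxA.
Qed.

Lemma bfDM (R : realType) (m n : nat) (M N : 'M[R]_(m, n)) u v : bf (M + N) u v = bf M u v + bf N u v.
Proof. by rewrite /bf mulmxDr mulmxDl mxE. Qed.
Lemma bfNM (R : realType) (m n : nat) (M : 'M[R]_(m, n)) u v : bf (- M) u v = - bf M u v.
Proof. by rewrite /bf mulmxN mulNmx mxE. Qed.
Lemma bfDl (R : realType) (m n : nat) (M : 'M[R]_(m, n)) u u' v : bf M (u + u') v = bf M u v + bf M u' v.
Proof. by rewrite /bf linearD/= !mulmxDl mxE. Qed.
Lemma bfDr (R : realType) (m n : nat) (M : 'M[R]_(m, n)) u v v' : bf M u (v + v') = bf M u v + bf M u v'.
Proof. by rewrite /bf !mulmxDr mxE. Qed.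
Lemma bfZl (R : realType) (m n : nat) (M : 'M[R]_(m, n)) c u v : bf M (c *: u) v = c * bf M u v.
Proof. by rewrite /bf linearZ/= -!scalemxAl mxE. Qed.
Lemma bfZr (R : realType) (m n : nat) (M : 'M[R]_(m, n)) c u v : bf M u (c *: v) = c * bf M u v.
Proof. by rewrite /bf -!scalemxAr mxE. Qed.
Lemma bfMr (R : realType) (m n p : nat) (M : 'M[R]_(m, n)) (N : 'M[R]_(n, p)) u v :
  bf (M *m N) u v = bf M u (N *m v).
Proof. by rewrite /bf !mulmxA. Qed.
Lemma bfMl (R : realType) (m n p : nat) (M : 'M[R]_(m, n)) (N : 'M[R]_(p, m)) u v :
  bf (N *m M) u v = bf M (N^T *m u) v.
Proof. by rewrite /bf trmx_mul trmxK !mulmxA. Qed.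
Lemma bf0r (R : realType) (m n : nat) (M : 'M[R]_(m, n)) u : bf M u 0 = 0.
Proof. by rewrite /bf mulmx0 mxE. Qed.

Lemma sq_norm2 (R : realType) (n : nat) (v : 'cV[R]_n) : norm2 v ^+ 2 = qf 1%:M v.
Proof.
rewrite /norm2 sqr_sqrtr ?sumr_ge0// => [|i _]; last exact: sqr_ge0.
by rewrite /bf mulmx1 mxE; apply: eq_bigr => i _; rewrite mxE expr2.
Qed.

Lemma spd_unit (R : realType) (n : nat) (M : 'M[R]_n) : spdmx M -> M \in unitmx.
Proof.
move=> [_ hM]; rewrite -row_free_unit; apply: inj_row_free => v vM.
apply/eqP; apply: contraT => v0; have := hM v^T.
rewrite trmxK vM mul0mx mxE ltxx; apply.
by apply: contra v0 => /eqP h; rewrite -[v]trmxK h trmx0.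
Qed.

Lemma spd_ge0 (R : realType) (n : nat) (M : 'M[R]_n) v : spdmx M -> 0 <= qf M v.
Proof.
move=> [_ hM]; have [->|v0] := eqVneq v 0; first by rewrite bf0r.
exact/ltW/hM.
Qed.

(** Nonnegativity of the form at the component of [u] orthogonal to [v]. *)
Lemma spd_cauchy_schwarz (R : realType) (n : nat) (M : 'M[R]_n) u v : spdmx M ->
  bf M u v ^+ 2 <= qf M u * qf M v.
Proof.
move=> hM; have [->|v0] := eqVneq v 0; first by rewrite !bf0r mulr0 expr0n.
have v1 : 0 < qf M v by exact: hM.2.
have := spd_ge0 (qf M v *: u + (- bf M u v) *: v) hM.
rewrite !(bfDl, bfDr, bfZl, bfZr) (bf_sym v u hM.1).
set a := qf M v in v1 *; set b := bf M u v; set c := qf M u => h.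
by rewrite -(ler_pM2l v1); nra.
Qed.

Lemma bf_bound (R : realType) (n : nat) (N : 'M[R]_n) :
  exists2 K : R, 0 < K & forall v, qf N v <= K * qf 1%:M v.
Proof.
exists (1 + \sum_i \sum_j `|N i j|).
  by rewrite ltr_wpDr// sumr_ge0// => i _; rewrite sumr_ge0.
move=> v; have hs : qf 1%:M v = \sum_i v i 0 ^+ 2.
  by rewrite /bf mulmx1 mxE; apply: eq_bigr => i _; rewrite mxE expr2.
have hv i : v i 0 ^+ 2 <= qf 1%:M v.
  by rewrite hs (bigD1 i)//= lerDl sumr_ge0// => j _; exact: sqr_ge0.
have hvv i j : `|v i 0 * v j 0| <= qf 1%:M v.
  have := hv i; have := hv j; rewrite ler_norml => h1 h2; apply/andP; split.
    by have := sqr_ge0 (v i 0 + v j 0); nra.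
  by have := sqr_ge0 (v i 0 - v j 0); nra.
have hv0 : 0 <= qf 1%:M v by rewrite hs sumr_ge0// => i _; exact: sqr_ge0.
rewrite mulrDl mul1r; apply: (@le_trans _ _ ((\sum_i \sum_j `|N i j|) * qf 1%:M v)); last by rewrite lerDr.
have -> : qf N v = \sum_i \sum_j v i 0 * N i j * v j 0.
  rewrite /bf mxE exchange_big/=; apply: eq_bigr => j _.
  by rewrite mxE mulr_suml; apply: eq_bigr => i _; rewrite mxE.
rewrite mulr_suml; apply: ler_sum => i _; rewrite mulr_suml; apply: ler_sum => j _.
by rewrite (le_trans (ler_norm _))// mulrAC mulrC normrM ler_wpM2l.
Qed.

(** Cauchy-Schwarz for the form of [M] between [v] and [invmx M *m v],
    whose product is the squared norm of [v]. *)
Lemma spd_lower (R : realType) (n : nat) (M : 'M[R]_n) : spdmx M ->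
  exists2 K : R, 0 < K & forall v, qf 1%:M v <= K * qf M v.
Proof.
move=> hM; have uM := spd_unit hM.
have [K K0 hK] := bf_bound (invmx M)^T.
exists K => // v.
have h1 : bf M v (invmx M *m v) = qf 1%:M v by rewrite -bfMr mulmxV.
have h2 : qf M (invmx M *m v) <= K * qf 1%:M v.
  rewrite (_ : qf M _ = qf (invmx M)^T v); first exact: hK.
  by rewrite -bfMr mulmxV// /bf mulmx1 trmx_mul.
have := spd_cauchy_schwarz v (invmx M *m v) hM; rewrite h1 => h3.
have s0 : 0 <= qf 1%:M v by rewrite -sq_norm2 sqr_ge0.
have m0 := spd_ge0 v hM.
have [s1|s1] := ltP 0 (qf 1%:M v); last by rewrite (le_trans s1)// mulr_ge0// ltW.
rewrite -(ler_pM2r s1) -expr2 (le_trans h3)//.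
by rewrite mulrC -mulrA [leRHS]mulrCA [X in _ <= X]mulrA mulrC; nra.
Qed.

Lemma spd_dominates (R : realType) (n : nat) (M N : 'M[R]_n) : spdmx M ->
  exists2 K : R, 0 < K & forall v, qf N v <= K * qf M v.
Proof.
move=> /spd_lower[K K0 hK]; have [K' K'0 hK'] := bf_bound N.
exists (K' * K); first exact: mulr_gt0.
by move=> v; rewrite (le_trans (hK' v))// -mulrA ler_pM2l.
Qed.

Lemma spd_inv (R : realType) (n : nat) (M : 'M[R]_n) : spdmx M -> spdmx (invmx M).
Proof.
move=> hM; have uM := spd_unit hM; split; first by rewrite trmx_inv hM.1.
move=> v v0; set w := invmx M *m v.
have vE : v = M *m w by rewrite /w mulmxA mulmxV ?mul1mx.
have w0 : w != 0 by apply: contra v0 => /eqP h; rewrite vE h mulmx0.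
have := hM.2 w w0.
rewrite -(mulmxA v^T) -/w; clearbody w.
by rewrite vE trmx_mul hM.1.
Qed.

(** * The Riccati equation and its closed loop *)

Definition ric {R : realType} {r : nat} (A S R1 P : 'M[R]_r) : 'M[R]_r :=
  A *m P + P *m A^T - P *m S *m P + R1.

(** The difference between a solution and its transpose solves a homogeneous
    linear equation, hence stays zero. *)
Lemma riccati_sym (R : realType) (r : nat) (A S R1 : 'M[R]_r) (P : R -> 'M[R]_r) (s t : R) :
  S^T = S -> R1^T = R1 -> (P s)^T = P s ->
  mxprim s t P (fun u => ric A S R1 (P u)) ->
  forall u, s <= u <= t -> (P u)^T = P u.
Proof.
move=> hS hR1 hPs hP u hu.
have cP := mxprim_cts hP.
pose P1 u := A - (P u)^T *m S; pose P2 u := A^T - S *m P u.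
have hD : mxprim s t (fun u => P u - (P u)^T)
    (fun u => P1 u *m (P u - (P u)^T) + (P u - (P u)^T) *m P2 u).
  apply: mxprim_eq (mxprimB hP (mxprimT hP)) => v _.
  rewrite /ric /P1 /P2 !(trmx_add, trmx_opp, trmx_mul, trmxK) hS hR1.
  mx_abel.
have c1 : mxcts s t P1.
  apply: mxctsD; first exact: mxcts_cst.
  by apply/mxctsN/mxctsM; [exact: mxctsT|exact: mxcts_cst].
have c2 : mxcts s t P2.
  apply: mxctsD; first exact: mxcts_cst.
  by apply/mxctsN/mxctsM; [exact: mxcts_cst|].
have := lin_ode_zero c1 c2 hD (or_introl erefl) _ hu.
by rewrite hPs subrr => /(_ erefl)/eqP; rewrite subr_eq0 => /eqP.
Qed.

Lemma mxprim_usub (R : realType) (m1 m2 n : nat) (a b : R) (F f : R -> 'M[R]_(m1 + m2, n)) :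
  mxprim a b F f -> mxprim a b (fun u => usubmx (F u)) (fun u => usubmx (f u)).
Proof. by move=> hF i j; apply: prim_ext (hF (lshift m2 i) j) => u; rewrite mxE. Qed.

Lemma mxprim_dsub (R : realType) (m1 m2 n : nat) (a b : R) (F f : R -> 'M[R]_(m1 + m2, n)) :
  mxprim a b F f -> mxprim a b (fun u => dsubmx (F u)) (fun u => dsubmx (f u)).
Proof. by move=> hF i j; apply: prim_ext (hF (rshift m1 i) j) => u; rewrite mxE. Qed.

(** Radon's linearization of the Riccati equation. The pair [(U, V)] solves a
    linear system with constant coefficients, the Hamiltonian matrix [M], and
    satisfies [U = P V] at time [t], hence on the whole segment. Substituting
    this in the equation of [V] gives [V' = - (A - P S)^T V], so the transpose of
    [V] is the transition matrix although [P] depends on time. *)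
Lemma closed_loop_transition (R : realType) (r : nat) (A S R1 : 'M[R]_r) (P : R -> 'M[R]_r) (s t : R) :
  s <= t -> S^T = S -> (forall u, s <= u <= t -> (P u)^T = P u) ->
  mxprim s t P (fun u => ric A S R1 (P u)) ->
  exists2 L : R -> 'M[R]_r, L t = 1%:M & mxprim s t L (fun u => - (L u *m (A - P u *m S))).
Proof.
move=> st hS hPsym hP; have cP := mxprim_cts hP.
pose M := block_mx A R1 S (- A^T).
have [X Xt hX] := lin_ode_exists M t (col_mx (P t) 1%:M).
pose U u := usubmx (X u); pose V u := dsubmx (X u).
have hM u : M *m X u = col_mx (A *m U u + R1 *m V u) (S *m U u - A^T *m V u).
  by rewrite -[X u]vsubmxK mul_block_col mulNmx.
have hU : mxprim s t U (fun u => A *m U u + R1 *m V u).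
  by apply: mxprim_eq (mxprim_usub (hX s t)) => u _; rewrite hM col_mxKu.
have hV : mxprim s t V (fun u => S *m U u - A^T *m V u).
  by apply: mxprim_eq (mxprim_dsub (hX s t)) => u _; rewrite hM col_mxKd.
have hD : mxprim s t (fun u => U u - P u *m V u)
    (fun u => (A - P u *m S) *m (U u - P u *m V u) + (U u - P u *m V u) *m 0).
  apply: mxprim_eq (mxprimB hU (mxprimM hP hV)) => u _.
  rewrite /ric; mx_abel.
have cF : mxcts s t (fun u => A - P u *m S).
  apply: mxctsD; first exact: mxcts_cst.
  by apply/mxctsN/mxctsM; [|exact: mxcts_cst].
have UV u : s <= u <= t -> U u = P u *m V u.
  move=> hu; apply/eqP; rewrite -subr_eq0; apply/eqP.
  apply: (lin_ode_zero cF (@mxcts_cst R r r s t 0) hD (or_intror erefl) _ hu).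
  by rewrite /U /V Xt col_mxKu col_mxKd mulmx1 subrr.
exists (fun u => (V u)^T); first by rewrite /V Xt col_mxKd trmx1.
apply: mxprim_eq (mxprimT hV) => u /andP[su ut].
have hu : s <= u <= t by rewrite !ltW.
rewrite (UV _ hu) !(trmx_add, trmx_opp, trmx_mul, trmxK) hS (hPsym _ hu).
mx_abel.
Qed.

(** The terms of the Riccati equation that contain the drift [A - P S]
    cancel against the derivative of [L]; the covariances of the noises remain. *)
Lemma transported_cov (R : realType) (r : nat) (A S R1 : 'M[R]_r) (P L : R -> 'M[R]_r) (s t : R) :
  S^T = S -> (forall u, s <= u <= t -> (P u)^T = P u) ->
  mxprim s t P (fun u => ric A S R1 (P u)) ->
  mxprim s t L (fun u => - (L u *m (A - P u *m S))) ->
  mxprim s t (fun u => L u *m P u *m (L u)^T)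
    (fun u => L u *m (R1 + P u *m S *m P u) *m (L u)^T).
Proof.
move=> hS hPsym hP hL.
apply: mxprim_eq (mxprimM (mxprimM hL hP) (mxprimT hL)) => u /andP[su ut].
have hu : s <= u <= t by rewrite !ltW.
rewrite !(trmx_add, trmx_opp, trmx_mul, trmxK) hS (hPsym _ hu) /ric.
mx_abel.
Qed.

Lemma prim_bf (R : realType) (m n : nat) (a b : R) (F f : R -> 'M[R]_(m, n)) u v :
  mxprim a b F f -> prim a b (fun x => bf (F x) u v) (fun x => bf (f x) u v).
Proof. by move=> hF; exact: (mxprimMr v (mxprimMl u^T hF)) 0 0. Qed.

Lemma prim_qf (R : realType) (n : nat) (a b : R) (F f : R -> 'M[R]_n) (y y' : R -> 'cV[R]_n) :
  mxprim a b F f -> mxprim a b y y' ->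
  prim a b (fun x => qf (F x) (y x))
    (fun x => bf (F x) (y' x) (y x) + bf (f x) (y x) (y x) + bf (F x) (y x) (y' x)).
Proof.
move=> hF hy.
have h := mxprimM (mxprimM (mxprimT hy) hF) hy.
apply: prim_ext (h 0 0) => x //.
by rewrite mulmxDl mxE [X in X + _]mxE.
Qed.

Lemma qf_gram (R : realType) (m n : nat) (C : 'M[R]_(m, n)) v :
  qf (C^T *m C) v = qf 1%:M (C *m v).
Proof. by rewrite /bf trmx_mul mulmx1 !mulmxA. Qed.

Lemma qf_congr (R : realType) (m n : nat) (L : 'M[R]_(m, n)) (M : 'M[R]_n) v :
  qf (L *m M *m L^T) v = qf M (L^T *m v).
Proof. by rewrite bfMr bfMl. Qed.

Lemma qf_congr_sym (R : realType) (n : nat) (P S : 'M[R]_n) v : P^T = P ->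
  qf (P *m S *m P) v = qf S (P *m v).
Proof. by move=> hP; have := qf_congr P S v; rewrite hP. Qed.

Lemma qf1_ge0 (R : realType) (n : nat) (v : 'cV[R]_n) : 0 <= qf 1%:M v.
Proof. by rewrite -sq_norm2 sqr_ge0. Qed.

Lemma qf1_eq0 (R : realType) (n : nat) (v : 'cV[R]_n) : qf 1%:M v <= 0 -> v = 0.
Proof.
have hs : qf 1%:M v = \sum_i v i 0 ^+ 2.
  by rewrite /bf mulmx1 mxE; apply: eq_bigr => i _; rewrite mxE expr2.
move=> h; apply/matrixP => i j; rewrite ord1 mxE; apply/eqP; rewrite -sqrf_eq0 eq_le sqr_ge0 andbT.
apply: le_trans h; rewrite hs (bigD1 i)//= lerDl sumr_ge0// => k _; exact: sqr_ge0.
Qed.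

Lemma spd1 (R : realType) (n : nat) : spdmx (1%:M : 'M[R]_n).
Proof.
split=> [|v v0]; first by rewrite trmx1.
rewrite ltNge; apply: contra v0 => h; apply/eqP; exact: qf1_eq0.
Qed.

Lemma mxprimZ (R : realType) (m n : nat) (a b : R) (k k' : R -> R) (F f : R -> 'M[R]_(m, n)) :
  prim a b k k' -> mxprim a b F f ->
  mxprim a b (fun u => k u *: F u) (fun u => k' u *: F u + k u *: f u).
Proof. by move=> hk hF i j; apply: prim_ext (primM hk (hF i j)) => u; rewrite !mxE. Qed.

Lemma mxprim_exists (R : realType) (m n : nat) (a b : R) (f : R -> 'M[R]_(m, n)) :
  mxcts a b f -> exists2 F, mxprim a b F f & F a = 0.
Proof.
move=> hf.
have h (p : 'I_m * 'I_n) : exists G, prim a b G (fun u => f u p.1 p.2) /\ G a = 0.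
  by have [G hG G0] := prim_exists (hf p.1 p.2); exists G.
have [G hG] := choice h.
exists (fun u => \matrix_(i, j) G (i, j) u).
  by move=> i j; apply: prim_ext (hG (i, j)).1 => u //; rewrite mxE.
by apply/matrixP => i j; rewrite !mxE (hG (i, j)).2.
Qed.

Lemma mxprim_const (R : realType) (m n : nat) (a b : R) (F : R -> 'M[R]_(m, n)) :
  a <= b -> mxprim a b F (fun=> 0) -> F b = F a.
Proof.
move=> ab hF; apply/matrixP => i j; apply/eqP; rewrite -subr_eq0 -normr_le0.
rewrite -(mul0r (b - a)); apply: prim_norm_le (hF i j) _ => // u _.
by rewrite mxE normr0.
Qed.

Lemma prim_zero (R : realType) (a b : R) (F f : R -> R) : prim a b F f ->
  (forall u, a < u < b -> F u = 0) -> forall u, a < u < b -> f u = 0.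
Proof.
move=> [_ hF] F0 u hu; have h := hF u hu.
have h0 : is_derive u (1:R) F 0.
  apply: near_eq_is_derive (is_derive_cst (0 : R) u 1).
  near=> x; rewrite F0//.
  have : x \in `]a, b[ by near: x; apply: near_in_itvoo; rewrite in_itv.
  by rewrite in_itv.
by rewrite -(@derive_val _ _ _ _ _ _ _ h) (@derive_val _ _ _ _ _ _ _ h0).
Unshelve. all: by end_near. Qed.

Lemma cts_zero_left (R : realType) (a b : R) (F : R -> R) : a < b -> cts a b F ->
  (forall u, a < u < b -> F u = 0) -> F a = 0.
Proof.
move=> ab cF F0; apply/eqP; rewrite -normr_le0; apply/ler_addgt0Pl => e e0.
rewrite addr0; have [d d0 hd] := cts_uniform cF e0.
pose u := a + Num.min (d / 2) ((b - a) / 2).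
have m0 : 0 < Num.min (d / 2) ((b - a) / 2).
  by rewrite lt_min !divr_gt0// subr_gt0.
have m1 : Num.min (d / 2) ((b - a) / 2) <= d / 2 by rewrite ge_min lexx.
have m2 : Num.min (d / 2) ((b - a) / 2) <= (b - a) / 2 by rewrite ge_min lexx orbT.
have hu : a < u < b by rewrite /u; apply/andP; split; lra.
rewrite -[F a]subr0 -(F0 u hu); apply/ltW/hd.
- by rewrite lexx ltW.
- by case/andP: hu => /ltW-> /ltW->.
- rewrite /u opprD addNKr normrN gtr0_norm//; lra.
Qed.

(** * Uniform bounds for the Riccati flow *)

(** The observability matrix has a left inverse. *)
Lemma observable_ker (R : realType) (r1 r2 : nat) (A : 'M[R]_r1) (C : 'M[R]_(r2, r1)) v :
  observable A C -> (forall k, C *m A ^+ k *m v = 0 :> 'cV_r2) -> v = 0.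
Proof.
move=> hobs hk.
have /row_fullP[B hB] : row_full (\mxcol_(i < r1) (C *m A ^+ i)) by apply/eqP.
rewrite -[v]mul1mx -hB -mulmxA mxcol_mul.
rewrite (_ : \mxcol_i _ = 0) ?mulmx0//.
under eq_mxcol => i do rewrite hk.
exact: mxcol0.
Qed.

(** [W] is the integral over [[0, 1]] of
    [N u = e^{-u} e^{-u A^T} C^T C e^{-u A}]. Since
    [N' = - (N + A^T N + N A)], the left-hand side is the form of [N 0 - N 1],
    and [N 0 = C^T C]. If the form of [W] vanishes at [v], then
    [C e^{-u A} v = 0] on [[0, 1]]; its derivatives at [0] are the [C A^k v] up
    to sign. *)
Lemma observable_lyapunov (R : realType) (r1 r2 : nat) (A : 'M[R]_r1) (C : 'M[R]_(r2, r1)) :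
  observable A C ->
  exists2 W, spdmx W & forall v, qf (A^T *m W + W *m A + W) v <= qf (C^T *m C) v.
Proof.
move=> hobs.
have [Y Y0 hY] := lin_ode_exists (- A^T) 0 (1%:M : 'M[R]_r1).
pose e (u : R) := expR (-1 * u).
pose N u := e u *: (Y u *m (C^T *m C) *m (Y u)^T).
have qN u v : qf (N u) v = e u * qf 1%:M (C *m (Y u)^T *m v).
  rewrite -mulmxA -qf_gram /N /bf -scalemxAr -scalemxAl mxE; congr (_ * _).
  by rewrite trmx_mul trmxK !mulmxA.
have hN : mxprim 0 1 N (fun u => - (N u + A^T *m N u + N u *m A)).
  apply: mxprim_eq (mxprimZ (prim_expR 0 1 (-1))
    (mxprimM (mxprimMr (C^T *m C) (hY 0 1)) (mxprimT (hY 0 1)))) => u _.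
  rewrite /N -/(e u) !(trmx_add, trmx_opp, trmx_mul, trmxK) -!scalemxAr -!scalemxAl.
  mx_abel.
have [Psi hPsi Psi0] := mxprim_exists (mxprim_cts hN).
have hE : mxprim 0 1 (fun u => A^T *m Psi u + Psi u *m A + Psi u + N u) (fun=> 0).
  have h := mxprimD (mxprimD (mxprimD (mxprimMl A^T hPsi) (mxprimMr A hPsi)) hPsi) hN.
  apply: mxprim_eq h => u _; mx_abel.
have NE : N 0 = C^T *m C by rewrite /N /e mulr0 expR0 scale1r Y0 trmx1 mulmx1 mul1mx.
have WE := mxprim_const ler01 hE.
rewrite Psi0 mul0mx mulmx0 !add0r NE in WE.
have Wsym : (Psi 1)^T = Psi 1.
  have h : mxprim 0 1 (fun u => Psi u - (Psi u)^T) (fun=> 0).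
    apply: mxprim_eq (mxprimB hPsi (mxprimT hPsi)) => u _.
    apply/eqP; rewrite subr_eq0 /N; apply/eqP.
    rewrite [in RHS]linearZ/=; congr (_ *: _).
    by rewrite !(trmx_mul, trmxK) !mulmxA.
  have := mxprim_const ler01 h; rewrite Psi0 trmx0 subrr => /eqP.
  by rewrite subr_eq0 => /eqP <-.
exists (Psi 1); last first.
  move=> v; rewrite -WE [leRHS]bfDM lerDl qN mulr_ge0 ?expR_ge0//; exact: qf1_ge0.
split=> // v v0; rewrite ltNge; apply/negP => h.
have hf := prim_bf v v hPsi.
have hinc := prim_homo hf (fun u _ => (_ : 0 <= qf (N u) v)).
have {}hinc x y : 0 <= x -> x <= y -> y <= 1 -> qf (Psi x) v <= qf (Psi y) v.
  by apply: hinc => u; rewrite qN mulr_ge0 ?expR_ge0//; exact: qf1_ge0.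
have f0 u : 0 < u < 1 -> qf (Psi u) v = 0.
  move=> /andP[u0 u1]; apply/eqP; rewrite eq_le; apply/andP; split.
    by rewrite (le_trans _ h)//; apply: hinc => //; exact: ltW.
  have : qf (Psi 0) v <= qf (Psi u) v by apply: hinc => //; exact: ltW.
  by rewrite Psi0 {1}/bf mulmx0 mul0mx mxE.
have N0 := prim_zero hf f0.
have g0 k : forall u, 0 < u < 1 -> C *m (Y u)^T *m (A ^+ k *m v) = 0.
  elim: k => [u hu|k IH u hu].
    rewrite expr0 mul1mx; apply: qf1_eq0.
    by have := N0 u hu; rewrite qN => /eqP; rewrite mulf_eq0 gt_eqF ?expR_gt0//= => /eqP->.
  have hg := mxprimMr (A ^+ k *m v) (mxprimMl C (mxprimT (hY 0 1))).
  apply/matrixP => i j; rewrite [RHS]mxE.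
  have gz x : 0 < x < 1 -> (C *m (Y x)^T *m (A ^+ k *m v)) i j = 0 by move=> hx; rewrite IH// mxE.
  have := prim_zero (hg i j) gz hu.
  rewrite mulNmx trmx_opp trmx_mul trmxK mulmxN mulNmx mxE.
  by move/eqP; rewrite oppr_eq0 exprS => /eqP <-; rewrite !mulmxA.
suff v00 : v = 0 by rewrite v00 eqxx in v0.
apply: (observable_ker hobs) => k.
have hg := mxprimMr (A ^+ k *m v) (mxprimMl C (mxprimT (hY 0 1))).
apply/matrixP => i j; rewrite [RHS]mxE.
have gz x : 0 < x < 1 -> (C *m (Y x)^T *m (A ^+ k *m v)) i j = 0 by move=> hx; rewrite g0// mxE.
have := cts_zero_left ltr01 (prim_cts (hg i j)) gz.
by rewrite Y0 trmx1 mulmx1 mulmxA.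
Qed.

(** The difference of the two sides is the form of [R2] at
    [(invmx R2 *m C *m P - K^T) *m y]. *)
Lemma complete_square (R : realType) (r1 r2 : nat) (C : 'M[R]_(r2, r1)) (R2 : 'M[R]_r2)
    (P : 'M[R]_r1) (K : 'M[R]_(r1, r2)) y :
  spdmx R2 -> P^T = P ->
  qf (K *m C *m P + P *m C^T *m K^T - P *m (C^T *m invmx R2 *m C) *m P) y
   <= qf (K *m R2 *m K^T) y.
Proof.
move=> hR2 hP; have uR := spd_unit hR2.
have [/esym hDs _] := spd_inv hR2; set D := invmx R2 in hDs *.
have h1 m (X : 'M[R]_(m, r2)) : X *m D *m R2 = X by rewrite -mulmxA mulVmx ?mulmx1.
have h2 m (X : 'M[R]_(m, r2)) : X *m R2 *m D = X by rewrite -mulmxA mulmxV ?mulmx1.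
have := spd_ge0 ((D *m C *m P - K^T) *m y) hR2.
rewrite -bfMr.
have -> : bf (R2 *m (D *m C *m P - K^T)) ((D *m C *m P - K^T) *m y) y =
   qf ((D *m C *m P - K^T)^T *m (R2 *m (D *m C *m P - K^T))) y.
  by rewrite [RHS]bfMl trmxK.
move=> h; rewrite -subr_ge0 -bfNM -bfDM; move: h.
set M2 := (X in 0 <= qf X y -> _); set M1 := (X in _ -> 0 <= qf X y).
suff -> : M1 = M2 by [].
rewrite /M1 /M2 !(trmx_add, trmx_opp, trmx_mul, trmxK) hP -hDs.
rewrite !(mulmxDl, mulmxDr, mulNmx, mulmxN, mulmxA, opprK) !h1 !h2.
mx_abel.
Qed.

(** The gain [K = invmx W *m C^T] is not optimal, so [P] lies below the
    solution of a linear equation with drift [B = A - K C] ([complete_square]).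
    Along the adjoint solution [y' = - B^T y] the form [q] of [invmx W] satisfies
    [q <= q'] by the inequality on [W], so [q] decays at unit rate from [t] back
    to [s], while the form of [P] has a derivative of at most [c0 q]. This is why
    the initial condition [cQ] appears with an exponentially small factor. *)
Lemma riccati_upper (R : realType) (r1 r2 : nat) (A : 'M[R]_r1) (C : 'M[R]_(r2, r1))
    (R1 : 'M[R]_r1) (R2 : 'M[R]_r2) (W : 'M[R]_r1) (P : R -> 'M[R]_r1) (c0 cQ s t : R) :
  s <= t -> spdmx R2 -> spdmx W ->
  (forall v, qf (A^T *m W + W *m A + W) v <= qf (C^T *m C) v) ->
  0 <= c0 -> 0 <= cQ ->
  (forall v, qf (R1 + (invmx W *m C^T) *m R2 *m (invmx W *m C^T)^T) v <= c0 * qf (invmx W) v) ->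
  (forall v, qf (P s) v <= cQ * qf (invmx W) v) ->
  (forall u, s <= u <= t -> (P u)^T = P u) ->
  mxprim s t P (fun u => ric A (C^T *m invmx R2 *m C) R1 (P u)) ->
  forall v, qf (P t) v <= (c0 + cQ * expR (- (t - s))) * qf (invmx W) v.
Proof.
move=> st hR2 hW hWA c00 cQ0 hc0 hcQ hPsym hP v.
have hZ := spd_inv hW; have uW := spd_unit hW.
set Z := invmx W in hc0 hcQ hZ *; pose K := Z *m C^T.
pose B := A - K *m C.
have [y yt hy] := lin_ode_exists (- B^T) t v.
have hh := prim_qf hP (hy s t).
have hz := prim_qf (mxprim_cst s t Z) (hy s t).
have z' u : qf Z (y u) <= bf Z (- B^T *m y u) (y u) + bf 0 (y u) (y u) + bf Z (y u) (- B^T *m y u).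
  rewrite -[bf Z (_ *m _) _]/(bf Z (_ *m _) _) -bfMr.
  have -> : bf Z (- B^T *m y u) (y u) = qf (- B *m Z) (y u).
    by rewrite bfMl trmx_opp.
  rewrite -!bfDM.
  have h := hWA (Z *m y u).
  have h0 := qf1_ge0 (C *m (Z *m y u)); rewrite -qf_gram in h0.
  have hconj (M : 'M[R]_r1) : qf M (Z *m y u) = qf (Z *m M *m Z) (y u).
    by rewrite bfMr bfMl hZ.1.
  rewrite !hconj in h h0.
  rewrite -subr_ge0 -bfNM -bfDM.
  rewrite -subr_ge0 -bfNM -bfDM in h.
  apply: le_trans (addr_ge0 h h0) _; rewrite -bfDM.
  set M1 := (X in qf X _ <= _); set M2 := (X in _ <= qf X _).
  suff -> : M1 = M2 by [].
  have e1 m (X : 'M[R]_(m, r1)) : X *m W *m Z = X by rewrite -mulmxA mulmxV ?mulmx1.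
  have e2 m (X : 'M[R]_(m, r1)) : X *m Z *m W = X by rewrite -mulmxA mulVmx ?mulmx1.
  have e3 : Z *m W = 1%:M by rewrite mulVmx.
  rewrite /M1 /M2 /B /K !(trmx_add, trmx_opp, trmx_mul, trmxK) hZ.1.
  rewrite !(mulmxDl, mulmxDr, mulNmx, mulmxN, mulmxA, opprK) !e1 !e3 !mul1mx.
  mx_abel.
have h' u : s < u < t -> bf (P u) (- B^T *m y u) (y u) +
    bf (ric A (C^T *m invmx R2 *m C) R1 (P u)) (y u) (y u) + bf (P u) (y u) (- B^T *m y u)
    <= c0 * qf Z (y u).
  move=> /andP[su ut]; have hu : s <= u <= t by rewrite !ltW.
  apply: le_trans (hc0 (y u)).
  have := complete_square C K (y u) hR2 (hPsym u hu).
  rewrite bfDM -/K => h; rewrite -lerBlDl; apply: le_trans h.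
  rewrite -bfMr -[bf (P u) (- B^T *m _) _]/(bf (P u) (- B^T *m _) _).
  have -> : bf (P u) (- B^T *m y u) (y u) = qf (- B *m P u) (y u).
    by rewrite bfMl trmx_opp.
  rewrite -!bfDM -bfNM -bfDM.
  set M1 := (X in qf X _ <= _); set M2 := (X in _ <= qf X _).
  suff -> : M1 = M2 by [].
  rewrite /M1 /M2 /ric /B !(trmx_add, trmx_opp, trmx_mul, trmxK).
  mx_abel.
have hzs : qf Z (y s) <= expR (- (t - s)) * qf Z (y t).
  have hze := primM hz (prim_expR s t (-1)).
  have := prim_homo hze _ (lexx s) st (lexx t).
  rewrite opprB expRD !mulN1r => h.
  have es : expR s * expR (- s) = 1 by rewrite -expRD subrr expR0.
  rewrite -(ler_pM2r (expR_gt0 (- s))).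
  rewrite (_ : expR s * _ * _ * _ = (expR s * expR (- s)) * (qf Z (y t) * expR (- t))); last by ring.
  rewrite es mul1r; apply: h => u hu.
  by rewrite [-1 * expR _]mulN1r mulrN -mulrBl mulr_ge0 ?expR_ge0// subr_ge0 z'.
have := prim_homo (primB (primZ c0 hz) hh) _ (lexx s) st (lexx t).
rewrite yt => /(_ _)H.
have {H} : c0 * qf Z (y s) - qf (P s) (y s) <= c0 * qf Z v - qf (P t) v.
  apply: H => u hu; rewrite subr_ge0 (le_trans (h' u hu))// ler_wpM2l//; exact: z'.
have := hcQ (y s); have := spd_ge0 (y s) hZ; rewrite yt in hzs.
have : 0 <= expR (- (t - s)) by exact: expR_ge0.
nra.
Qed.

Lemma prim_exp (R : realType) (a b : R) (F f : R -> R) : prim a b F f ->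
  prim a b (fun u => expR (F u)) (fun u => f u * expR (F u)).
Proof.
move=> [cF dF]; split; first by apply: cts_comp => //; exact: continuous_expR.
move=> u hu; have h := dF u hu.
have := @is_derive1_comp R expR F u (expR (F u)) (f u) (is_derive_expR _) h.
by rewrite mulrC.
Qed.

(** By [transported_cov], [P t] is a transport of [P s] plus the integral of
    nonnegative forms. *)
Lemma riccati_ge0 (R : realType) (r : nat) (A S R1 : 'M[R]_r) (P : R -> 'M[R]_r) (s t : R) :
  s <= t -> S^T = S -> (forall v, 0 <= qf S v) -> (forall v, 0 <= qf R1 v) ->
  (forall v, 0 <= qf (P s) v) -> (forall u, s <= u <= t -> (P u)^T = P u) ->
  mxprim s t P (fun u => ric A S R1 (P u)) -> forall v, 0 <= qf (P t) v.
Proof.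
move=> st hS S0 R10 Ps0 hPsym hP v.
have [L Lt hL] := closed_loop_transition st hS hPsym hP.
have hK := prim_bf v v (transported_cov hS hPsym hP hL).
have := prim_homo hK _ (lexx s) st (lexx t).
rewrite Lt trmx1 mulmx1 mul1mx => h.
apply: le_trans (h _); last first.
  move=> u /andP[su ut]; rewrite qf_congr bfDM addr_ge0//.
  by rewrite qf_congr_sym// hPsym ?ltW.
by rewrite qf_congr.
Qed.

(** Let [m] be the form of [L P L^T] at [v]. By [transported_cov] its
    derivative is at least the form of [R1] at [w = L^T v], and the bound on [P]
    gives [m <= c0 k (1 + x0 e^{-(u - s)}) qf R1 w] with [x0 = cQ / c0]. So [m]
    grows at the rate [beta = (c0 k)^-1] once the transient of [P] is over, and
    this transient costs at most the factor [exp (beta x0)]. As [L t = 1], the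
    growth reads as a decay of [L s]. The rate is the same for all initial
    conditions, since these only affect [x0]. *)
Lemma transition_decay (R : realType) (r : nat) (A S R1 Z : 'M[R]_r) (P L : R -> 'M[R]_r)
    (c0 cQ k s t : R) :
  s <= t -> S^T = S -> (forall v, 0 <= qf S v) -> 0 < c0 -> 0 < cQ -> 0 < k ->
  (forall v, 0 <= qf R1 v) -> (forall v, qf Z v <= k * qf R1 v) ->
  (forall u, s <= u <= t -> (P u)^T = P u) ->
  (forall u, s <= u <= t -> forall v, 0 <= qf (P u) v) ->
  (forall u, s <= u <= t -> forall v, qf (P u) v <= (c0 + cQ * expR (- (u - s))) * qf Z v) ->
  mxprim s t P (fun u => ric A S R1 (P u)) ->
  L t = 1%:M -> mxprim s t L (fun u => - (L u *m (A - P u *m S))) ->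
  forall v, qf (P s) ((L s)^T *m v) <=
    expR (cQ / (c0 * k * c0)) * expR (- (c0 * k)^-1 * (t - s)) * qf (P t) v.
Proof.
move=> st hS S0 c00 cQ0 k0 R10 hZ hPsym P0 Pup hP Lt hL v.
set beta := (c0 * k)^-1; set x0 := cQ / c0.
have b0 : 0 < beta by rewrite invr_gt0 mulr_gt0.
have x00 : 0 < x0 by rewrite divr_gt0.
have hK := prim_bf v v (transported_cov hS hPsym hP hL).
have hshift : prim s t (fun u => - (u - s)) (fun=> -1).
  apply: prim_ext (primN (primB (prim_id s t) (prim_cst s t s))) => u //.
  by rewrite subr0.
have he := prim_exp hshift.
have hg := prim_exp (primB (primZ beta hshift) (primZ (beta * x0) he)).
have := prim_homo (primM hK hg) _ (lexx s) st (lexx t).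
rewrite Lt trmx1 mulmx1 mul1mx subrr oppr0 expR0 mulr0 mulr1 sub0r => h.
have {h} : bf (L s *m P s *m (L s)^T) v v * expR (- (beta * x0)) <=
    bf (P t) v v * expR (beta * - (t - s) - beta * x0 * expR (- (t - s))).
  apply: h => u /andP[su ut]; have hu : s <= u <= t by rewrite !ltW.
  rewrite mulrA -mulrDl mulr_ge0 ?expR_ge0//.
  rewrite -[beta * x0 * _]mulrA -mulrBr mulrCA.
  rewrite !qf_congr bfDM.
  set w := (L u)^T *m v; set e := expR _.
  have e0 : 0 < e by exact: expR_gt0.
  have m0 := P0 u hu w; have m1 := Pup u hu w; have z1 := hZ w.
  have r0 := R10 w.
  have s0 : 0 <= qf (P u *m S *m P u) w by rewrite qf_congr_sym// hPsym.
  rewrite -/e in m1.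
  set m := qf (P u) w in m0 m1 *; set q := qf R1 w in z1 r0 *.
  set z := qf Z w in m1 z1.
  have m2 : beta * m <= (1 + x0 * e) * q.
    have -> : (1 + x0 * e) * q = beta * ((c0 + cQ * e) * (k * q)).
      by rewrite /beta /x0; field; rewrite !gt_eqF.
    rewrite ler_pM2l//; apply: le_trans m1 _; rewrite ler_wpM2l// addr_ge0 ?ltW//.
    exact: mulr_gt0.
  rewrite mulrCA; set x := x0 * e in m2 *.
  have xx : 0 < x by rewrite mulr_gt0.
  have y0 : 0 <= beta * m by rewrite mulr_ge0// ltW.
  have -> : x0 * (-1 * e) = - x by rewrite mulN1r mulrN.
  rewrite opprK.
  move: y0 m2; set y := beta * m => y0 m2.
  rewrite (_ : m * _ = - (y * (1 - x))); last by rewrite /y; ring.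
  (* [1 - x <= 1 / (1 + x)]: the growth rate is replaced by a smaller one with an
     explicit primitive, which is the exponent in [hg]. *)
  suff : y * (1 - x) <= q by lra.
  have [x1|x1] := leP 1 x; nra.
rewrite mulNr -mulrN; set d := beta * - _.
have -> : cQ / (c0 * k * c0) = beta * x0.
  by rewrite /beta /x0; field; rewrite !gt_eqF.
set f := beta * x0 => h.
rewrite -qf_congr.
have ef : expR f * expR (- f) = 1 by rewrite -expRD subrr expR0.
rewrite -(ler_pM2r (expR_gt0 (- f))) (le_trans h)//.
rewrite (_ : _ * qf (P t) v * _ = (expR f * expR (- f)) * (qf (P t) v * expR d)); last by ring.
rewrite ef mul1r ler_wpM2l ?P0 ?st ?lexx// ler_expR gerBl.
by rewrite mulr_ge0 ?expR_ge0// mulr_ge0 ?ltW.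
Qed.

Lemma riccati_flow_mxprim (R : realType) (r : nat) (A S R1 : 'M[R]_r) phi s t Q :
  is_riccati_flow A S R1 phi -> 0 <= s -> spdmx Q ->
  mxprim s t (fun u => phi s u Q) (fun u => ric A S R1 (phi s u Q)).
Proof.
move=> hphi s0 hQ i j; have [_ hc hd] := hphi s Q s0 hQ; split.
  have hc' : {within `[s, t], continuous (fun t => phi s t Q)}.
    by apply: continuous_subspaceW hc => x /=; rewrite !in_itv/= => /andP[->].
  move/subspace_continuousP : hc' => hc'.
  apply/subspace_continuousP => x hx.
  exact: (cvg_comp _ _ (hc' x hx) (@coord_continuous _ _ _ i j _)).
move=> u /andP[su _]; have [h1 h2] := hd u su.
have h3 := (derivable_mxP _ _ _).1 h1 i j.
apply: DeriveDef => //.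
by rewrite derive_mx// in h2; rewrite /ric -h2 mxE.
Qed.

(** Collects the facts about the Riccati flow on which the probabilistic part
    relies: [a1] bounds the transition matrix, [a2] the covariance, and [beta] is
    chosen before [Q]. The decay of [(L s)^T] given by [transition_decay] passes
    to [L s] by duality. *)
Lemma riccati_estimates (R : realType) (r1 r2 : nat) (A : 'M[R]_r1) (C : 'M[R]_(r2, r1))
    (R1 : 'M[R]_r1) (R2 : 'M[R]_r2) (S : 'M[R]_r1) phi :
  spdmx R1 -> spdmx R2 -> observable A C -> S = C^T *m invmx R2 *m C ->
  is_riccati_flow A S R1 phi ->
  exists2 beta : R, 0 < beta & forall Q, exists a1 a2 : R, [/\ 0 < a1, 0 < a2 &
    spdmx Q -> forall s t, 0 <= s -> s <= t ->
    (forall u, s <= u <= t -> (phi s u Q)^T = phi s u Q) /\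
    exists L : R -> 'M[R]_r1,
    [/\ L t = 1%:M, mxprim s t L (fun u => - (L u *m (A - phi s u Q *m S))),
      forall v, norm2 (L s *m v) <= a1 * expR (- beta * (t - s)) * norm2 v &
      forall v, qf (phi s t Q) v <= a2 * qf 1%:M v]].
Proof.
move=> hR1 hR2 hobs hS hphi.
have [W hW hWA] := observable_lyapunov hobs.
have hZ := spd_inv hW; set Z := invmx W in hZ.
have [c0 c00 hc0] := spd_dominates (R1 + (Z *m C^T) *m R2 *m (Z *m C^T)^T) hZ.
have [k k0 hk] := spd_dominates Z hR1.
have [cZ cZ0 hcZ] := bf_bound Z.
have b0 : 0 < (c0 * k)^-1 by rewrite invr_gt0 mulr_gt0.
have R2inv := spd_inv hR2.
have Ssym : S^T = S by rewrite hS !trmx_mul trmxK R2inv.1 mulmxA.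
have S0 v : 0 <= qf S v.
  by rewrite hS -{2}[C]trmxK qf_congr; exact: spd_ge0.
(* The square root turns a bound on squared norms into one on norms. *)
exists ((c0 * k)^-1 / 2); first by rewrite divr_gt0.
move=> Q; have [hQ|nQ] := pselect (spdmx Q); last by exists 1, 1.
have [cQ cQ0 hcQ] := spd_dominates Q hZ.
have [cq cq0 hcq] := spd_lower hQ.
(* [cq] compares the Euclidean norm with the form of [Q], the second factor is the
   transient in [transition_decay], the third one bounds [phi s t Q]. *)
pose kap2 := cq * expR (cQ / (c0 * k * c0)) * ((c0 + cQ) * cZ).
have kap20 : 0 < kap2 by rewrite !mulr_gt0 ?expR_gt0// addr_gt0.
exists (Num.sqrt kap2), ((c0 + cQ) * cZ); split=> //.
- by rewrite sqrtr_gt0.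
- by rewrite mulr_gt0// addr_gt0.
move=> _ s t s0 st.
have hP t' := riccati_flow_mxprim t' hphi s0 hQ.
have Ps : phi s s Q = Q by have [] := hphi s Q s0 hQ.
have hPsym t' : forall u, s <= u <= t' -> (phi s u Q)^T = phi s u Q.
  by apply: (riccati_sym Ssym hR1.1 _ (hP t')); rewrite Ps hQ.1.
split; first exact: hPsym.
have R10 v : 0 <= qf R1 v by exact: spd_ge0.
have P0 u : s <= u -> forall v, 0 <= qf (phi s u Q) v.
  move=> su; apply: (riccati_ge0 su Ssym S0 R10 _ (hPsym u) (hP u)) => v.
  by rewrite Ps; exact: spd_ge0.
have Pup u : s <= u -> forall v,
    qf (phi s u Q) v <= (c0 + cQ * expR (- (u - s))) * qf Z v.
  move=> su; apply: (riccati_upper su hR2 hW hWA (ltW c00) (ltW cQ0) hc0 _ (hPsym u)).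
    by rewrite Ps.
  by rewrite -hS; exact: hP.
have Pup2 v : qf (phi s t Q) v <= (c0 + cQ) * cZ * qf 1%:M v.
  apply: le_trans (Pup t st v) _; rewrite -mulrA; apply: ler_pM => //.
  - by rewrite addr_ge0 ?mulr_ge0 ?expR_ge0 ?ltW.
  - exact: spd_ge0.
  - by rewrite lerD2l ler_piMr ?(ltW cQ0)// -[leRHS]expR0 ler_expR oppr_le0 subr_ge0.
have [L Lt hL] := closed_loop_transition st Ssym (hPsym t) (hP t).
exists L; split=> //.
have hdec := transition_decay st Ssym S0 c00 cQ0 k0 R10 hk (hPsym t)
  (fun u hu => P0 u (proj1 (andP hu))) (fun u hu => Pup u (proj1 (andP hu))) (hP t) Lt hL.
have hLT v : qf 1%:M ((L s)^T *m v) <= kap2 * expR (- (c0 * k)^-1 * (t - s)) * qf 1%:M v.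
  apply: le_trans (hcq _) _.
  rewrite (_ : kap2 * _ * _ = cq * (expR (cQ / (c0 * k * c0)) *
    expR (- (c0 * k)^-1 * (t - s)) * ((c0 + cQ) * cZ * qf 1%:M v))); last first.
    by rewrite /kap2; ring.
  rewrite ler_pM2l//; move: (hdec v); rewrite Ps => /le_trans; apply.
  by rewrite ler_wpM2l ?mulr_ge0 ?expR_ge0.
move=> v; set lam := L s *m v.
have hlam : bf 1%:M ((L s)^T *m lam) v = qf 1%:M lam.
  by rewrite -bfMl mulmx1 {3}/lam -bfMr mul1mx.
have hCS := spd_cauchy_schwarz ((L s)^T *m lam) v (spd1 R r1).
rewrite hlam in hCS.
have hsq : qf 1%:M lam <= kap2 * expR (- (c0 * k)^-1 * (t - s)) * qf 1%:M v.
  have l0 := qf1_ge0 lam; have v0 := qf1_ge0 v.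
  have K0 : 0 <= kap2 * expR (- (c0 * k)^-1 * (t - s)) by rewrite mulr_ge0 ?expR_ge0 ?ltW.
  move: l0; rewrite le_eqVlt => /predU1P[<-|l0]; first by rewrite mulr_ge0.
  rewrite -(ler_pM2r l0) -expr2 (le_trans hCS)//.
  by rewrite [leRHS]mulrAC ler_wpM2r.
rewrite -(@ler_pXn2r _ 2) ?nnegrE ?sqrtr_ge0//; last first.
  by rewrite !mulr_ge0 ?sqrtr_ge0 ?expR_ge0.
rewrite !exprMn !sq_norm2 sqr_sqrtr ?(ltW kap20)// -expRM_natl.
rewrite (_ : 2 * _ = - (c0 * k)^-1 * (t - s))//.
by move: (c0 * k)^-1 => z; field.
Qed.

(** * Pathwise variation of constants *)

Lemma mxprim_mxintegral (R : realType) (n : nat) (s t : R) (f : R -> 'cV[R]_n) :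
  mxcts s t f -> mxprim s t (fun x => mxintegral s x f) f.
Proof.
move=> hf i j; rewrite (ord1 j).
by apply: prim_ext (prim_integral (hf i 0)) => u //; rewrite mxE.
Qed.

Lemma mxintegral_id (R : realType) (n : nat) (s : R) (f : R -> 'cV[R]_n) :
  mxintegral s s f = 0.
Proof. by apply/matrixP => i j; rewrite !mxE set_itv1 Rintegral_set1. Qed.

Lemma prim_incr_unique (R : realType) (a b : R) (F G f : R -> R) : a <= b ->
  prim a b F f -> prim a b G f -> F b - F a = G b - G a.
Proof.
move=> ab hF hG; apply/eqP; rewrite -subr_eq0 -normr_le0.
have := prim_norm_le (K := 0) ab (primB hF hG).
rewrite mul0r (_ : F b - G b - _ = F b - F a - (G b - G a)); last by ring.
by apply => u _; rewrite subrr normr0.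
Qed.

Lemma riemann_sumE (R : realType) (m n : nat) (G : R -> 'M[R]_(m, n)) (Y : R -> 'cV[R]_n)
    s t k i : riemann_sum G Y s t k i 0 =
  \sum_l \sum_(j < k) G (grid s t k j) i l * (Y (grid s t k j.+1) l 0 - Y (grid s t k j) l 0).
Proof.
rewrite /riemann_sum summxE exchange_big/=; apply: eq_bigr => j _.
by rewrite mxE; apply: eq_bigr => l _; rewrite !mxE.
Qed.

(** Summation by parts. The increments of [M], a path that is only
    continuous, are traded for those of [H], so the sums converge for each path
    and not merely in probability. *)
Lemma riemann_sum_parts (R : realType) (m n : nat) (s t : R)
    (H H' : R -> 'M[R]_(m, n)) (M : R -> 'cV[R]_n) (Psi : R -> 'cV[R]_m) i : s <= t ->
  mxprim s t H H' -> mxcts s t H' -> mxcts s t M ->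
  mxprim s t Psi (fun u => H' u *m M u) ->
  (fun k => riemann_sum H M s t k i 0) @ \oo -->
    (H t *m M t - H s *m M s - (Psi t - Psi s)) i 0.
Proof.
move=> st hH cH' cM hPsi.
have h l : exists2 psi, prim s t psi (fun u => H' u i l * M u l 0) & psi s = 0.
  by apply: prim_exists; exact: ctsM (cH' i l) (cM l 0).
have hc l : exists psi, prim s t psi (fun u => H' u i l * M u l 0).
  by have [psi ? _] := h l; exists psi.
have [psi hpsi] := choice hc.
have hsum : prim s t (fun u => \sum_l psi l u) (fun u => (H' u *m M u) i 0).
  by apply: prim_ext (prim_sum (index_enum _) hpsi) => u //; rewrite mxE.
have -> : (H t *m M t - H s *m M s - (Psi t - Psi s)) i 0 =
    \sum_l (H t i l * M t l 0 - H s i l * M s l 0 - (psi l t - psi l s)).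
  have := prim_incr_unique st (hPsi i 0) hsum.
  by rewrite !sumrB !mxE => ->.
under eq_cvg do rewrite riemann_sumE.
apply: cvg_sumR => l.
have hrs := riemann_stieltjes_cvg st (cM l 0) (hH i l) (cH' i l) (hpsi l)
  (xi := fun k j => grid s t k j.+1).
have hE : \forall k \near \oo, H t i l * M t l 0 - H s i l * M s l 0 -
   \sum_(j < k) M (grid s t k j.+1) l 0 * (H (grid s t k j.+1) i l - H (grid s t k j) i l) =
   \sum_(j < k) H (grid s t k j) i l * (M (grid s t k j.+1) l 0 - M (grid s t k j) l 0).
  near=> k.
  have k0 : (0 < k)%N by near: k; exact: nbhs_infty_gt.
  rewrite -{1 2}(gridE s t k0) -{3 4}(grid0 s t k).
  rewrite -(@telescope_sumr _ 0 k (fun j => H (grid s t k j) i l * M (grid s t k j) l 0))//.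
  rewrite big_mkord -sumrB; apply: eq_bigr => j _; ring.
apply: cvg_trans (near_eq_cvg hE) _.
apply: cvgB; first exact: cvg_cst.
apply: hrs => k j jk; rewrite lexx andbT grid_le.
Unshelve. all: by end_near. Qed.

Lemma riemann_sum_drift (R : realType) (m n : nat) (s t : R)
    (G : R -> 'M[R]_(m, n)) (I I' : R -> 'cV[R]_n) (Phi : R -> 'cV[R]_m) i : s <= t ->
  mxcts s t G -> mxprim s t I I' -> mxcts s t I' ->
  mxprim s t Phi (fun u => G u *m I' u) ->
  (fun k => riemann_sum G I s t k i 0) @ \oo --> (Phi t - Phi s) i 0.
Proof.
move=> st cG hI cI' hPhi.
have h l : exists psi, prim s t psi (fun u => I' u l 0 * G u i l).
  have [psi ? _] := prim_exists (ctsM (cI' l 0) (cG i l)).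
  by exists psi.
have [psi hpsi] := choice h.
have hsum : prim s t (fun u => \sum_l psi l u) (fun u => (G u *m I' u) i 0).
  apply: prim_ext (prim_sum (index_enum _) hpsi) => u //; rewrite mxE.
  by apply: eq_bigr => l _; rewrite mulrC.
have -> : (Phi t - Phi s) i 0 = \sum_l (psi l t - psi l s).
  have := prim_incr_unique st (hPhi i 0) hsum.
  by rewrite !sumrB !mxE => ->.
under eq_cvg do rewrite riemann_sumE.
apply: cvg_sumR => l.
apply: (riemann_stieltjes_cvg st (cG i l) (hI l 0) (cI' l 0) (hpsi l)
  (xi := fun k j => grid s t k j)) => k j jk.
by rewrite lexx grid_le.
Qed.

Lemma riemann_sumD (R : realType) (m n : nat) (G : R -> 'M[R]_(m, n)) (Y1 Y2 : R -> 'cV[R]_n)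
    s t k : riemann_sum G (fun u => Y1 u + Y2 u) s t k =
  riemann_sum G Y1 s t k + riemann_sum G Y2 s t k.
Proof.
rewrite /riemann_sum -big_split; apply: eq_bigr => j _.
by rewrite /= -mulmxDr; congr (_ *m _); rewrite opprD addrACA.
Qed.

Lemma riemann_sum_shift (R : realType) (m n : nat) (G : R -> 'M[R]_(m, n)) (Y : R -> 'cV[R]_n)
    c s t k : riemann_sum G (fun u => Y u - c) s t k = riemann_sum G Y s t k.
Proof.
apply: eq_bigr => j _; congr (_ *m _); by rewrite opprB addrA subrK.
Qed.

Lemma riemann_sum_eq (R : realType) (m n : nat) (G : R -> 'M[R]_(m, n)) (Y Y' : R -> 'cV[R]_n)
    s t k : s <= t -> (forall u, s <= u <= t -> Y u = Y' u) ->
  riemann_sum G Y s t k = riemann_sum G Y' s t k.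
Proof.
move=> st h; apply: eq_bigr => j _; congr (_ *m (_ - _)); apply: h.
  exact: (grid_itv st (ltn_ord j)).
exact: (grid_itv st (ltnW (ltn_ord j))).
Qed.

(** Variation of constants for [Z' = F Z + G M'] with a continuous path
    [M]: the derivative [M'] has no meaning by itself, and [G M'] stands for
    [(G M)' - G' M]. The derivative of [L (Z - G M)] no longer contains [Z], and
    [riemann_sum_parts] identifies the result. *)
Lemma voc_riemann (R : realType) (r n : nat) (s t : R) (F L : R -> 'M[R]_r)
    (G G' : R -> 'M[R]_(r, n)) (M : R -> 'cV[R]_n) (Z I J : R -> 'cV[R]_r) z i : s <= t ->
  mxcts s t F -> L t = 1%:M -> mxprim s t L (fun u => - (L u *m F u)) ->
  mxprim s t G G' -> mxcts s t G' -> mxcts s t M -> M s = 0 ->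
  mxprim s t I (fun u => F u *m Z u) -> I s = 0 ->
  mxprim s t J (fun u => G' u *m M u) -> J s = 0 ->
  (forall u, s <= u <= t -> Z u = z + I u + (G u *m M u - J u)) ->
  (fun k => riemann_sum (fun u => L u *m G u) M s t k i 0) @ \oo -->
    (Z t - L s *m z) i 0.
Proof.
move=> st cF Lt hL hG cG' cM Ms hI Is hJ Js hZ.
have hH := mxprimM hL hG.
have cL := mxprim_cts hL; have cG := mxprim_cts hG.
have cH' : mxcts s t (fun u => - (L u *m F u) *m G u + L u *m G' u).
  by apply: mxctsD; [apply: mxctsM => //; apply: mxctsN|]; exact: mxctsM.
have hy : mxprim s t (fun u => L u *m (z + I u - J u))
    (fun u => - ((- (L u *m F u) *m G u + L u *m G' u) *m M u)).
  apply: mxprim_eq (mxprimM hL (mxprimB (mxprimD (mxprim_cst s t z) hI) hJ)) => u /andP[su ut].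
  have hu : s <= u <= t by rewrite !ltW.
  have -> : z + I u - J u = Z u - G u *m M u.
    by rewrite (hZ u hu) [_ *m _ - _]addrC addrA addrK.
  rewrite add0r; mx_abel.
have hPsi : mxprim s t (fun u => - (L u *m (z + I u - J u)))
    (fun u => (- (L u *m F u) *m G u + L u *m G' u) *m M u).
  by apply: mxprim_eq (mxprimN hy) => u _; rewrite opprK.
have := riemann_sum_parts (i := i) st hH cH' cM hPsi.
rewrite Lt Ms Is Js !mul1mx mulmx0 !addr0 !subr0.
rewrite opprK opprD opprK addrA (hZ t) ?st ?lexx//.
by rewrite (_ : G t *m M t + (z + I t - J t) = z + I t + (G t *m M t - J t))//; exact: addrCA.
Qed.

Lemma signal_riemann (R : realType) (r n : nat) (s t : R) (A : 'M[R]_r) (L : R -> 'M[R]_r)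
    (K : 'M[R]_(r, n)) (N : R -> 'cV[R]_n) (Z : R -> 'cV[R]_r) z i : s <= t ->
  L t = 1%:M -> mxprim s t L (fun u => - (L u *m A)) ->
  mxcts s t N -> N s = 0 -> mxcts s t Z ->
  (forall u, s <= u <= t -> Z u = z + mxintegral s u (fun u => A *m Z u) + K *m N u) ->
  (fun k => riemann_sum (fun u => L u *m K) N s t k i 0) @ \oo -->
    (Z t - L s *m z) i 0.
Proof.
move=> st Lt hL cN Ns cZ hZ.
apply: (voc_riemann (F := fun=> A) (G' := fun=> 0)
  (I := fun u => mxintegral s u (fun u => A *m Z u)) (J := fun=> 0)) => //.
- exact: mxcts_cst.
- exact: mxprim_cst.
- exact: mxcts_cst.
- by apply: mxprim_mxintegral; apply: mxctsM => //; exact: mxcts_cst.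
- exact: mxintegral_id.
- by apply: mxprim_eq (mxprim_cst s t 0) => u _; rewrite mul0mx.
- by move=> u hu; rewrite subr0; exact: hZ.
Qed.

Lemma mxprim_row_mx (R : realType) (m n1 n2 : nat) (a b : R)
    (F f : R -> 'M[R]_(m, n1)) (G g : R -> 'M[R]_(m, n2)) :
  mxprim a b F f -> mxprim a b G g ->
  mxprim a b (fun u => row_mx (F u) (G u)) (fun u => row_mx (f u) (g u)).
Proof.
move=> hF hG i j; case: (splitP j) => k jk.
  have -> : j = lshift n2 k by apply: val_inj.
  by apply: prim_ext (hF i k) => u; rewrite row_mxEl.
have -> : j = rshift n1 k by apply: val_inj.
by apply: prim_ext (hG i k) => u; rewrite row_mxEr.
Qed.

Lemma mxcts_row_mx (R : realType) (m n1 n2 : nat) (a b : R)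
    (F : R -> 'M[R]_(m, n1)) (G : R -> 'M[R]_(m, n2)) :
  mxcts a b F -> mxcts a b G -> mxcts a b (fun u => row_mx (F u) (G u)).
Proof.
move=> hF hG i j; case: (splitP j) => k jk.
  have -> : j = lshift n2 k by apply: val_inj.
  by apply: cts_eq (hF i k) => u _; rewrite row_mxEl.
have -> : j = rshift n1 k by apply: val_inj.
by apply: cts_eq (hG i k) => u _; rewrite row_mxEr.
Qed.

Lemma mxcts_col_mx (R : realType) (m n1 n2 : nat) (a b : R)
    (F : R -> 'M[R]_(n1, m)) (G : R -> 'M[R]_(n2, m)) :
  mxcts a b F -> mxcts a b G -> mxcts a b (fun u => col_mx (F u) (G u)).
Proof.
move=> hF hG i j; case: (splitP i) => k jk.
  have -> : i = lshift n2 k by apply: val_inj.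
  by apply: cts_eq (hF k j) => u _; rewrite col_mxEu.
have -> : i = rshift n1 k by apply: val_inj.
by apply: cts_eq (hG k j) => u _; rewrite col_mxEd.
Qed.

Lemma mxctsB_cst (R : realType) (m n : nat) (a b : R) (F : R -> 'M[R]_(m, n)) c :
  mxcts a b F -> mxcts a b (fun u => F u - c).
Proof. by move=> hF; apply: mxctsD => //; exact: mxcts_cst. Qed.

(** Because [G C = P S], the part of the observation that comes from the
    signal combines with the drift of the filter into [(A - P S) (psi - X)]. The
    error is thus a linear equation driven by the pair [(W, V)]. *)
Lemma filter_error_riemann (R : realType) (r1 r2 : nat) (s t : R)
    (A S R1h : 'M[R]_r1) (C : 'M[R]_(r2, r1)) (R2h : 'M[R]_r2)
    (P L : R -> 'M[R]_r1) (G G' : R -> 'M[R]_(r1, r2))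
    (W X psi J : R -> 'cV[R]_r1) (V : R -> 'cV[R]_r2) x i : s <= t ->
  mxcts s t P -> mxprim s t G G' -> mxcts s t G' -> (forall u, G u *m C = P u *m S) ->
  L t = 1%:M -> mxprim s t L (fun u => - (L u *m (A - P u *m S))) ->
  mxcts s t W -> mxcts s t V -> mxcts s t X -> mxcts s t psi ->
  (forall u, s <= u <= t ->
     X u = X s + mxintegral s u (fun u => A *m X u) + R1h *m (W u - W s)) ->
  (forall u, s <= u <= t ->
     psi u = x + mxintegral s u (fun u => (A - P u *m S) *m psi u) + J u) ->
  (forall u, s <= u <= t ->
     J u = mxintegral s u (fun u => G u *m (C *m X u)) + (G u *m (R2h *m (V u - V s))
       - mxintegral s u (fun u => G' u *m (R2h *m (V u - V s))))) ->
  (fun k => riemann_sum (fun u => L u *m row_mx (- R1h) (G u *m R2h))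
     (fun u => col_mx (W u) (V u)) s t k i 0) @ \oo -->
    (psi t - X t - L s *m (x - X s)) i 0.
Proof.
move=> st cP hG cG' GC Lt hL cW cV cX cpsi hX hpsi hJ.
have cG := mxprim_cts hG.
pose I u := mxintegral s u (fun u => (A - P u *m S) *m psi u) +
  mxintegral s u (fun u => G u *m (C *m X u)) - mxintegral s u (fun u => A *m X u).
pose N u := mxintegral s u (fun u => G' u *m (R2h *m (V u - V s))).
have cF : mxcts s t (fun u => A - P u *m S).
  by apply: mxctsD; [exact: mxcts_cst|apply/mxctsN/mxctsM => //; exact: mxcts_cst].
have cM : mxcts s t (fun u => col_mx (W u) (V u) - col_mx (W s) (V s)).
  by apply: mxctsB_cst; exact: mxcts_col_mx.
have ME u : col_mx (W u) (V u) - col_mx (W s) (V s) = col_mx (W u - W s) (V u - V s).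
  by rewrite opp_col_mx add_col_mx.
have := @voc_riemann R r1 (r1 + r2) s t (fun u => A - P u *m S) L
  (fun u => row_mx (- R1h) (G u *m R2h)) (fun u => row_mx 0 (G' u *m R2h))
  (fun u => col_mx (W u) (V u) - col_mx (W s) (V s)) (fun u => psi u - X u) I N
  (x - X s) i st cF Lt hL.
have -> : (fun k : nat => riemann_sum (fun u => L u *m row_mx (- R1h) (G u *m R2h))
     (fun u => col_mx (W u) (V u) - col_mx (W s) (V s)) s t k i 0) =
   (fun k => riemann_sum (fun u => L u *m row_mx (- R1h) (G u *m R2h))
     (fun u => col_mx (W u) (V u)) s t k i 0).
  by apply/funext => k; rewrite riemann_sum_shift.
apply.
- by apply: mxprim_row_mx; [apply: mxprim_cst|exact: mxprimMr].
- by apply: mxcts_row_mx; [exact: mxcts_cst|apply: mxctsM => //; exact: mxcts_cst].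
- exact: cM.
- by rewrite subrr.
- have h1 : mxprim s t (fun u => mxintegral s u (fun u => (A - P u *m S) *m psi u))
      (fun u => (A - P u *m S) *m psi u).
    by apply: mxprim_mxintegral; exact: mxctsM.
  have h2 : mxprim s t (fun u => mxintegral s u (fun u => G u *m (C *m X u)))
      (fun u => G u *m (C *m X u)).
    by apply: mxprim_mxintegral; apply: mxctsM => //; apply: mxctsM => //; exact: mxcts_cst.
  have h3 : mxprim s t (fun u => mxintegral s u (fun u => A *m X u)) (fun u => A *m X u).
    by apply: mxprim_mxintegral; apply: mxctsM => //; exact: mxcts_cst.
  apply: mxprim_eq (mxprimB (mxprimD h1 h2) h3) => u _.
  by rewrite mulmxA GC; mx_abel.
- by rewrite /I !mxintegral_id addr0 subr0.
- have h : mxprim s t N (fun u => G' u *m (R2h *m (V u - V s))).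
    apply: mxprim_mxintegral; apply: mxctsM => //; apply: mxctsM; first exact: mxcts_cst.
    exact: mxctsB_cst.
  by apply: mxprim_eq h => u _; rewrite ME mul_row_col mul0mx add0r mulmxA.
- exact: mxintegral_id.
- move=> u hu; rewrite (hpsi u hu) (hX u hu) (hJ u hu) ME mul_row_col /I -/(N u) mulNmx mulmxA.
  by apply/matrixP => a b; rewrite !mxE; ring.
Qed.

(** * Random vectors and almost sure properties *)

Lemma norm2_coord (R : realType) (n : nat) (v : 'cV[R]_n) i : `|v i 0| <= norm2 v.
Proof.
rewrite /norm2 -sqrtr_sqr ler_wsqrtr// (bigD1 i)//= lerDl sumr_ge0// => j _.
exact: sqr_ge0.
Qed.

Lemma norm2_ge0 (R : realType) (n : nat) (v : 'cV[R]_n) : 0 <= norm2 v.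
Proof. exact: sqrtr_ge0. Qed.

Lemma measurable_norm2 d (T : measurableType d) (R : realType) (n : nat) (Z : T -> 'cV[R]_n) :
  random_vector Z -> measurable_fun [set: T] (fun w => norm2 (Z w)).
Proof.
move=> mZ.
have ms : measurable_fun [set: T] (fun w => \sum_i Z w i 0 ^+ 2).
  by apply: measurable_sum => i; apply: measurable_funX; exact: mZ.
apply: (measurableT_comp _ ms).
exact: (continuous_measurable_fun (@sqrt_continuous R)).
Qed.

Lemma random_vectorB d (T : measurableType d) (R : realType) (n : nat) (Z1 Z2 : T -> 'cV[R]_n) :
  random_vector Z1 -> random_vector Z2 -> random_vector (fun w => Z1 w - Z2 w).
Proof.
move=> m1 m2 i; have := measurable_funB (m1 i) (m2 i).
by congr measurable_fun; apply/funext => w; rewrite /mxcoord !mxE.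
Qed.

Lemma random_vectorM d (T : measurableType d) (R : realType) (m n : nat) (M : 'M[R]_(m, n)) (Z : T -> 'cV[R]_n) :
  random_vector Z -> random_vector (fun w => M *m Z w).
Proof.
move=> mZ i.
have := @measurable_sum _ T R setT _ (index_enum 'I_n) (fun l w => M i l * Z w l 0).
rewrite (_ : (fun w => _) = mxcoord (fun w => M *m Z w) i); last first.
  by apply/funext => w; rewrite /mxcoord mxE.
by apply => l; apply: measurable_funM => //; exact: mZ.
Qed.

Lemma random_vector_sum d (T : measurableType d) (R : realType) (n : nat) (I : Type) (r : seq I)
    (Z : I -> T -> 'cV[R]_n) :
  (forall i, random_vector (Z i)) -> random_vector (fun w => \sum_(i <- r) Z i w).
Proof.
move=> mZ l.
have := @measurable_sum _ T R setT _ r (fun i w => Z i w l 0).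
rewrite (_ : (fun w => _) = mxcoord (fun w => \sum_(i <- r) Z i w) l); last first.
  by apply/funext => w; rewrite /mxcoord summxE.
by apply => i; exact: mZ.
Qed.

Lemma random_vector_riemann d (T : measurableType d) (R : realType) (m n : nat)
    (G : R -> 'M[R]_(m, n)) (Y : R -> T -> 'cV[R]_n) s t k : s <= t ->
  (forall u, s <= u <= t -> random_vector (Y u)) ->
  random_vector (fun w => riemann_sum G (fun u => Y u w) s t k).
Proof.
move=> st mY; apply: random_vector_sum => j; apply: random_vectorM.
apply: random_vectorB; apply: mY; first exact: (grid_itv st (ltn_ord j)).
exact: (grid_itv st (ltnW (ltn_ord j))).
Qed.

(** If [J w] differed from the pathwise limit, then for some [n] and [K] the
    point [w] would lie in [A n K k] for all [k], and such points form a null set.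
    The quantification over all [l] inside the almost sure event allows the
    pathwise limit to depend on [w] in a way that is not known to be measurable. *)
Lemma cvg_in_prob_unique (R : realType) d (T : measurableType d) (P : probability T R) (m : nat)
    (f : nat -> T -> 'cV[R]_m) (J : T -> 'cV[R]_m) :
  (forall k, random_vector (f k)) -> random_vector J ->
  (forall e : R, 0 < e ->
    (fun k => P [set w | e <= norm2 (f k w - J w)]) @ \oo --> 0%E) ->
  \forall w \ae P, forall l : 'cV[R]_m,
    (forall i, (fun k => f k w i 0) @ \oo --> l i 0) -> J w = l.
Proof.
move=> mf mJ hP.
pose A n K k := [set w | n.+1%:R^-1 <= norm2 (f (K + k)%N w - J w)].
have mA n K k : measurable (A n K k).
  have h := measurable_norm2 (random_vectorB (mf (K + k)%N) mJ).
  rewrite -[A _ _ _]setTI; exact: measurable_fun_le.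
have : \forall w \ae P, forall n K, ~ (forall k, A n K k w).
  apply: ae_foralln => n; apply: ae_foralln => K.
  exists (\bigcap_k A n K k); split; first exact: bigcap_measurable.
    apply/eqP; rewrite eq_le measure_ge0 andbT.
    have n0 : (0 : R) < n.+1%:R^-1 by rewrite invr_gt0.
    have h := hP _ n0; have h' : (fun k => P (A n K k)) @ \oo --> 0%E.
      rewrite /A; under eq_fun do rewrite addnC.
      by move: h; rewrite -(cvg_shiftn K).
    rewrite -(cvg_lim _ h')//; apply: lime_ge.
      by apply/cvg_ex; exists 0%E.
    apply: nearW => k; apply: le_measure; rewrite ?inE//; first exact: bigcap_measurable.
    by move=> w; apply.
  by move=> w /= /contrapT h k _; exact: h.
apply: filterS => w hw l hl; apply/matrixP => i j; rewrite (ord1 j).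
apply: contrapT => /eqP; rewrite eq_sym -subr_eq0 -normr_gt0 => e0.
have /cvgrPdist_lt/(_ _ (divr_gt0 e0 (ltr0n _ 2)))[K _ hK] := hl i.
have [n hn] : exists n : nat, n.+1%:R^-1 < `|l i 0 - J w i 0| / 2.
  have [n _ hn] := near_infty_natSinv_lt (PosNum (divr_gt0 e0 (ltr0n R 2))).
  by exists n; apply: hn => /=.
apply: (hw n K) => k; rewrite /A/=.
apply: le_trans (norm2_coord _ i); rewrite !mxE (le_trans (ltW hn))//.
have := hK (K + k)%N (leq_addr _ _).
have := ler_distD (f (K + k)%N w i 0) (l i 0) (J w i 0).
by set a := `|_ - _|; set b := `|_ - _|; set c := `|_ - _| => /=; lra.
Qed.

(** The rationals approach [u] from the left, so the value at the end [s] has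
    to be prescribed. *)
Lemma cts_rat_zero (R : realType) (s t : R) (f : R -> R) :
  cts s t f -> f s = 0 -> (forall q : rat, s <= ratr q <= t -> f (ratr q) = 0) ->
  forall u, s <= u <= t -> f u = 0.
Proof.
move=> cf fs fq u /andP[]; rewrite le_eqVlt => /predU1P[<-//|su ut].
apply/eqP; rewrite -normr_le0; apply/ler_addgt0Pl => e e0.
rewrite addr0; have [d d0 hd] := cts_uniform cf e0.
have mu : Num.max s (u - d) < u by rewrite gt_max su ltrBlDr ltrDl.
have [q] := rat_in_itvoo mu; rewrite in_itv/= gt_max => /andP[/andP[sq dq] qu].
have hq : s <= ratr q <= t by rewrite (ltW sq) (le_trans (ltW qu)).
rewrite -[f u]subr0 -(fq q hq); apply/ltW/hd => //; first by rewrite (ltW su).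
rewrite ger0_norm ?subr_ge0 ?(ltW qu)//; lra.
Qed.

Lemma ae_forall_rat (R : realType) d (T : measurableType d) (P : probability T R)
    (A : set rat) (Phi : rat -> T -> Prop) :
  (forall q, A q -> \forall w \ae P, Phi q w) -> \forall w \ae P, forall q, A q -> Phi q w.
Proof.
move=> h.
have : \forall w \ae P, forall n, if unpickle n is Some q then A q -> Phi q w else True.
  apply: ae_foralln => n; case: (unpickle n) => [q|]; last exact: aeW.
  have [Aq|nAq] := pselect (A q); last exact: aeW.
  by apply: filterS (h q Aq) => w.
by apply: filterS => w hw q Aq; have := hw (pickle q); rewrite pickleK; apply.
Qed.

Lemma within_mxcts (R : realType) (m n : nat) (s0 a b : R) (F : R -> 'M[R]_(m, n)) :
  s0 <= a -> {within `[s0, +oo[, continuous F} -> mxcts a b F.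
Proof.
move=> s0a hF i j.
have hF' : {within `[a, b], continuous F}.
  by apply: continuous_subspaceW hF => x /=; rewrite !in_itv/= => /andP[/(le_trans s0a)->].
move/subspace_continuousP : hF' => hc'.
apply/subspace_continuousP => x hx.
exact: (cvg_comp _ _ (hc' x hx) (@coord_continuous _ _ _ i j _)).
Qed.

Lemma mxintegral_chasles (R : realType) (n : nat) (a s u t : R) (f : R -> 'cV[R]_n) :
  a <= s -> s <= u -> u <= t -> mxcts a t f ->
  mxintegral a u f - mxintegral a s f = mxintegral s u f.
Proof.
move=> as_ su ut cf; apply/matrixP => i j; rewrite (ord1 j).
have h1 := mxprim_sub as_ ut (mxprim_mxintegral cf).
have h2 := mxprim_mxintegral (mxcts_sub as_ ut cf).
have := prim_incr_unique su (h1 i 0) (h2 i 0).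
by move=> h; rewrite [LHS]mxE [X in _ + X]mxE h mxintegral_id [X in _ - X]mxE subr0.
Qed.

Lemma sde_increment (R : realType) (r n : nat) (A : 'M[R]_r) (K : 'M[R]_(r, n))
    (X : R -> 'cV[R]_r) (N : R -> 'cV[R]_n) (a s t : R) z : a <= s -> mxcts a t X ->
  (forall u, a <= u -> X u = z + mxintegral a u (fun u => A *m X u) + K *m N u) ->
  forall u, s <= u <= t ->
  X u = X s + mxintegral s u (fun u => A *m X u) + K *m (N u - N s).
Proof.
move=> as_ cX hX u /andP[su ut].
have cAX : mxcts a t (fun u => A *m X u) by apply: mxctsM => //; exact: mxcts_cst.
rewrite -(mxintegral_chasles as_ su ut cAX) (hX u (le_trans as_ su)) (hX s as_) mulmxBr.
by apply/matrixP => i j; rewrite !mxE; ring.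
Qed.

(** The observation is the sum of a differentiable path, treated by
    [riemann_sum_drift], and of a Brownian path, treated by [riemann_sum_parts]. *)
Lemma observation_riemann (R : realType) (r1 r2 : nat) (s t : R)
    (C : 'M[R]_(r2, r1)) (R2h : 'M[R]_r2) (G G' : R -> 'M[R]_(r1, r2))
    (X : R -> 'cV[R]_r1) (V Y : R -> 'cV[R]_r2) i : 0 <= s -> s <= t ->
  mxprim s t G G' -> mxcts s t G' -> mxcts 0 t X -> mxcts 0 t V ->
  (forall u, 0 <= u -> Y u = mxintegral 0 u (fun u => C *m X u) + R2h *m V u) ->
  (fun k => riemann_sum G Y s t k i 0) @ \oo -->
    (mxintegral s t (fun u => G u *m (C *m X u)) + (G t *m (R2h *m (V t - V s))
       - mxintegral s t (fun u => G' u *m (R2h *m (V u - V s))))) i 0.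
Proof.
move=> s0 st hG cG' cX cV hY; have cG := mxprim_cts hG.
have cX' := mxcts_sub s0 (lexx t) cX; have cV' := mxcts_sub s0 (lexx t) cV.
have -> : (fun k => riemann_sum G Y s t k i 0) = (fun k =>
    riemann_sum G (fun u => mxintegral 0 u (fun u => C *m X u)) s t k i 0 +
    riemann_sum G (fun u => R2h *m (V u - V s)) s t k i 0).
  apply/funext => k; rewrite (_ : (fun u => R2h *m (V u - V s)) = (fun u => R2h *m V u - R2h *m V s)).
    rewrite riemann_sum_shift.
    rewrite (@riemann_sum_eq _ _ _ _ _ (fun u => mxintegral 0 u (fun u => C *m X u) + R2h *m V u))//.
      by rewrite riemann_sumD mxE.
    by move=> u /andP[su _]; apply: hY; exact: le_trans su.
  by apply/funext => u; rewrite mulmxBr.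
rewrite mxE; apply: cvgD.
  have cCX : mxcts 0 t (fun u => C *m X u) by apply: mxctsM => //; exact: mxcts_cst.
  have hI := mxprim_sub s0 (lexx t) (mxprim_mxintegral cCX).
  have cCX' := mxcts_sub s0 (lexx t) cCX.
  have := riemann_sum_drift (i := i) st cG hI cCX' (mxprim_mxintegral (mxctsM cG cCX')).
  by rewrite mxintegral_id subr0.
have cM : mxcts s t (fun u => R2h *m (V u - V s)).
  by apply: mxctsM; [exact: mxcts_cst|exact: mxctsB_cst].
have := riemann_sum_parts (i := i) st hG cG' cM (mxprim_mxintegral (mxctsM cG' cM)).
by rewrite mxintegral_id subrr !mulmx0 !subr0.
Qed.

(** * Almost sure representation of the signal and of the filter error *)

Section flow_ae.
Variables (R : realType) (d : measure_display) (T : measurableType d) (P : probability T R).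
Variables (r1 r2 : nat) (A R1h : 'M[R]_r1) (C : 'M[R]_(r2, r1)) (R2h : 'M[R]_r2).
Variables (W X : R -> T -> 'cV[R]_r1) (V Y : R -> T -> 'cV[R]_r2).
Hypothesis hB : is_brownian P (fun t w => col_mx (W t w) (V t w)).
Hypothesis hX : is_signal P A R1h W X.
Hypothesis hY : is_observation P C R2h V X Y.

Lemma brownian_paths_ae : \forall w \ae P, forall a b, 0 <= a ->
  mxcts a b (fun u => W u w) /\ mxcts a b (fun u => V u w).
Proof.
have [_ _ hc _ _] := hB; apply: filterS hc => w hw a b a0.
have h := within_mxcts (b := b) a0 hw; split => i j.
  by apply: cts_eq (h (lshift r2 i) j) => u _; rewrite col_mxEu.
by apply: cts_eq (h (rshift r1 i) j) => u _; rewrite col_mxEd.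
Qed.

Lemma signal_paths_ae : \forall w \ae P, (forall a b, 0 <= a -> mxcts a b (fun u => X u w)) /\
  forall s t, 0 <= s -> forall u, s <= u <= t ->
  X u w = X s w + mxintegral s u (fun u => A *m X u w) + R1h *m (W u w - W s w).
Proof.
have [_ h] := hX; apply: filterS h => w [hc he].
split=> [a b a0|s t s0 u hu]; first exact: within_mxcts hc.
apply: (@sde_increment _ _ _ A R1h (fun u => X u w) (fun u => W u w) 0 s t (X 0 w) s0 _ _ u hu) => //.
exact: (within_mxcts (lexx _) hc).
Qed.

Lemma signal_riemann_ae (L : R -> 'M[R]_r1) s t : 0 <= s -> s <= t ->
  L t = 1%:M -> mxprim s t L (fun u => - (L u *m A)) ->
  \forall w \ae P, forall i,
  (fun k => riemann_sum (fun u => L u *m R1h) (fun u => W u w) s t k i 0) @ \oo -->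
    (X t w - L s *m X s w) i 0.
Proof.
move=> s0 st Lt hL; apply: filterS2 brownian_paths_ae signal_paths_ae => w hw [cX eX] i.
have -> : (fun k => riemann_sum (fun u => L u *m R1h) (fun u => W u w) s t k i 0) =
    (fun k => riemann_sum (fun u => L u *m R1h) (fun u => W u w - W s w) s t k i 0).
  by apply/funext => k; rewrite riemann_sum_shift.
apply: (signal_riemann (Z := fun u => X u w)) => //.
- by apply: mxctsB_cst; have [] := hw s t s0.
- by rewrite subrr.
- exact: cX.
- exact: eX.
Qed.

(** Variation of constants from time [s] makes both sides limits of the same
    Riemann sums. The exceptional set of the flow is common to all starting
    points, which allows the random starting point [X s w]. *)
Lemma signal_flow_ae varphi s t : is_signal_flow P A R1h W varphi -> 0 <= s -> s <= t ->
  \forall w \ae P, X t w = varphi s t (X s w) w.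
Proof.
move=> hf s0 st; have [_ hv] := hf s s0.
have [L Lt hL] := transition_exists A t.
apply: filterS3 brownian_paths_ae hv (signal_riemann_ae s0 st Lt (hL s t)) => w hw hvw hr.
apply/matrixP => i j; rewrite (ord1 j).
have [hc he] := hvw (X s w).
have h : (fun k => riemann_sum (fun u => L u *m R1h) (fun u => W u w) s t k i 0) @ \oo -->
    (varphi s t (X s w) w - L s *m X s w) i 0.
  have -> : (fun k => riemann_sum (fun u => L u *m R1h) (fun u => W u w) s t k i 0) =
    (fun k => riemann_sum (fun u => L u *m R1h) (fun u => W u w - W s w) s t k i 0).
    by apply/funext => k; rewrite riemann_sum_shift.
  apply: (signal_riemann (Z := fun u => varphi s u (X s w) w)) => //.
  - by apply: mxctsB_cst; have [] := hw s t s0.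
  - by rewrite subrr.
  - exact: (within_mxcts (lexx _) hc).
  - by move=> u /andP[su _]; exact: he.
have e1 := cvg_lim (@norm_hausdorff _ _) (hr i).
have e2 := cvg_lim (@norm_hausdorff _ _) h.
have pf : ProperFilter (\oo : set_system nat) by exact: _.
by have := etrans (esym (e1 pf)) (e2 pf); rewrite !mxE => /addIr.
Qed.

(** The pathwise and the Ito integrals agree almost surely at each time,
    hence simultaneously at all rational times, and by continuity at all times.
    The error representation then applies to each path. *)
Lemma filter_error_ae (S : 'M[R]_r1) (P0 L : R -> 'M[R]_r1)
    (G G' : R -> 'M[R]_(r1, r2)) (psi J : R -> T -> 'cV[R]_r1) x s t :
  0 <= s -> s <= t ->
  mxcts s t P0 -> mxprim s t G G' -> mxcts s t G' -> (forall u, G u *m C = P0 u *m S) ->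
  L t = 1%:M -> mxprim s t L (fun u => - (L u *m (A - P0 u *m S))) ->
  (forall u, s <= u -> is_stoch_integral P G Y s u (J u)) ->
  (\forall w \ae P, solves_linear_sde (fun u => A - P0 u *m S) (fun u => J u w) s x
     (fun u => psi u w)) ->
  \forall w \ae P, forall i,
  (fun k => riemann_sum (fun u => L u *m row_mx (- R1h) (G u *m R2h))
     (fun u => col_mx (W u w) (V u w)) s t k i 0) @ \oo -->
    (psi t w - X t w - L s *m (x - X s w)) i 0.
Proof.
move=> s0 st cP hG cG' GC Lt hL hJ hpsi.
have [mY eY] := hY.
pose lim u w := mxintegral s u (fun v => G v *m (C *m X v w)) + (G u *m (R2h *m (V u w - V s w))
       - mxintegral s u (fun v => G' v *m (R2h *m (V v w - V s w)))).
have hlim u : s <= u -> u <= t -> \forall w \ae P, J u w = lim u w.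
  move=> su ut; have [mJ cJ] := hJ u su.
  have mf k : random_vector (fun w => riemann_sum G (fun v => Y v w) s u k).
    by apply: random_vector_riemann => // v /andP[sv _]; apply: mY; exact: le_trans sv.
  have h1 := cvg_in_prob_unique mf mJ cJ.
  have h2 : \forall w \ae P, forall i,
      (fun k => riemann_sum G (fun v => Y v w) s u k i 0) @ \oo --> lim u w i 0.
    apply: filterS3 brownian_paths_ae signal_paths_ae eY => w hw [cX _] hYw i.
    apply: observation_riemann => //.
    - exact: mxprim_sub hG.
    - exact: mxcts_sub cG'.
    - exact: cX.
    - by have [] := hw 0 u (lexx _).
  by apply: filterS2 h1 h2 => w h1 h2; exact: h1.
have hs := hlim s (lexx s) st.
have hq : \forall w \ae P, forall q : rat, s <= ratr q <= t -> J (ratr q) w = lim (ratr q) w.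
  apply: (@ae_forall_rat _ _ _ _ [set q | s <= ratr q <= t]) => q /andP[sq qt]; exact: hlim.
apply: filterS3 (filterI hs hq) hpsi (filterI brownian_paths_ae signal_paths_ae).
move=> w [hsw hqw] [cpsi epsi] [hw [cX eX]] i.
have [cW cV] := hw s t s0.
have cpsi' : mxcts s t (fun u => psi u w) by exact: (within_mxcts (lexx _) cpsi).
have cX' := cX s t s0.
have cG := mxprim_cts hG.
have cF : mxcts s t (fun u => A - P0 u *m S).
  by apply: mxctsD; [exact: mxcts_cst|apply/mxctsN/mxctsM => //; exact: mxcts_cst].
have cI1 : mxcts s t (fun u => mxintegral s u (fun v => (A - P0 v *m S) *m psi v w)).
  by apply: mxprim_cts; apply: mxprim_mxintegral; exact: mxctsM.
have cI2 : mxcts s t (fun u => mxintegral s u (fun v => G v *m (C *m X v w))).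
  apply: mxprim_cts; apply: mxprim_mxintegral; apply: mxctsM => //; apply: mxctsM => //.
  exact: mxcts_cst.
have cRV : mxcts s t (fun v => R2h *m (V v w - V s w)).
  by apply: mxctsM; [exact: mxcts_cst|exact: mxctsB_cst].
have cI3 : mxcts s t (fun u => mxintegral s u (fun v => G' v *m (R2h *m (V v w - V s w)))).
  by apply: mxprim_cts; apply: mxprim_mxintegral; exact: mxctsM.
have hJw u : s <= u <= t -> J u w = lim u w.
  move=> hu; apply/matrixP => a b; apply/eqP; rewrite -subr_eq0; apply/eqP.
  pose D u := psi u w - x - mxintegral s u (fun v => (A - P0 v *m S) *m psi v w) - lim u w.
  have cD : mxcts s t D.
    apply: mxctsD; first by apply: mxctsD; [exact: mxctsB_cst|exact: mxctsN].
    apply: mxctsN; apply: mxctsD => //; apply: mxctsD; last exact: mxctsN.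
    exact: mxctsM.
  have eJ v : s <= v -> J v w = psi v w - x - mxintegral s v (fun v => (A - P0 v *m S) *m psi v w).
    by move=> sv; rewrite (epsi v sv); apply/matrixP => ? ?; rewrite !mxE; ring.
  have DE v : s <= v -> D v = J v w - lim v w by move=> sv; rewrite eJ.
  rewrite (_ : _ - _ = D u a b); last by rewrite DE ?mxE//; case/andP: hu.
  apply: (cts_rat_zero (cD a b)) hu; first by rewrite DE// hsw subrr mxE.
  by move=> q hqst; rewrite DE ?hqw ?subrr ?mxE//; case/andP: hqst.
apply: (filter_error_riemann (G' := G') (J := fun u => J u w) st cP hG cG' GC Lt hL cW cV cX' cpsi').
- exact: eX.
- by move=> u /andP[su _]; exact: epsi.
- exact: hJw.
Qed.

End flow_ae.

(** * Gaussian exponential moments and independence *)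

(** Completing the square turns [expR (c * y)] times the density into a
    multiple of the normal density with mean [c * sigma ^+ 2]. *)
Lemma normal_mgf (R : realType) (c sigma : R) : sigma != 0 ->
  (\int[normal_prob 0 sigma]_y (expR (c * y))%:E = (expR (c ^+ 2 * sigma ^+ 2 / 2))%:E)%E.
Proof.
move=> s0.
have mexp : measurable_fun [set: measurableTypeR R] (fun y : measurableTypeR R => (expR (c * y))%:E).
  by apply/measurable_EFinP; apply: measurableT_comp => //; exact: measurable_funM.
have dom := normal_prob_dominates 0 sigma.
rewrite -(Radon_Nikodym_SigmaFinite.change_of_variables dom)//.
pose p x := (normal_pdf 0 sigma x)%:E.
have mp : measurable_fun [set: measurableTypeR R] p.
  by apply/measurable_EFinP; exact: measurable_normal_pdf.
have gp : ae_eq lebesgue_measure setT (Radon_Nikodym_SigmaFinite.f (normal_prob 0 sigma) lebesgue_measure) p.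
  apply: integral_ae_eq => //; first exact: Radon_Nikodym_SigmaFinite.f_integrable.
  by move=> E _ mE; rewrite -Radon_Nikodym_SigmaFinite.f_integral.
have mg : measurable_fun [set: measurableTypeR R] (Radon_Nikodym_SigmaFinite.f (normal_prob 0 sigma) lebesgue_measure).
  by apply: measurable_int; exact: Radon_Nikodym_SigmaFinite.f_integrable.
transitivity (\int[@lebesgue_measure R]_x ((expR (c * x))%:E * p x))%E.
  apply: ae_eq_integral => //.
  - exact: emeasurable_funM.
  - exact: emeasurable_funM.
  - by apply: filterS gp => x gx _; rewrite gx.
have -> : (fun x => (expR (c * x))%:E * p x)%E = (fun x : measurableTypeR R =>
    (expR (c ^+ 2 * sigma ^+ 2 / 2))%:E * (normal_pdf (c * sigma ^+ 2) sigma x)%:E)%E.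
  apply/funext => x; rewrite /p -!EFinM; congr EFin.
  rewrite !normal_pdfE// /normal_fun mulrCA [RHS]mulrCA; congr (_ * _).
  rewrite -!expRD; congr expR; rewrite -mulr_natr; field.
  by rewrite s0.
rewrite ge0_integralZl//.
- by rewrite integral_normal_pdf mule1.
- by apply/measurable_EFinP; exact: measurable_normal_pdf.
- by move=> x _; rewrite lee_fin normal_pdf_ge0.
Qed.

Section independence.
Context (R : realType) (d : measure_display) (T : measurableType d) (P : probability T R).

(** Two finite measures that agree on a pi-system: the trace of [P] on [E],
    and [P] scaled by [P E]. *)
Lemma indep_gen (G : set (set T)) (E : set T) : G `<=` measurable -> setI_closed G ->
  G setT -> measurable E -> (forall A, G A -> P (A `&` E) = (P A * P E)%E) ->
  forall A, <<s G >> A -> P (A `&` E) = (P A * P E)%E.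
Proof.
move=> Gm GI GT mE h A sA.
have PE0 : 0 <= fine (P E) by apply: fine_ge0; exact: measure_ge0.
pose k := NngNum PE0.
have kE : (k%:num%:E = P E)%E by rewrite /k/= fineK// fin_num_measure.
have : mrestr P mE A = mscale k P A.
  apply: (g_sigma_algebra_measure_unique G Gm (fun=> setT)) => //.
  - by rewrite bigcup_const//; exists 0%N.
  - by move=> B GB; apply: etrans (h B GB) _; rewrite -kE muleC.
  - by move=> _; rewrite /= /mrestr setTI (le_lt_trans (probability_le1 P mE))// ltry.
by rewrite /mrestr /mscale/= muleC => ->; congr (_ * _)%E; rewrite kE.
Qed.

(** The pair formed by the identity, valued in [T] with the coarser
    sigma-algebra generated by [G], and by [Y] has a product law; the formula is
    Tonelli's theorem for it. *)
Lemma indep_tonelli (G : set (set T)) (Y : T -> measurableTypeR R)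
    (muY : probability (measurableTypeR R) R)
    (f : T -> \bar R) (g : measurableTypeR R -> \bar R) :
  G `<=` measurable -> measurable_fun [set: T] Y ->
  (forall A D, <<s G >> A -> measurable D -> P (A `&` Y @^-1` D) = (P A * muY D)%E) ->
  measurable_fun [set: g_sigma_algebraType G] f -> (forall w, 0 <= f w)%E ->
  measurable_fun [set: measurableTypeR R] g -> (forall y, 0 <= g y)%E ->
  (\int[P]_w (f w * g (Y w)) = \int[P]_w f w * \int[muY]_y g y)%E.
Proof.
move=> Gm mY hind mf f0 mg g0.
pose TG : measurableType G.-sigma := g_sigma_algebraType G.
have mid : measurable_fun [set: T] (id : T -> TG).
  move=> _ B mB; rewrite setTI preimage_id.
  exact: (smallest_sub (@sigma_algebra_measurable _ T) Gm).
have mphi : measurable_fun [set: T] (fun w => (w : TG, Y w)).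
  exact: (measurable_fun_pair mid mY).
pose idm := isMeasurableFun.Build _ _ T TG id mid.
pose idf : {mfun T >-> TG} := HB.pack (id : T -> TG) idm.
pose m1 := distribution P idf.
pose phm := isMeasurableFun.Build _ _ T (TG * measurableTypeR R)%type (fun w => (w : TG, Y w)) mphi.
pose phf : {mfun T >-> (TG * measurableTypeR R)%type} := HB.pack (fun w => (w : TG, Y w)) phm.
pose m' := distribution P phf.
pose h (z : TG * measurableTypeR R) := (f z.1 * g z.2)%E.
have mh : measurable_fun [set: TG * measurableTypeR R] h.
  apply: emeasurable_funM.
    exact: (measurableT_comp (mf : measurable_fun [set: TG] f) measurable_fst).
  exact: (measurableT_comp mg measurable_snd).
have h0 z : (0 <= h z)%E by rewrite mule_ge0.
have e1 : (\int[P]_w (f w * g (Y w)) = \int[m']_z h z)%E.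
  by rewrite ge0_integral_distribution.
rewrite e1 (@eq_measure_integral _ _ _ _ (m1 \x muY)%E); last first.
  move=> X mX _; apply/esym; apply: (@product_measure_unique _ _ _ _ _ m1 muY m') => //.
rewrite (fubini_tonelli1 h)// /fubini_F/=.
transitivity (\int[m1]_x (f x * \int[muY]_y g y))%E.
  by apply: eq_integral => x _; rewrite /h/= ge0_integralZl.
rewrite ge0_integralZr//; last exact: integral_ge0.
by rewrite ge0_integral_distribution.
Qed.

End independence.

(** Jensen's inequality for the exponential and the mean of the [n * a i],
    from the tangent of the exponential at the mean. *)
Lemma expR_mean_le (R : realType) (n : nat) (a : 'I_n -> R) : (0 < n)%N ->
  expR (\sum_i a i) <= \sum_i n%:R^-1 * expR (n%:R * a i).
Proof.
move=> n0; set S := \sum_i a i.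
have nn : n%:R != 0 :> R by rewrite pnatr_eq0 -lt0n.
have h i : n%:R^-1 * (expR S * (1 + (n%:R * a i - S))) <= n%:R^-1 * expR (n%:R * a i).
  rewrite ler_wpM2l ?invr_ge0//.
  have -> : expR (n%:R * a i) = expR S * expR (n%:R * a i - S).
    by rewrite -expRD addrCA subrr addr0.
  by rewrite ler_wpM2l ?expR_ge0// expR_ge1Dx.
apply: le_trans (ler_sum _ (fun i _ => h i)).
rewrite -mulr_sumr -mulr_sumr big_split/= sumrB -mulr_sumr -/S !sumr_const card_ord.
by rewrite -[S *+ n]mulr_natl subrr addr0 mulrCA mulVf// mulr1.
Qed.

(** * The history of the noise *)

Section generated.
Context (R : realType) (d : measure_display) (T : measurableType d).

Lemma sigma_rv_sub (n : nat) (Z : T -> 'cV[R]_n) (S : set (set T)) :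
  sigma_algebra setT S ->
  (forall i (D : set (measurableTypeR R)), measurable D -> S (mxcoord Z i @^-1` D)) -> sigma_rv Z `<=` S.
Proof.
move=> sS h; apply: smallest_sub => //.
elim/big_ind : _ => [//|A B hA hB|i _]; first by rewrite subUset.
by move=> _ [D mD <-]; rewrite setTI; exact: h.
Qed.

Lemma sigma_rv_coord (n : nat) (Z : T -> 'cV[R]_n) i (D : set (measurableTypeR R)) :
  measurable D -> sigma_rv Z (mxcoord Z i @^-1` D).
Proof.
move=> mD; apply: sub_sigma_algebra; rewrite (bigD1 i)//=; left.
by exists D => //; rewrite setTI.
Qed.

Lemma sigma_process_sub (n : nat) (I : set R) (Z : R -> T -> 'cV[R]_n) (S : set (set T)) :
  sigma_algebra setT S -> (forall t, I t -> sigma_rv (Z t) `<=` S) ->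
  sigma_process I Z `<=` S.
Proof. by move=> sS h; apply: smallest_sub => // A [t It]; exact: h. Qed.

Lemma sigma_process_rv (n : nat) (I : set R) (Z : R -> T -> 'cV[R]_n) t :
  I t -> sigma_rv (Z t) `<=` sigma_process I Z.
Proof. by move=> It A hA; apply: sub_sigma_algebra; exists t. Qed.

Lemma measurable_fun_genT (G : set (set T)) d' (U : measurableType d') (f : T -> U) :
  G `<=` measurable ->
  measurable_fun [set: g_sigma_algebraType G] f -> measurable_fun [set: T] f.
Proof.
move=> Gm mf _ D mD; apply: (smallest_sub (@sigma_algebra_measurable _ T) Gm).
exact: mf.
Qed.

Lemma measurable_fun_genP (G : set (set T)) (f : T -> R) :
  (forall D : set (measurableTypeR R), measurable D -> <<s G >> (f @^-1` D)) ->
  measurable_fun [set: g_sigma_algebraType G] f.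
Proof. by move=> h _ D mD; rewrite setTI; exact: h. Qed.

End generated.

Section past.
Context (R : realType) (d : measure_display) (T : measurableType d) (P : probability T R).
Context (n r : nat) (X0 : T -> 'cV[R]_r) (B : R -> T -> 'cV[R]_n).
Hypothesis hB : is_brownian P B.
Hypothesis mX0 : random_vector X0.
Hypothesis hind : indep_sigma P (sigma_rv X0) (sigma_process `[0, +oo[ B).

(** Events of [X0], events of the noise up to time [u], and almost sure
    events; their intersections form a pi-system, on which independence from the
    later increments can be checked. The almost sure events are included in order
    that almost sure limits be measurable with respect to the history. *)
Definition past (u : R) : set (set T) :=
  [set A | exists D E N, [/\ sigma_rv X0 D, sigma_process `[0, u] B E,
     measurable N, P N = 1%E & A = D `&` E `&` N]].

Lemma sigma_X0_measurable : sigma_rv X0 `<=` measurable.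
Proof.
apply: sigma_rv_sub; first exact: sigma_algebra_measurable.
by move=> i D mD; rewrite -[X in measurable X]setTI; exact: mX0.
Qed.

Lemma sigma_B_measurable u : sigma_process `[0, u] B `<=` measurable.
Proof.
have [mB _ _ _ _] := hB.
apply: sigma_process_sub => [|t]; first exact: sigma_algebra_measurable.
rewrite /= in_itv/= => /andP[t0 _]; apply: sigma_rv_sub; first exact: sigma_algebra_measurable.
by move=> i D mD; rewrite -[X in measurable X]setTI; exact: mB.
Qed.

Lemma past_measurable u : past u `<=` measurable.
Proof.
move=> A [D [E [N [hD hE mN _ ->]]]]; apply: measurableI => //.
by apply: measurableI; [exact: sigma_X0_measurable|exact: sigma_B_measurable hE].
Qed.

Lemma full_setC (N : set T) : measurable N -> P N = 1%E -> P (~` N) = 0%E.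
Proof. by move=> mN N1; rewrite probability_setC// N1 subee. Qed.

Lemma full_setI (N M : set T) : measurable N -> measurable M -> P N = 1%E -> P M = 1%E ->
  P (N `&` M) = 1%E.
Proof.
move=> mN mM N1 M1.
have : P.-negligible (~` (N `&` M)).
  rewrite setCI; apply: negligibleU; apply/negligibleP; try exact: measurableC.
    exact: full_setC.
  exact: full_setC.
move/negligibleP => /(_ (measurableC (measurableI _ _ mN mM))) h.
by rewrite -[_ `&` _]setCK probability_setC ?h ?sube0//; apply: measurableC; exact: measurableI.
Qed.

Lemma prob_full_setI (N A : set T) : measurable N -> measurable A -> P N = 1%E ->
  P (A `&` N) = P A.
Proof.
move=> mN mA N1.
have hN := full_setC mN N1.
rewrite -[in RHS](setIT A) -(setUv N) setIUr measureU//; last 3 first.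
- exact: measurableI.
- by apply: measurableI => //; exact: measurableC.
- by rewrite setIACA setICr setI0.
rewrite -[LHS]adde0; congr (_ + _)%E; apply/esym/eqP.
rewrite eq_le measure_ge0 andbT -hN le_measure ?inE//.
- by apply: measurableI => //; exact: measurableC.
- exact: measurableC.
Qed.

Lemma past_setI u : setI_closed (past u).
Proof.
move=> A1 A2 [D1 [E1 [N1 [hD1 hE1 mN1 P1 ->]]]] [D2 [E2 [N2 [hD2 hE2 mN2 P2 ->]]]].
exists (D1 `&` D2), (E1 `&` E2), (N1 `&` N2); split.
- exact: (@measurableI _ (g_sigma_algebraType _)).
- exact: (@measurableI _ (g_sigma_algebraType _)).
- exact: measurableI.
- exact: full_setI.
- by rewrite setIACA [in RHS]setIACA.
Qed.

Lemma past_full u N : measurable N -> P N = 1%E -> past u N.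
Proof.
move=> mN N1; exists setT, setT, N; split => //; last by rewrite !setTI.
- exact: (@measurableT _ (g_sigma_algebraType _)).
- exact: (@measurableT _ (g_sigma_algebraType _)).
Qed.

Lemma past_setT u : past u setT.
Proof. by apply: past_full => //; rewrite probability_setT. Qed.

Lemma past_X0 u : sigma_rv X0 `<=` past u.
Proof.
move=> D hD; exists D, setT, setT; split => //; rewrite ?probability_setT ?setIT//.
exact: (@measurableT _ (g_sigma_algebraType _)).
Qed.

Lemma past_B u : sigma_process `[0, u] B `<=` past u.
Proof.
move=> E hE; exists setT, E, setT; split => //; rewrite ?probability_setT ?setIT ?setTI//.
exact: (@measurableT _ (g_sigma_algebraType _)).
Qed.

Lemma past_mono u v : u <= v -> <<s past u >> `<=` <<s past v >>.
Proof.
move=> uv; apply: smallest_sub; first exact: smallest_sigma_algebra.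
move=> A [D [E [N [hD hE mN P1 ->]]]]; apply: sub_sigma_algebra.
exists D, E, N; split => //; apply: sigma_process_sub hE.
  exact: smallest_sigma_algebra.
move=> t; rewrite /= in_itv/= => /andP[t0 tu]; apply: sigma_process_rv.
by rewrite /= in_itv/= t0 (le_trans tu).
Qed.

Lemma measurable_past_B u v i : 0 <= u -> u <= v ->
  measurable_fun [set: g_sigma_algebraType (past v)] (mxcoord (B u) i).
Proof.
move=> u0 uv; apply: measurable_fun_genP => D mD; apply: sub_sigma_algebra; apply: past_B.
apply: (@sigma_process_rv _ _ _ _ _ _ u); last exact: sigma_rv_coord.
by rewrite /= in_itv/= u0.
Qed.

Lemma measurable_past_X0 v i :
  measurable_fun [set: g_sigma_algebraType (past v)] (mxcoord X0 i).
Proof.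
apply: measurable_fun_genP => D mD; apply: sub_sigma_algebra; apply: past_X0.
exact: sigma_rv_coord.
Qed.

(** On the generating pi-system the three facts used are that an increment is
    independent of the earlier noise, that [X0] is independent of the whole noise,
    and that almost sure events do not change probabilities. *)
Lemma past_indep u v A E : 0 <= u -> u < v ->
  <<s past u >> A -> sigma_rv (fun w => B v w - B u w) E -> P (A `&` E) = (P A * P E)%E.
Proof.
move=> u0 uv hA hE; have [mB _ _ hinc _] := hB.
have v0 := le_lt_trans u0 uv.
have hEp : sigma_process `[0, +oo[ B E.
  apply: sigma_rv_sub hE; first exact: smallest_sigma_algebra.
  move=> i D mD.
  pose G := \bigcup_(t in `[0, +oo[) sigma_rv (B t).
  have m1 t : 0 <= t -> measurable_fun [set: g_sigma_algebraType G] (mxcoord (B t) i).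
    move=> t0; apply: measurable_fun_genP => D' mD'.
    apply: (@sigma_process_rv _ _ _ _ _ _ t); last exact: sigma_rv_coord.
    by rewrite /= in_itv/= t0.
  have m2 := measurable_funB (m1 _ (ltW v0)) (m1 _ u0).
  have := m2 measurableT D mD; rewrite setTI.
  by congr (sigma_process _ _ _); apply/seteqP; split => w /=; rewrite /mxcoord !mxE.
have mE : measurable E.
  apply: (sigma_rv_sub _ _ hE); first exact: sigma_algebra_measurable.
  move=> i D mD; rewrite -[X in measurable X]setTI.
  exact: (random_vectorB (mB _ (ltW v0)) (mB _ u0)).
apply: (@indep_gen _ _ _ P (past u)) hA => //.
- exact: past_measurable.
- exact: past_setI.
- exact: past_setT.
move=> _ [D [E' [N [hD hE' mN N1 ->]]]].
have mD := sigma_X0_measurable hD; have mE' := sigma_B_measurable hE'.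
have mDE' : measurable (D `&` E') by exact: measurableI.
have hE'p : sigma_process `[0, +oo[ B E'.
  apply: sigma_process_sub hE'; first exact: smallest_sigma_algebra.
  move=> t; rewrite /= in_itv/= => /andP[t0 tu]; apply: sigma_process_rv.
  by rewrite /= in_itv/= t0.
rewrite (prob_full_setI mN mDE' N1) setIAC (prob_full_setI mN _ N1); last exact: measurableI.
rewrite -setIA hind//; last exact: (@measurableI _ (g_sigma_algebraType _)).
have -> : P (D `&` E') = (P D * P E')%E by exact: hind.
rewrite -muleA; congr (_ * _)%E.
by rewrite setIC (hinc u v u0 uv)// muleC.
Qed.

Lemma increment_law u v i (D : set (measurableTypeR R)) : 0 <= u -> u < v -> measurable D ->
  P (mxcoord (fun w => B v w - B u w) i @^-1` D) = normal_prob 0 (Num.sqrt (v - u)) D.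
Proof.
move=> u0 uv mD; have [_ _ _ _ hlaw] := hB.
have := hlaw u v (fun j => if j == i then D else setT) u0 uv _.
rewrite (bigD1 i)//= eqxx big1 ?mule1; last first.
  by move=> j /negbTE ->; rewrite probability_setT.
move=> <-; last by move=> j; case: ifP.
congr (P _); apply/seteqP; split => w /=.
  by move=> h j; case: eqP => // ->.
by move=> /(_ i); rewrite eqxx.
Qed.

(** [expR_mean_le] bounds the exponential of the sum by a mean in which each
    term involves a single Gaussian coordinate with coefficient [n * h i], whence
    the factor [n ^+ 2] in the exponent. *)
Lemma increment_mgf (f : T -> \bar R) (h : 'I_n -> R) u v : 0 <= u -> u <= v ->
  measurable_fun [set: g_sigma_algebraType (past u)] f -> (forall w, 0 <= f w)%E ->
  (\int[P]_w (f w * (expR (\sum_i h i * (B v w - B u w) i 0))%:E) <=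
   \int[P]_w f w * (expR (n%:R ^+ 2 * (\sum_i h i ^+ 2) * (v - u) / 2))%:E)%E.
Proof.
move=> u0; rewrite le_eqVlt => /predU1P[<- _ f0|uv mf f0].
  rewrite subrr mulr0 mul0r expR0 mule1.
  rewrite le_eqVlt; apply/orP; left; apply/eqP; apply: eq_integral => w _.
  by rewrite big1 ?expR0 ?mule1// => i _; rewrite subrr mxE mulr0.
have mfT : measurable_fun [set: T] f by exact: measurable_fun_genT (@past_measurable u) mf.
case: (posnP n) => [n0|n0].
  rewrite le_eqVlt; apply/orP; left; apply/eqP.
  have no (i : 'I_n) : False by move: (ltn_ord i); rewrite {2}n0.
  rewrite big1; last by move=> i; case: (no i).
  rewrite mulr0 !mul0r expR0 mule1; apply: eq_integral => w _.
  by rewrite big1 ?expR0 ?mule1// => i; case: (no i).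
pose c i := n%:R * h i.
pose Y i := mxcoord (fun w => B v w - B u w) i : T -> measurableTypeR R.
have [mB _ _ _ _] := hB.
have mY i : measurable_fun [set: T] (Y i).
  by apply: random_vectorB; apply: mB => //; exact: ltW (le_lt_trans u0 uv).
pose g i (y : measurableTypeR R) := (expR (c i * y))%:E.
have mg i : measurable_fun [set: measurableTypeR R] (g i).
  by apply/measurable_EFinP; apply: measurableT_comp => //; exact: measurable_funM.
have mgY i : measurable_fun [set: T] (fun w => g i (Y i w)) by exact: measurableT_comp (mg i) (mY i).
have fg0 i w : (0 <= f w * g i (Y i w))%E by rewrite mule_ge0// lee_fin expR_ge0.
have mfg i : measurable_fun [set: T] (fun w => f w * g i (Y i w))%E by exact: emeasurable_funM.
apply: (@le_trans _ _ (\int[P]_w (\sum_i (n%:R^-1)%:E * (f w * g i (Y i w))))%E).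
  apply: ge0_le_integral => //.
  - by move=> w _; rewrite mule_ge0// lee_fin expR_ge0.
  - apply: emeasurable_funM => //; apply/measurable_EFinP.
    apply: measurableT_comp => //; apply: measurable_sum => i.
    by apply: measurable_funM => //; exact: (mY i).
  - by apply: emeasurable_sum => i; apply: emeasurable_funM => //; exact: measurable_cst.
  - move=> w _.
    rewrite (eq_bigr (fun i => f w * ((n%:R^-1)%:E * g i (Y i w)))%E); last first.
      by move=> i _; rewrite muleCA.
    rewrite -ge0_sume_distrr; last by move=> i _; rewrite mule_ge0// lee_fin ?invr_ge0// expR_ge0.
    apply: lee_wpmul2l => //.
    rewrite (eq_bigr (fun i => (n%:R^-1 * expR (c i * Y i w))%:E))// sumEFin lee_fin.
    apply: le_trans (expR_mean_le _ n0) _; apply: ler_sum => i _.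
    by rewrite /c mulrA.
rewrite ge0_integral_sum//; last 2 first.
- by move=> i; apply: emeasurable_funM => //; exact: measurable_cst.
- by move=> i w _; rewrite mule_ge0// lee_fin invr_ge0.
have s0 : 0 < v - u by rewrite subr_gt0.
have ss0 : Num.sqrt (v - u) != 0 by rewrite gt_eqF// sqrtr_gt0.
have hint i : (\int[P]_w ((n%:R^-1)%:E * (f w * g i (Y i w))) =
   (n%:R^-1)%:E * (\int[P]_w f w * (expR (c i ^+ 2 * (v - u) / 2))%:E))%E.
  rewrite ge0_integralZl//.
  congr (_ * _)%E.
  rewrite (@indep_tonelli _ _ _ P (past u) (Y i) (normal_prob 0 (Num.sqrt (v - u))) f (g i))//.
  - by rewrite normal_mgf// sqr_sqrtr// ltW.
  - exact: past_measurable.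
  - move=> A D hA mD.
    apply: etrans (past_indep u0 uv hA (sigma_rv_coord i mD)) _.
    exact: (congr1 (fun z => P A * z)%E (increment_law i u0 uv mD)).
  - by move=> y; rewrite lee_fin expR_ge0.
under eq_bigr do rewrite hint.
have I0 : (0 <= \int[P]_w f w)%E by exact: integral_ge0.
apply: (@le_trans _ _ (\sum_(i < n) (n%:R^-1)%:E * (\int[P]_w f w *
    (expR (n%:R ^+ 2 * (\sum_i h i ^+ 2) * (v - u) / 2))%:E))%E).
  apply: lee_sum => i _; apply: lee_wpmul2l; first by rewrite lee_fin invr_ge0.
  apply: lee_wpmul2l => //; rewrite lee_fin ler_expR ler_wpM2r// ler_wpM2r ?(ltW s0)//.
  rewrite /c exprMn ler_wpM2l ?exprn_ge0// (bigD1 i)//= lerDl sumr_ge0// => j _.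
  exact: sqr_ge0.
rewrite -ge0_sume_distrl; last by move=> i _; rewrite lee_fin invr_ge0.
by rewrite sumEFin sumr_const card_ord -[_ *+ n]mulr_natl mulfV ?mul1e// pnatr_eq0 -lt0n.
Qed.

End past.

(** * Exponential moments and tails of Wiener integrals *)

Lemma prob_bigU_le (R : realType) d (T : measurableType d) (P : probability T R) (I : finType)
    (F : I -> set T) : (forall i, measurable (F i)) ->
  (P (\bigcup_(i in setT) F i) <= \sum_i P (F i))%E.
Proof.
move=> mF; rewrite (_ : [set: I] = [set` enum I]); last first.
  by apply/seteqP; split => i //= _; rewrite mem_enum.
rewrite bigcup_seq -big_enum/=.
suff [] : measurable (\big[setU/set0]_(i <- enum I) F i) /\
   (P (\big[setU/set0]_(i <- enum I) F i) <= \sum_(i <- enum I) P (F i))%E by [].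
elim/big_ind2 : _ => [|A x B y [mA hA] [mB hB]|i _]; [by rewrite measure0| |by split].
split; first exact: measurableU.
by apply: le_trans (measureU2 _ _ _) (leeD hA hB).
Qed.

Section gaussian_tail.
Context (R : realType) (d : measure_display) (T : measurableType d) (P : probability T R).
Context (n r : nat) (X0 : T -> 'cV[R]_r) (B : R -> T -> 'cV[R]_n).
Hypothesis hB : is_brownian P B.
Hypothesis mX0 : random_vector X0.
Hypothesis hind : indep_sigma P (sigma_rv X0) (sigma_process `[0, +oo[ B).
Let past := past P X0 B.

(** Induction on the number of increments: the last one is integrated out,
    the others being measurable with respect to its past. *)
Lemma gaussian_sum_mgf (u : nat -> R) (h : nat -> 'I_n -> R) (A : set T) k :
  0 <= u 0 -> (forall j, u j <= u j.+1) -> <<s past (u 0)>> A ->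
  (\int[P]_w (\1_A w * expR (\sum_(j < k) \sum_l h j l * (B (u j.+1) w - B (u j) w) l 0))%:E <=
   P A * (expR (n%:R ^+ 2 / 2 * \sum_(j < k) (\sum_l h j l ^+ 2) * (u j.+1 - u j)))%:E)%E.
Proof.
move=> u0 uS hA.
have umono i j : (i <= j)%N -> u i <= u j.
  move=> /subnK <-; elim: (j - i)%N => [|m IH]//; exact: le_trans IH (uS _).
have uge j : 0 <= u j by exact: le_trans u0 (umono _ _ (leq0n j)).
have mA : measurable A.
  by apply: (smallest_sub (@sigma_algebra_measurable _ T) _ hA); exact: past_measurable.
elim: k => [|k IH].
  rewrite !big_ord0 mulr0 expR0 mule1.
  rewrite (eq_integral (fun w => (\1_A w)%:E)); last by move=> w _; rewrite big_ord0 expR0 mulr1.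
  by rewrite integral_indic// setIT.
pose f w := (\1_A w * expR (\sum_(j < k) \sum_l h j l * (B (u j.+1) w - B (u j) w) l 0))%:E.
have mf : measurable_fun [set: g_sigma_algebraType (past (u k))] f.
  apply/measurable_EFinP; apply: measurable_funM.
    apply: (@measurable_indic _ (g_sigma_algebraType (past (u k)))).
    exact: past_mono (umono _ _ (leq0n k)) _ hA.
  apply: measurableT_comp => //; apply: measurable_sum => j; apply: measurable_sum => l.
  apply: measurable_funM => //.
  have m1 := measurable_past_B (P:=P) (X0:=X0) (B:=B) l (uge j.+1) (umono _ _ (ltn_ord j)).
  have m2 := measurable_past_B (P:=P) (X0:=X0) (B:=B) l (uge j) (umono _ _ (ltnW (ltn_ord j))).
  have := measurable_funB m1 m2.
  by congr measurable_fun; apply/funext => w; rewrite /mxcoord !mxE.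
have f0 w : (0 <= f w)%E by rewrite lee_fin mulr_ge0// expR_ge0.
have := increment_mgf hB mX0 hind (h k) (uge k) (uS k) mf f0.
rewrite (eq_integral (fun w => (\1_A w * expR (\sum_(j < k.+1) \sum_l
    h j l * (B (u j.+1) w - B (u j) w) l 0))%:E)); last first.
  by move=> w _; rewrite big_ord_recr/= expRD mulrA EFinM.
move=> /le_trans; apply.
rewrite big_ord_recr/= (mulrDr (n%:R ^+ 2 / 2)) expRD EFinM muleA.
rewrite (_ : n%:R ^+ 2 / 2 * (_ * _) = n%:R ^+ 2 * (\sum_i h k i ^+ 2) * (u k.+1 - u k) / 2); last by ring.
by rewrite lee_wpmul2r// lee_fin expR_ge0.
Qed.

(** Fatou's lemma along the Riemann sums, whose variances converge to [q]. *)
Lemma riemann_limit_mgf (m : nat) (H : R -> 'M[R]_(m, n)) i (Z : T -> R) (q s t : R) (A : set T) :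
  0 <= s -> s <= t -> measurable_fun [set: T] Z ->
  (\forall w \ae P, (fun k => riemann_sum H (fun u => B u w) s t k i 0) @ \oo --> Z w) ->
  (fun k => \sum_(j < k) (\sum_l H (grid s t k j) i l ^+ 2) *
     (grid s t k j.+1 - grid s t k j)) @ \oo --> q ->
  <<s past s>> A ->
  (\int[P]_w (\1_A w * expR (Z w))%:E <= P A * (expR (n%:R ^+ 2 / 2 * q))%:E)%E.
Proof.
move=> s0 st mZ hZ hq hA.
have mA : measurable A.
  by apply: (smallest_sub (@sigma_algebra_measurable _ T) _ hA); exact: past_measurable.
have [mB _ _ _ _] := hB.
pose F k w := (\1_A w * expR (riemann_sum H (fun u => B u w) s t k i 0))%:E.
have mF k : measurable_fun [set: T] (F k).
  apply/measurable_EFinP; apply: measurable_funM; first exact: measurable_indic.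
  apply: measurableT_comp => //.
  apply: (@random_vector_riemann _ _ _ _ _ H B s t k st _ i) => u /andP[su _].
  by apply: mB; exact: le_trans su.
have F0 k w : (0 <= F k w)%E by rewrite lee_fin mulr_ge0// expR_ge0.
have mG : measurable_fun [set: T] (fun w => (\1_A w * expR (Z w))%:E).
  apply/measurable_EFinP; apply: measurable_funM; first exact: measurable_indic.
  exact: measurableT_comp.
have ae1 : ae_eq P setT (fun w => (\1_A w * expR (Z w))%:E) (fun w => limn_einf (F^~ w)).
  apply: filterS hZ => w hw _.
  have cF : (F^~ w) @ \oo --> (\1_A w * expR (Z w))%:E.
    apply: cvg_EFin; first by near=> k.
    apply: cvgM; first exact: cvg_cst.
    by apply: continuous_cvg => //; exact: continuous_expR.
  by apply/esym; apply: (cvg_limn_einf_sup cF).1.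
have mlim : measurable_fun [set: T] (fun w => limn_einf (F^~ w)).
  apply: measurableT_comp => //; apply: measurable_fun_limn_esup => k.
  exact: measurableT_comp.
rewrite (ae_eq_integral (fun w => limn_einf (F^~ w)) _ measurableT mG mlim ae1).
apply: le_trans (fatou _ _ _ _) _ => //.
pose g k := (P A * (expR (n%:R ^+ 2 / 2 * \sum_(j < k) (\sum_l H (grid s t k j) i l ^+ 2) *
     (grid s t k j.+1 - grid s t k j)))%:E)%E.
have cg : g @ \oo --> (P A * (expR (n%:R ^+ 2 / 2 * q))%:E)%E.
  apply: cvgeZl; first exact: fin_num_measure.
  apply: cvg_EFin; first by near=> k.
  apply: continuous_cvg; first exact: continuous_expR.
  exact: cvgMr hq.
rewrite -(cvg_lim _ cg)// limn_einf_lim; apply: lee_lim.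
- exact: is_cvg_einfs.
- by apply/cvg_ex; exists (P A * (expR (n%:R ^+ 2 / 2 * q))%:E)%E.
apply: nearW => k; apply: (@le_trans _ _ (\int[P]_w F k w)%E).
  by apply: ereal_inf_lbound; exists k => /=.
have -> : (\int[P]_w F k w = \int[P]_w (\1_A w * expR (\sum_(j < k) \sum_l
    H (grid s t k j) i l * (B (grid s t k j.+1) w - B (grid s t k j) w) l 0))%:E)%E.
  apply: eq_integral => w _; rewrite /F riemann_sumE exchange_big/=.
  do 3 congr (_ _); apply: eq_bigr => j _; apply: eq_bigr => l _; by rewrite !mxE.
apply: (@gaussian_sum_mgf (grid s t k) (fun j => H (grid s t k j) i)); rewrite ?grid0// => j.
exact: grid_le.
Unshelve. all: by end_near. Qed.

(** Chernoff's bound with parameter one, for [Z] and for [- Z]: the resulting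
    tail is exponential in [a], which suffices for a deviation that is allowed to
    grow linearly in [delta]. *)
Lemma riemann_limit_tail (m : nat) (H : R -> 'M[R]_(m, n)) i (Z : T -> R) (q a s t : R) (A : set T) :
  0 <= s -> s <= t -> measurable_fun [set: T] Z ->
  (\forall w \ae P, (fun k => riemann_sum H (fun u => B u w) s t k i 0) @ \oo --> Z w) ->
  (fun k => \sum_(j < k) (\sum_l H (grid s t k j) i l ^+ 2) *
     (grid s t k j.+1 - grid s t k j)) @ \oo --> q ->
  <<s past s>> A ->
  (P (A `&` [set w | (a <= `|Z w|)%R]) <= P A * (2 * expR (n%:R ^+ 2 / 2 * q - a))%R%:E)%E.
Proof.
move=> s0 st mZ hZ hq hA.
have mA : measurable A.
  by apply: (smallest_sub (@sigma_algebra_measurable _ T) _ hA); exact: past_measurable.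
have hp := riemann_limit_mgf s0 st mZ hZ hq hA.
have hm : (\int[P]_w (\1_A w * expR (- Z w))%:E <= P A * (expR (n%:R ^+ 2 / 2 * q))%:E)%E.
  apply: (@riemann_limit_mgf m (fun u => - H u) i _ q s t) => //.
  - exact: measurableT_comp.
  - apply: filterS hZ => w hw.
    rewrite (_ : (fun k => _) = (fun k => - riemann_sum H (fun u => B u w) s t k i 0)).
      exact: cvgN.
    apply/funext => k; rewrite !riemann_sumE -sumrN; apply: eq_bigr => l _.
    by rewrite -sumrN; apply: eq_bigr => j _; rewrite mxE mulNr.
  - apply: cvg_trans hq; apply: near_eq_cvg; apply: nearW => k; apply: eq_bigr => j _.
    by congr (_ * _); apply: eq_bigr => l _; rewrite mxE sqrrN.
have mexp (Y : T -> R) : measurable_fun [set: T] Y ->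
    measurable_fun [set: T] (fun w => (\1_A w * expR (Y w))%:E).
  move=> mY; apply/measurable_EFinP; apply: measurable_funM; first exact: measurable_indic.
  exact: measurableT_comp.
have mN : measurable_fun [set: T] (fun w => - Z w) by exact: measurableT_comp.
set E := _ `&` _.
have mE : measurable E.
  apply: measurableI => //.
  rewrite -[X in measurable X]setTI; apply: measurable_fun_le => //.
  exact: measurableT_comp.
have step : ((expR a)%:E * P E <= P A * (2 * expR (n%:R ^+ 2 / 2 * q))%:E)%E.
  have -> : ((expR a)%:E * P E = \int[P]_w (expR a * \1_E w)%:E)%E.
    under eq_integral do rewrite EFinM.
    rewrite ge0_integralZl ?lee_fin ?expR_ge0//; first by rewrite integral_indic// setIT.
    by apply/measurable_EFinP; exact: measurable_indic.
  apply: (@le_trans _ _ (\int[P]_w ((\1_A w * expR (Z w))%:E + (\1_A w * expR (- Z w))%:E))%E).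
    apply: ge0_le_integral => //.
    - by apply/measurable_EFinP; apply: measurable_funM => //; exact: measurable_indic.
    - by apply: emeasurable_funD; exact: mexp.
    - move=> w _; rewrite -EFinD lee_fin -mulrDr !indicE.
      case: (boolP (w \in E)) => [|_]; last by rewrite mulr0 mulr_ge0// addr_ge0// expR_ge0.
      rewrite inE => -[Aw /= aZ]; rewrite mulr1 mem_set// mul1r.
      apply: (@le_trans _ _ (expR `|Z w|)); first by rewrite ler_expR.
      by case: (ger0P (Z w)) => _; rewrite ?lerDl ?lerDr expR_ge0.
  rewrite ge0_integralD//; [|exact: mexp..].
  apply: le_trans (leeD hp hm) _.
  by rewrite -muleDr ?fin_num_measure// -EFinD mulr2n mulrDl mul1r.
have -> : (P E = (expR (- a))%:E * ((expR a)%:E * P E))%E.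
  by rewrite muleA -EFinM -expRD addNr expR0 mul1e.
apply: (le_trans (lee_wpmul2l _ step)); first by rewrite lee_fin expR_ge0.
by rewrite muleCA -EFinM expRD mulrCA (mulrC (expR (- a))) .
Qed.

Lemma riemann_limit_vector_tail (m : nat) (H : R -> 'M[R]_(m, n)) (Z : T -> 'cV[R]_m)
    (q : 'I_m -> R) (b a s t : R) (A : set T) :
  0 <= s -> s <= t -> random_vector Z ->
  (\forall w \ae P, forall i, (fun k => riemann_sum H (fun u => B u w) s t k i 0) @ \oo --> Z w i 0) ->
  (forall i, (fun k => \sum_(j < k) (\sum_l H (grid s t k j) i l ^+ 2) *
     (grid s t k j.+1 - grid s t k j)) @ \oo --> q i) ->
  (forall i, q i <= b) ->
  <<s past s>> A ->
  (P (A `&` [set w | exists i, (a <= `|Z w i 0|)%R]) <=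
     P A * (m%:R * (2 * expR (n%:R ^+ 2 / 2 * b - a)))%:E)%E.
Proof.
move=> s0 st mZ hZ hq hqb hA.
have mA : measurable A.
  by apply: (smallest_sub (@sigma_algebra_measurable _ T) _ hA); exact: past_measurable.
have mi i : measurable (A `&` [set w | a <= `|Z w i 0|]).
  apply: measurableI => //.
  rewrite -[X in measurable X]setTI; apply: measurable_fun_le => //.
  by apply: measurableT_comp => //; exact: mZ.
have -> : A `&` [set w | exists i, a <= `|Z w i 0|] =
    \bigcup_(i in [set: 'I_m]) (A `&` [set w | a <= `|Z w i 0|]).
  by apply/seteqP; split => w /=; [move=> [Aw [i hi]]; exists i | move=> [i _ [Aw hi]]; split => //; exists i].
apply: le_trans (prob_bigU_le P mi) _.
apply: (@le_trans _ _ (\sum_(i < m) P A * (2 * expR (n%:R ^+ 2 / 2 * b - a))%:E)%E).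
  apply: lee_sum => i _.
  apply: le_trans (riemann_limit_tail a s0 st (mZ i) _ (hq i) hA) _.
    by apply: filterS hZ => w; exact.
  by rewrite lee_wpmul2l// lee_fin ler_wpM2l// ler_expR lerD2r ler_wpM2l// divr_ge0// exprn_ge0.
rewrite -ge0_sume_distrr; last by move=> i _; rewrite lee_fin mulr_ge0// expR_ge0.
by rewrite sumEFin sumr_const card_ord -[_ *+ m]mulr_natl.
Qed.

End gaussian_tail.

(** * Conditional probabilities *)

Section conditional_probability.
Context (R : realType) (d : measure_display) (T : measurableType d) (P : probability T R).

(** The Radon-Nikodym derivative, on the sigma-algebra [G], of the trace of
    [P] on [E] with respect to [P]. *)
Lemma cond_prob_exists (G : set (set T)) (E : set T) :
  sigma_algebra setT G -> G `<=` measurable -> measurable E ->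
  exists p, is_cond_prob P G E p.
Proof.
move=> sG Gm mE.
pose TG : measurableType G.-sigma := g_sigma_algebraType G.
have mTG (A : set TG) : measurable A -> G A by rewrite measurable_g_measurableTypeE.
have GTG (A : set TG) : G A -> measurable A by rewrite measurable_g_measurableTypeE.
have mid : measurable_fun [set: T] (id : T -> TG).
  by move=> _ B mB; rewrite setTI preimage_id; apply: Gm; exact: mTG.
pose idm := isMeasurableFun.Build _ _ T TG id mid.
pose idf : {mfun T >-> TG} := HB.pack (id : T -> TG) idm.
pose mu := distribution P idf.
pose nu (A : set TG) := mrestr P mE A.
have nu0 : nu set0 = 0%E by exact: measure0.
have nu_ge0 A : (0 <= nu A)%E by exact: measure_ge0.
have nu_add : semi_sigma_additive nu.
  move=> F mF tF mUF; apply: (@measure_semi_sigma_additive _ _ _ (mrestr P mE)) => //.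
  - by move=> i; apply: Gm; exact: mTG.
  - by apply: Gm; exact: mTG.
pose nuM := isMeasure.Build _ TG R nu nu0 nu_ge0 nu_add.
pose nu1 : {measure set TG -> \bar R} := HB.pack nu nuM.
have nu_fin : fin_num_fun nu1.
  move=> A mA; apply: (@fin_num_measure _ _ _ P (A `&` E)); apply: measurableI => //.
  by apply: Gm; exact: mTG.
pose nuF := Measure_isFinite.Build _ TG R nu1 nu_fin.
pose nu2 : {finite_measure set TG -> \bar R} := HB.pack nu nuM nuF.
have dom : nu2 `<< mu.
  apply/null_content_dominatesP => A mA A0.
  have mA' : measurable (A : set T) by apply: Gm; exact: mTG.
  apply/eqP; rewrite eq_le nu_ge0 andbT -A0.
  by apply: (@le_measure _ _ _ P); rewrite ?inE//; exact: measurableI.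
pose f := Radon_Nikodym_SigmaFinite.f nu2 mu.
have f0 := Radon_Nikodym_SigmaFinite.f_ge0 dom.
have ffin := Radon_Nikodym_SigmaFinite.f_fin_num dom.
have fint := Radon_Nikodym_SigmaFinite.f_integrable dom.
have mf : measurable_fun [set: TG] f := measurable_int _ fint.
have mfT : measurable_fun [set: T] (f : T -> \bar R) by exact: measurableT_comp mf mid.
have fE : EFin \o (fine \o f) = f by apply/funext => w; rewrite /= fineK// ffin.
have hf A : G A -> (\int[P]_(w in A) f w = P (E `&` A))%E.
  move=> GA; have mA := GTG _ GA.
  have -> : (P (E `&` A) = nu2 A)%E by rewrite /nu2/= /nu /mrestr setIC.
  rewrite (Radon_Nikodym_SigmaFinite.f_integral dom mA) -/f.
  rewrite /mu /distribution ge0_integral_pushforward//.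
  exact: measurable_funTS.
exists (fine \o f); split.
- move=> B mB; apply: mTG.
  have := measurableT_comp (fine_measurable measurableT : measurable_fun _ (fine : \bar R -> R)) mf.
  by move/(_ measurableT B mB); rewrite setTI.
- rewrite fE; apply/integrableP; split => //.
  under eq_integral do rewrite gee0_abs//.
  rewrite hf ?setIT ?fin_num_fun_lty//; last first.
    by apply: mTG; exact: measurableT.
  by rewrite ltey_eq fin_num_measure.
- move=> A GA; rewrite -(hf A GA); apply: eq_integral => w _.
  by rewrite /= fineK// ffin.
Qed.

(** On the event [p < 1 - eps], which belongs to [G], the integral of the
    positive function [1 - eps - p] is nonpositive by the assumption on [G]. *)
Lemma cond_prob_ge (G : set (set T)) (E : set T) (p : T -> R) (eps : R) :
  G `<=` measurable -> measurable E -> is_cond_prob P G E p ->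
  (forall A, G A -> (P (A `\` E) <= P A * eps%:E)%E) ->
  \forall w \ae P, 1 - eps <= p w.
Proof.
move=> Gm mE [mp ip hp] hA.
set A := p @^-1` `]-oo, (1 - eps)[%classic.
have GA : G A by exact: mp.
have mA := Gm _ GA.
have [a Pa] : exists a, P A = a%:E.
  by exists (fine (P A)); rewrite fineK// fin_num_measure.
have mEA : measurable (E `&` A) by exact: measurableI.
have [b Pb] : exists b, P (E `&` A) = b%:E.
  by exists (fine (P (E `&` A))); rewrite fineK// fin_num_measure.
have [c Pc] : exists c, P (A `\` E) = c%:E.
  by exists (fine (P (A `\` E))); rewrite fineK// fin_num_measure//; exact: measurableD.
have acb : a = c + b.
  apply: EFin_inj; rewrite EFinD -Pa -Pb -Pc setIC; exact: measureDI.
have ce : c <= a * eps by have := hA _ GA; rewrite Pa Pc -EFinM lee_fin.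
pose g w := 1 - eps - p w.
have ipA : P.-integrable A (EFin \o p) by exact: integrableS ip.
have icA : P.-integrable A (cst (1 - eps)%:E) by exact: finite_measure_integrable_cst.
have ig : P.-integrable A (EFin \o g).
  exact: integrableB icA ipA.
have gA w : A w -> 0 < g w by rewrite /A /= in_itv/= subr_gt0.
have : (\int[P]_(w in A) `|(EFin \o g) w| = 0)%E.
  apply/eqP; rewrite eq_le integral_ge0 ?andbT//.
  rewrite (eq_integral (EFin \o g)); last first.
    by move=> w; rewrite inE => /gA g0; rewrite /= gtr0_norm.
  apply: (@le_trans _ _ ((1 - eps) * a - b)%:E); last by rewrite lee_fin; lra.
  have ecst : (\int[P]_(x in A) cst (1 - eps)%:E x = ((1 - eps) * a)%:E)%E.
    exact: etrans (integral_cst P mA _) (congr1 (fun z => (1 - eps)%:E * z)%E Pa).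
  have ep : (\int[P]_(x in A) (EFin \o p) x = b%:E)%E by exact: etrans (hp A GA) Pb.
  have := integralB mA icA ipA; rewrite ecst ep => eB.
  by rewrite EFinB -eB.
move/ae_eq_integral_abs => /(_ mA (measurable_int _ ig)).
apply: filterS => w h; rewrite leNgt; apply/negP => pw.
have Aw : A w by rewrite /A /= in_itv.
have [g0] := h Aw.
by have := gA _ Aw; rewrite g0 ltxx.
Qed.

End conditional_probability.

(** * Almost sure limits and the history *)

Section past_limits.
Context (R : realType) (d : measure_display) (T : measurableType d) (P : probability T R).
Context (n r : nat) (X0 : T -> 'cV[R]_r) (B : R -> T -> 'cV[R]_n).

(** The limit holds everywhere on an almost sure event, which belongs to
    the history; the part of a preimage outside it is null, hence in the history
    as the complement of an almost sure event. *)
Lemma measurable_past_ae_limit u (f : nat -> T -> R) (g : T -> R) :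
  (forall k, measurable_fun [set: g_sigma_algebraType (past P X0 B u)] (f k)) ->
  measurable_fun [set: T] g ->
  (\forall w \ae P, f k w @[k --> \oo] --> g w) ->
  measurable_fun [set: g_sigma_algebraType (past P X0 B u)] g.
Proof.
move=> mf mg [N [mN N0 hN]].
have N1 : P (~` N) = 1%E by rewrite probability_setC// N0 sube0.
have gN : <<s past P X0 B u>> (~` N).
  by apply: sub_sigma_algebra; apply: past_full => //; exact: measurableC.
have m1 : measurable_fun [set: g_sigma_algebraType (past P X0 B u)]
    (fun w => \1_(~` N) w * g w).
  apply: (@measurable_fun_cvg _ (g_sigma_algebraType (past P X0 B u)) _ _
    (fun k w => \1_(~` N) w * f k w)).
  - by move=> k; apply: measurable_funM.
  - move=> w _; rewrite indicE; case: (boolP (w \in ~` N)) => [|_].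
      rewrite inE => wN; apply: cvgMr.
      by apply: contrapT => h; apply: wN; exact: hN.
    by under eq_fun do rewrite mul0r; rewrite mul0r; exact: cvg_cst.
apply: measurable_fun_genP => D mD.
have -> : g @^-1` D = ((fun w => \1_(~` N) w * g w) @^-1` D `&` ~` N) `|`
    ~` (~` (g @^-1` D `&` N)).
  rewrite setCK; apply/seteqP; split => w /=; rewrite indicE.
    move=> gD; case: (pselect (N w)) => Nw; [by right|left].
    by rewrite mem_set// mul1r.
  by move=> [[+ Nw]|[]//]; rewrite mem_set// mul1r.
have mgD : measurable (g @^-1` D) by rewrite -[X in measurable X]setTI; exact: mg.
apply: (@measurableU _ (g_sigma_algebraType (past P X0 B u))).
  apply: (@measurableI _ (g_sigma_algebraType (past P X0 B u))) => //.
  by have := m1 measurableT D mD; rewrite setTI.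
apply: (@measurableC _ (g_sigma_algebraType (past P X0 B u))).
apply: sub_sigma_algebra; apply: past_full.
  by apply: measurableC; exact: measurableI.
have h0 : P (g @^-1` D `&` N) = 0%E.
  apply/eqP; rewrite eq_le measure_ge0 andbT -N0.
  by apply: le_measure; rewrite ?inE//; exact: measurableI.
by rewrite probability_setC ?h0 ?sube0//; exact: measurableI.
Qed.

End past_limits.

(** * Deviation of the filter error *)

Lemma norm2D (R : realType) (n : nat) (u v : 'cV[R]_n) : norm2 (u + v) <= norm2 u + norm2 v.
Proof.
rewrite -(@ler_pXn2r _ 2)// ?nnegrE ?addr_ge0 ?norm2_ge0//.
rewrite sqrrD !sq_norm2 bfDl !bfDr (bf_sym v u) ?trmx1//.
have := spd_cauchy_schwarz u v (spd1 R n).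
rewrite -!sq_norm2 -exprMn -[X in X <= _ -> _]real_normK ?num_real// => h.
have : `|bf 1%:M u v| <= norm2 u * norm2 v.
  by rewrite -(@ler_pXn2r _ 2)// ?nnegrE ?mulr_ge0 ?norm2_ge0.
move=> /(le_trans (ler_norm _)); rewrite -mulr_natr; lra.
Qed.

Lemma norm2_le_coord (R : realType) (n : nat) (v : 'cV[R]_n) (a : R) : 0 <= a ->
  (forall i, `|v i 0| <= a) -> norm2 v <= n%:R * a.
Proof.
move=> a0 h; rewrite /norm2 -[leRHS]ger0_norm ?mulr_ge0// -sqrtr_sqr ler_wsqrtr//.
apply: (@le_trans _ _ (\sum_(i < n) a ^+ 2)).
  by apply: ler_sum => i _; rewrite -[leLHS]real_normK ?num_real// ler_pXn2r ?nnegrE.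
rewrite sumr_const card_ord -[_ *+ n]mulr_natl exprMn ler_wpM2r ?sqr_ge0// -natrX ler_nat.
by case: n {v h} => // n; rewrite leq_pmulr.
Qed.

(** The gain is [P *m C^T *m invmx R2], so the observation noise contributes
    [P C^T R2^-1 R2 R2^-1 C P = P S P]. *)
Lemma noise_covariance (R : realType) (r1 r2 : nat) (R1 R1h P S L : 'M[R]_r1)
    (R2 R2h : 'M[R]_r2) (C : 'M[R]_(r2, r1)) :
  is_sym_sqrtmx R1 R1h -> is_sym_sqrtmx R2 R2h -> spdmx R2 -> P^T = P ->
  S = C^T *m invmx R2 *m C ->
  let H := L *m row_mx (- R1h) (P *m C^T *m invmx R2 *m R2h) in
  H *m H^T = L *m (R1 + P *m S *m P) *m L^T.
Proof.
move=> [s1 e1] [s2 e2] hR2 hP hS H.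
have uR2 := spd_unit hR2; have sI : (invmx R2)^T = invmx R2 by rewrite trmx_inv hR2.1.
rewrite /H trmx_mul !mulmxA; congr (_ *m _); rewrite -!mulmxA; congr (_ *m _).
rewrite tr_row_mx mul_row_col trmx_opp mulNmx mulmxN opprK s1 e1; congr (_ + _).
rewrite !trmx_mul s2 sI hP trmxK !mulmxA -(mulmxA _ R2h R2h) e2.
by rewrite -(mulmxA _ (invmx R2) R2) mulVmx// mulmx1 hS !mulmxA.
Qed.

Lemma row_norm_mulmxT (R : realType) (m n : nat) (H : 'M[R]_(m, n)) i :
  \sum_l H i l ^+ 2 = (H *m H^T) i i.
Proof. by rewrite mxE; apply: eq_bigr => l _; rewrite mxE expr2. Qed.

(** The limit is the integral of the squared coefficients of the noise, for
    which [transported_cov] provides the primitive [K]. *)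
Lemma quadratic_variation (R : realType) (r1 r2 : nat) (A R1 R1h S : 'M[R]_r1)
    (R2 R2h : 'M[R]_r2) (C : 'M[R]_(r2, r1)) (P L : R -> 'M[R]_r1) s t i :
  is_sym_sqrtmx R1 R1h -> is_sym_sqrtmx R2 R2h -> spdmx R2 ->
  S = C^T *m invmx R2 *m C -> s <= t ->
  (forall u, s <= u <= t -> (P u)^T = P u) ->
  mxprim s t P (fun u => ric A S R1 (P u)) ->
  mxprim s t L (fun u => - (L u *m (A - P u *m S))) ->
  let H u := L u *m row_mx (- R1h) (P u *m C^T *m invmx R2 *m R2h) in
  let K u := L u *m P u *m (L u)^T in
  (fun k => \sum_(j < k) (\sum_l H (grid s t k j) i l ^+ 2) *
     (grid s t k j.+1 - grid s t k j)) @ \oo --> (K t - K s) i i.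
Proof.
move=> h1 h2 hR2 hS st hP hPr hL H K.
have sI : (invmx R2)^T = invmx R2 by rewrite trmx_inv hR2.1.
have sS : S^T = S by rewrite hS !trmx_mul trmxK sI mulmxA.
have hK := transported_cov sS hP hPr hL.
pose M u := L u *m (R1 + P u *m S *m P u) *m (L u)^T.
have cP := mxprim_cts hPr; have cL := mxprim_cts hL.
have cM : cts s t (fun u => M u i i).
  apply: mxctsM; last exact: mxctsT.
  apply: mxctsM => //; apply: mxctsD; first exact: mxcts_cst.
  by apply: mxctsM => //; apply: mxctsM => //; exact: mxcts_cst.
have -> : (K t - K s) i i = K t i i - K s i i by rewrite !mxE.
have hKi : prim s t (fun u => K u i i) (fun u => 1 * M u i i).
  by apply: prim_eq (hK i i) => u _; rewrite mul1r.
have := riemann_stieltjes_cvg (xi := fun k j => grid s t k j) st cM (prim_id s t) (@cts_cst _ s t 1) hKi.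
have hx k j : (j < k)%N -> grid s t k j <= grid s t k j <= grid s t k j.+1.
  by move=> _; rewrite lexx grid_le.
move=> /(_ hx); apply: cvg_trans; apply: near_eq_cvg; apply: nearW => k.
apply: eq_bigr => j _; congr (_ * _).
rewrite row_norm_mulmxT (noise_covariance _ h1 h2 hR2 _ hS)//.
exact: hP (grid_itv st (ltnW (ltn_ord j))).
Qed.

Lemma qf_delta (R : realType) (n : nat) (M : 'M[R]_n) i : qf M (delta_mx i 0) = M i i.
Proof.
by rewrite /bf trmx_delta -rowE -colE !mxE.
Qed.

Lemma le_probability_ae (R : realType) d (T : measurableType d) (P : probability T R) (A B : set T) :
  measurable A -> measurable B -> (\forall w \ae P, A w -> B w) -> (P A <= P B)%E.
Proof.
move=> mA mB [N [mN N0 hN]].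
apply: (@le_trans _ _ (P (B `|` N))).
  apply: le_measure; rewrite ?inE//; first exact: measurableU.
  move=> w Aw; case: (pselect (B w)) => Bw; [by left|right].
  by apply: hN => /(_ Aw).
by apply: le_trans (measureU2 _ mB mN) _; rewrite [X in (_ + X)%E]N0 adde0.
Qed.

Lemma measurable_flow_value (R : realType) d (T : measurableType d) (r : nat)
    (f : 'cV[R]_r -> T -> R) (X : T -> 'cV[R]_r) :
  measurable_fun [set: (r.-tuple R * T)%type]
    (fun p : r.-tuple R * T => f (\col_j tnth p.1 j) p.2) ->
  random_vector X -> measurable_fun [set: T] (fun w => f (X w) w).
Proof.
move=> mf mX.
pose g w : r.-tuple R * T := ([tuple X w j 0 | j < r], w).
have mg : measurable_fun [set: T] g.
  apply: measurable_fun_pair => //; apply/measurable_fun_tnthP => j.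
  by have := mX j; congr measurable_fun; apply/funext => w; rewrite /= tnth_mktuple.
have := measurableT_comp mf mg; congr measurable_fun; apply/funext => w.
by rewrite /=; congr (f _ _); apply/matrixP => a b; rewrite mxE tnth_mktuple (ord1 b).
Qed.

Section deviation.
Context (R : realType) (d : measure_display) (T : measurableType d) (P : probability T R).
Context (r1 r2 : nat) (A R1 R1h S : 'M[R]_r1) (C : 'M[R]_(r2, r1)) (R2 R2h : 'M[R]_r2).
Context (W X : R -> T -> 'cV[R]_r1) (V Y : R -> T -> 'cV[R]_r2).
Hypothesis R1h_sqrt : is_sym_sqrtmx R1 R1h.
Hypothesis R2h_sqrt : is_sym_sqrtmx R2 R2h.
Hypothesis R2_spd : spdmx R2.
Hypothesis S_def : S = C^T *m invmx R2 *m C.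
Hypothesis hB : is_brownian P (fun t w => col_mx (W t w) (V t w)).
Hypothesis hind : indep_sigma P (sigma_rv (X 0))
  (sigma_process `[0, +oo[ (fun t w => col_mx (W t w) (V t w))).
Hypothesis hX : is_signal P A R1h W X.
Hypothesis hY : is_observation P C R2h V X Y.
Let B t w := col_mx (W t w) (V t w).

(** [X s] is almost surely the limit of Riemann sums of the noise up to time
    [s], up to a linear function of [X 0]. *)
Lemma sigma_signal_past s : 0 <= s -> sigma_rv (X s) `<=` <<s past P (X 0) B s>>.
Proof.
move=> s0; have [mX _] := hX.
apply: sigma_rv_sub => [|i D mD]; first exact: smallest_sigma_algebra.
have [L Ls hL] := transition_exists A s.
have hlim := signal_riemann_ae hB hX (lexx 0) s0 Ls (hL 0 s).
suff m : measurable_fun [set: g_sigma_algebraType (past P (X 0) B s)] (mxcoord (X s) i).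
  by have := m measurableT D mD; rewrite setTI.
apply: (measurable_past_ae_limit (f := fun k w =>
    riemann_sum (fun u => L u *m R1h) (fun u => W u w) 0 s k i 0 + (L 0 *m X 0 w) i 0)).
- move=> k; apply: measurable_funD.
    have -> : (fun w => riemann_sum (fun u => L u *m R1h) (fun u => W u w) 0 s k i 0) =
      (fun w => \sum_l \sum_(j < k) (L (grid 0 s k j) *m R1h) i l *
        (mxcoord (B (grid 0 s k j.+1)) (lshift r2 l) w - mxcoord (B (grid 0 s k j)) (lshift r2 l) w)).
      apply/funext => w; rewrite riemann_sumE; apply: eq_bigr => l _; apply: eq_bigr => j _.
      by rewrite /mxcoord /B !col_mxEu.
    apply: measurable_sum => l; apply: measurable_sum => j; apply: measurable_funM => //.
    have /andP[g0 gs] := grid_itv s0 (ltn_ord j).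
    have /andP[g0' gs'] := grid_itv s0 (ltnW (ltn_ord j)).
    by apply: measurable_funB; exact: measurable_past_B.
  have -> : (fun w => (L 0 *m X 0 w) i 0) = (fun w => \sum_l L 0 i l * mxcoord (X 0) l w).
    by apply/funext => w; rewrite mxE.
  apply: measurable_sum => l; apply: measurable_funM => //; exact: measurable_past_X0.
- exact: mX.
- apply: filterS hlim => w /(_ i) h.
  have -> : mxcoord (X s) i w = (X s w - L 0 *m X 0 w) i 0 + (L 0 *m X 0 w) i 0.
    by rewrite /mxcoord !mxE subrK.
  by apply: cvgD => //; exact: cvg_cst.
Qed.

(** The variance of the i-th coordinate is [(P0 t) i i] minus a nonnegative
    quantity, hence at most [b]. *)
Lemma filter_deviation (P0 L : R -> 'M[R]_r1) (psi J : R -> T -> 'cV[R]_r1)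
    x s t (b a : R) (F : set T) :
  0 <= s -> s <= t ->
  mxprim s t P0 (fun u => ric A S R1 (P0 u)) ->
  spdmx (P0 s) -> (forall u, s <= u <= t -> (P0 u)^T = P0 u) ->
  (forall v, qf (P0 t) v <= b * qf 1%:M v) ->
  L t = 1%:M -> mxprim s t L (fun u => - (L u *m (A - P0 u *m S))) ->
  (forall u, s <= u -> random_vector (psi u)) ->
  (forall u, s <= u -> is_stoch_integral P (fun v => P0 v *m C^T *m invmx R2) Y s u (J u)) ->
  (\forall w \ae P, solves_linear_sde (fun u => A - P0 u *m S) (fun u => J u w) s x
     (fun u => psi u w)) ->
  sigma_rv (X s) F ->
  (P (F `&` [set w | exists i, (a <= `|(psi t w - X t w - L s *m (x - X s w)) i 0|)%R]) <=
   P F * (r1%:R * (2 * expR ((r1 + r2)%:R ^+ 2 / 2 * b - a)))%:E)%E.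
Proof.
move=> s0 st hP Ps Psym Pb Lt hL mpsi hJ hpsi hF.
have [mX _] := hX.
pose G u := P0 u *m C^T *m invmx R2.
pose G' u := ric A S R1 (P0 u) *m C^T *m invmx R2.
have cP := mxprim_cts hP.
have hG : mxprim s t G G' by apply: mxprimMr; exact: mxprimMr.
have cric : mxcts s t (fun u => ric A S R1 (P0 u)).
  apply: mxctsD; last exact: mxcts_cst.
  apply: mxctsD; last by apply/mxctsN/mxctsM => //; apply: mxctsM => //; exact: mxcts_cst.
  by apply: mxctsD; apply: mxctsM => //; exact: mxcts_cst.
have cG' : mxcts s t G'.
  apply: mxctsM; last exact: mxcts_cst.
  by apply: mxctsM => //; exact: mxcts_cst.
have GC u : G u *m C = P0 u *m S by rewrite S_def /G !mulmxA.
have hlim := filter_error_ae hB hX hY s0 st cP hG cG' GC Lt hL hJ hpsi.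
have mX0 : random_vector (X 0) by exact: mX.
have hqv i := quadratic_variation (i := i) R1h_sqrt R2h_sqrt R2_spd S_def st Psym hP hL.
have hu := riemann_limit_vector_tail hB mX0 hind a s0 st _ hlim hqv.
apply: hu.
- apply: random_vectorB; first by apply: random_vectorB; [exact: mpsi|exact: mX (le_trans s0 st)].
  apply: random_vectorM => i.
  have := @measurable_funB _ T R setT (cst (x i 0)) (mxcoord (X s) i) (measurable_cst _) (mX s s0 i).
  by congr measurable_fun; apply/funext => w; rewrite /mxcoord !mxE.
- move=> i; rewrite mxE [X in _ + X]mxE Lt mul1mx trmx1 mulmx1.
  rewrite -(qf_delta (P0 t)) -(qf_delta (_ *m _)) qf_congr.
  apply: (@le_trans _ _ (qf (P0 t) (delta_mx i 0))).
    by rewrite lerBlDr lerDl spd_ge0.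
  by apply: le_trans (Pb _) _; rewrite qf_delta mxE eqxx mulr1.
- exact: sigma_signal_past hF.
Qed.

End deviation.

Theorem theorem1p4 (R : realType) (r1 r2 : nat)
    (r1_ge1 : (1 <= r1)%N) (r2_ge1 : (1 <= r2)%N)
    (A : 'M[R]_r1) (C : 'M[R]_(r2, r1)) (R1 R1h : 'M[R]_r1) (R2 R2h : 'M[R]_r2)
    (R1_spd : spdmx R1) (R2_spd : spdmx R2)
    (R1h_sqrt : is_sym_sqrtmx R1 R1h) (R2h_sqrt : is_sym_sqrtmx R2 R2h)
    (AR1_ctrl : controllable A R1h) (AC_obs : observable A C)
    (S : 'M[R]_r1) (S_def : S = C^T *m invmx R2 *m C)
    (phi : R -> R -> 'M[R]_r1 -> 'M[R]_r1)
    (phi_flow : is_riccati_flow A S R1 phi) :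
  exists (beta : R) (alpha1 alpha2 : 'M[R]_r1 -> R),
    0 < beta /\
    forall (d : measure_display) (T : measurableType d) (P : probability T R)
      (W X : R -> T -> 'cV[R]_r1) (V Y : R -> T -> 'cV[R]_r2)
      (varphi : R -> R -> 'cV[R]_r1 -> T -> 'cV[R]_r1)
      (psi : R -> R -> 'cV[R]_r1 -> 'M[R]_r1 -> T -> 'cV[R]_r1),
    is_brownian P (fun t w => col_mx (W t w) (V t w)) ->
    indep_sigma P (sigma_rv (X 0))
      (sigma_process `[0, +oo[ (fun t w => col_mx (W t w) (V t w))) ->
    (forall i : 'I_r1,
       P.-integrable [set: T] (fun w => (X 0 w i 0 ^+ 2)%:E)) ->
    is_signal P A R1h W X ->
    is_observation P C R2h V X Y ->
    is_signal_flow P A R1h W varphi ->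
    is_filter_flow P A S C R2 phi Y psi ->
    forall (x : 'cV[R]_r1) (Q : 'M[R]_r1) (delta s t : R),
      spdmx Q -> 0 <= delta -> 0 <= s -> s <= t ->
      \forall w \ae P,
        1 - expR (- delta) <
        cond_prob P (sigma_rv (X s))
          [set w' | norm2 (psi s t x Q w' - varphi s t (X s w') w')
                    <= alpha1 Q * expR (- beta * (t - s)) * norm2 (x - X s w')
                       + alpha2 Q * (1 + delta + Num.sqrt delta)] w.
Proof.
have [beta beta0 hest] := riccati_estimates R1_spd R2_spd AC_obs S_def phi_flow.
have [a1 ha1] := choice hest; have [a2 ha2] := choice ha1.
(* With [a = delta + b Q] and [n = r1 + r2], the bound [2 r1 exp (n^2 a2 / 2 - a)]
   on the bad event is at most [exp (- 1 - delta)], because [2 r1 <= exp (2 r1)];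
   the summand 1 makes the final inequality strict. *)
pose b Q := 1 + r1%:R * 2 + (r1 + r2)%:R ^+ 2 / 2 * a2 Q.
exists beta, a1, (fun Q => r1%:R * (1 + b Q)); split=> // d T P W X V Y varphi psi
  hB hind _ hX hY hvarphi hpsi x Q delta s t hQ delta0 s0 st.
have [a1_gt0 a2_gt0 /(_ hQ s t s0 st) [Psym [L [Lt hL Ls Pt]]]] := ha2 Q.
have [mpsi [J [hJ psiE]]] := hpsi s x Q s0 hQ.
have [mX _] := hX.
have t0 := le_trans s0 st.
pose a := delta + b Q.
have b0 : 0 <= b Q by rewrite /b !addr_ge0 ?mulr_ge0 ?divr_ge0 ?exprn_ge0// ltW.
have a0 : 0 <= a by exact: addr_ge0.
have phiss : phi s s Q = Q by have [] := phi_flow s Q s0 hQ.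
have Ps : spdmx (phi s s Q) by rewrite phiss.
have hdev F (hF : sigma_rv (X s) F) := filter_deviation (b := a2 Q)
  R1h_sqrt R2h_sqrt R2_spd S_def hB hind hX hY a s0 st
  (riccati_flow_mxprim t phi_flow s0 hQ) Ps Psym Pt Lt hL mpsi hJ psiE hF.
set E := [set w' | _].
have mvarphi : random_vector (fun w => varphi s t (X s w) w).
  move=> i; have [mv _] := hvarphi s s0.
  exact: (measurable_flow_value (f := fun y w => varphi s t y w i 0) (mv t i st) (mX s s0)).
have mxX : random_vector (fun w => x - X s w).
  move=> i.
  have := @measurable_funB _ T R setT (cst (x i 0)) (mxcoord (X s) i) (measurable_cst _) (mX s s0 i).
  by congr measurable_fun; apply/funext => w; rewrite /mxcoord !mxE.
have mE : measurable E.
  rewrite -[X in measurable X]setTI; apply: measurable_fun_le => //.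
    by apply: measurable_norm2; apply: random_vectorB mvarphi; exact: mpsi.
  by apply: measurable_funD => //; apply: measurable_funM => //; exact: measurable_norm2.
have sXm : sigma_rv (X s) `<=` measurable.
  apply: sigma_rv_sub; first exact: sigma_algebra_measurable.
  by move=> i D mD; rewrite -[X in measurable X]setTI; exact: mX.
pose Z w := psi s t x Q w - X t w - L s *m (x - X s w).
pose bad := [set w | exists i, a <= `|Z w i 0|].
have mbad : measurable bad.
  have -> : bad = \bigcup_(i in [set: 'I_r1]) [set w | a <= `|Z w i 0|].
    by apply/seteqP; split => w /=; [move=> [i hi]; exists i | move=> [i _ hi]; exists i].
  apply: fin_bigcup_measurable => // i _.
  rewrite -[X in measurable X]setTI; apply: measurable_fun_le => //.
  apply: measurableT_comp => //.
  have mZ : random_vector Z.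
    apply: random_vectorB; last exact: random_vectorM.
    by apply: random_vectorB; [exact: mpsi|exact: mX].
  exact: mZ.
have good : \forall w \ae P, ~ bad w -> E w.
  apply: filterS (signal_flow_ae hB hX hvarphi s0 st) => w Xw hbad.
  rewrite /E /= -Xw (_ : psi s t x Q w - X t w = L s *m (x - X s w) + Z w); last first.
    by rewrite [RHS]addrC /Z subrK.
  apply: le_trans (norm2D _ _) _; apply: lerD; first exact: Ls.
  apply: (@le_trans _ _ (r1%:R * a)).
    apply: norm2_le_coord => // i; rewrite leNgt; apply/negP => /ltW h.
    by apply: hbad; exists i.
  rewrite -mulrA ler_wpM2l// /a.
  have : 0 <= b Q * (delta + Num.sqrt delta) by rewrite mulr_ge0// addr_ge0// sqrtr_ge0.
  have := sqrtr_ge0 delta; lra.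
pose eps := expR (- 1 - delta).
have heps : r1%:R * (2 * expR ((r1 + r2)%:R ^+ 2 / 2 * a2 Q - a)) <= eps.
  rewrite mulrA; apply: (@le_trans _ _ (expR (r1%:R * 2) * expR ((r1 + r2)%:R ^+ 2 / 2 * a2 Q - a))).
    rewrite ler_wpM2r ?expR_ge0//; apply: le_trans (expR_ge1Dx _).
    by rewrite lerDr.
  by rewrite -expRD ler_expR /a /b; lra.
have hE F : sigma_rv (X s) F -> (P (F `\` E) <= P F * eps%:E)%E.
  move=> hF; have mF := sXm _ hF.
  apply: (@le_trans _ _ (P (F `&` bad))).
    apply: le_probability_ae; [exact: measurableD|exact: measurableI|].
    apply: filterS good => w hw [Fw nE]; split => //.
    by apply: contrapT => /hw.
  apply: le_trans (hdev F hF) _.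
  by rewrite lee_wpmul2l// lee_fin.
have sX : sigma_algebra setT (sigma_rv (X s)) by exact: smallest_sigma_algebra.
have [p0 hp0] := cond_prob_exists P sX sXm mE.
have hp : is_cond_prob P (sigma_rv (X s)) E (cond_prob P (sigma_rv (X s)) E).
  by apply: xgetPex; exists p0.
apply: filterS (cond_prob_ge sXm mE hp hE) => w; apply: lt_le_trans.
by rewrite ltrD2l ltrN2 ltr_expR; lra.
Qed.
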